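(* Let $\ell\ge 3$ be an integer. If $H$ is a $3$-graph with maximum degree at most $\Delta$, then $$\mathrm{ex}(H,C_\ell^3)\ge \Delta^{-1+\frac1\ell-o(1)}\cdot e(H).$$ Moreover, if $\ell$ is even, then there exists a $3$-graph $H$ with at least one edge and maximum degree at most $\Delta$ such that $$\mathrm{ex}(H,C_\ell^3)\le \Delta^{-1+\frac1{\ell-1}+o(1)}\cdot e(H).$$
   Context: An $r$-graph is an $r$-uniform hypergraph; $e(H)$ is its number of edges; the maximum degree is the maximum number of edges containing a given vertex. $\mathrm{ex}(H,F)$ is the maximum number of edges in a subgraph of $H$ containing no subgraph isomorphic to $F$. The loose cycle $C_\ell^r$ is the $r$-graph with $\ell$ edges $e_1,\dots,e_\ell$ such that $e_i\cap e_{i+1}=\{v_i\}$ for $1\le i\le\ell$ with all $v_i$ distinct and indices cyclic, and $e_i\cap e_j=\emptyset$ for any other pair of indices $i\neq j$. Asymptotics are as $\Delta\to\infty$ with $\ell$ fixed. The first bound means: for every $\varepsilon>0$ there is $\Delta_0$ such that for all $\Delta\ge\Delta_0$ and all $3$-graphs $H$ with maximum degree at most $\Delta$ the inequality holds with $o(1)$ replaced by $\varepsilon$. The second means: for every $\varepsilon>0$ there is $\Delta_0$ such that for all $\Delta\ge\Delta_0$ such an $H$ exists satisfying the inequality with $o(1)$ replaced by $\varepsilon$. *)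

(* Defs.v *)
From mathcomp Require Import all_boot.

Set Implicit Arguments.
Unset Strict Implicit.
Unset Printing Implicit Defensive.

(* A hypergraph on the finite vertex type V is its edge set {set {set V}}. *)

Definition uniform (r : nat) (V : finType) (H : {set {set V}}) : Prop :=
  forall e : {set V}, e \in H -> #|e| = r.

Definition degree (V : finType) (H : {set {set V}}) (x : V) : nat :=
  #|[set e in H | x \in e]|.

Definition max_degree (V : finType) (H : {set {set V}}) : nat :=
  \max_(x : V) degree H x.

(* G has a (not necessarily induced) subgraph isomorphic to F. *)
Definition contains_copy (U V : finType) (F : {set {set U}})
    (G : {set {set V}}) : bool :=
  [exists f : {ffun U -> V},
    injectiveb f && [forall e in F, (f @: (e : {set U})) \in G]].

(* ex(H, F); the maximum is over a nonempty family as soon as F has an edge. *)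
Definition ex_in (U V : finType) (H : {set {set V}}) (F : {set {set U}}) : nat :=
  \max_(G : {set {set V}} | (G \subset H) && ~~ contains_copy F G) #|G|.

(* C is a copy of C_l^r, meaningful for l >= 3. Indices are cyclic: ordS i is
   i + 1 mod l. The condition on cover C rules out isolated vertices, so that C
   is determined up to isomorphism. *)
Definition loose_cycle (r l : nat) (U : finType) (C : {set {set U}}) : Prop :=
  uniform r C /\ cover C = [set: U] /\
  exists (e : 'I_l -> {set U}) (v : 'I_l -> U),
    injective e /\ C = [set e i | i : 'I_l] /\
    injective v /\
    (forall i, (e i :&: e (ordS i) = [set v i])) /\
    (forall i j, i != j -> j != ordS i -> i != ordS j ->
       (e i :&: e j = set0)).

Lemma ordS_neq (l : nat) (i : 'I_l) : 1 < l -> ordS i != i.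
Proof.
case: l i => [|l] // i hl; apply/eqP => /(congr1 val) /=.
have := ltn_ord i; rewrite ltnS leq_eqVlt => /orP[/eqP->|hi].
  by rewrite modnn => h; rewrite -h in hl.
by rewrite modn_small ?ltnS // => /eqP; rewrite eqn_leq ltnn.
Qed.

Lemma ordS2_neq (l : nat) (i : 'I_l) : 2 < l -> ordS (ordS i) != i.
Proof.
move=> hl; apply/eqP => /(congr1 val) /=.
rewrite -addn1 modnDml -[X in _ = X](modn_small (ltn_ord i)) addn1 -addn2.
rewrite -[X in _ = X %% l]addn0 => /eqP; rewrite eqn_modDl mod0n modn_small //.
Qed.

Lemma loose_cycle_exists (r l : nat) : 3 <= l ->
  exists C : {set {set 'I_l * 'I_r.+1}}, loose_cycle r.+2 l C.
Proof.
move=> hl; have hl1 : 1 < l by apply: ltnW.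
pose v (i : 'I_l) : 'I_l * 'I_r.+1 := (ordS i, ord0).
pose e (i : 'I_l) : {set 'I_l * 'I_r.+1} :=
  [set x | (x.1 == i) || (x == v i)].
have vinj : injective v by move=> i j [h]; apply: ordS_inj; apply: val_inj.
have inter i j x : i != j -> x \in (e i :&: e j) ->
    (i == ordS j) && (x == v j) || (j == ordS i) && (x == v i).
  move=> ij; rewrite !inE => /andP[/orP[/eqP xi|/eqP xi] /orP[/eqP xj|/eqP xj]].
  - by rewrite -xi -xj eqxx in ij.
  - by rewrite -xi xj /= !eqxx.
  - by rewrite -xj xi /= !eqxx orbT.
  - by move: ij; rewrite xi in xj; rewrite (vinj _ _ xj) eqxx.
have einj : injective e.
  move=> i j eij; apply/eqP/negPn/negP => ij.
  have vin : v i \in (e i :&: e j) by rewrite -eij setIid inE eqxx orbT.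
  have vjn : v j \in (e i :&: e j) by rewrite eij setIid inE eqxx orbT.
  have /orP[/andP[/eqP a /eqP/vinj b]|/andP[/eqP a _]] := inter _ _ _ ij vin.
    by rewrite b eqxx in ij.
  have /orP[/andP[/eqP b _]|/andP[_ /eqP/vinj b]] := inter _ _ _ ij vjn.
    by have := ordS2_neq i hl; rewrite -a -b eqxx.
  by rewrite b eqxx in ij.
exists [set e i | i : 'I_l]; split; [|split; [|exists e, v; do !split => //]].
- move=> _ /imsetP[i _ ->].
  have -> : e i = (v i |: setX [set i] [set: 'I_r.+1]).
    by apply/setP => x; rewrite !inE andbT orbC.
  by rewrite cardsU1 cardsX cards1 cardsT card_ord !inE /= andbT ordS_neq // mul1n.
- apply/setP => x; rewrite inE; apply/bigcupP; exists (e x.1).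
    exact: imset_f.
  by rewrite inE eqxx.
- move=> i; apply/setP => x; apply/idP/idP; last first.
    by rewrite !inE => /eqP ->; rewrite !eqxx orbT.
  move/inter; rewrite eq_sym ordS_neq // => /(_ isT) /orP[/andP[/eqP h _]|].
    by have := ordS2_neq i hl; rewrite -h eqxx.
  by rewrite !inE eqxx.
- move=> i j ij ji ij'; apply/setP => x; rewrite [RHS]inE; apply/negP.
  by move/(inter _ _ _ ij); rewrite (negPf ji) (negPf ij').
Qed.

(* Main.v *)
Require Import Defs.
From HB Require Import structures.
From mathcomp Require Import all_boot all_order all_algebra archimedean.
From mathcomp Require Import zify ring lra.

Set Implicit Arguments.
Unset Strict Implicit.
Unset Printing Implicit Defensive.

(* Lower bound.  Let D <= s^l bound the degrees.  If most edges contain only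
   pairs of codegree at most s, then H has at most |H| (3D)^(l-2) 9s closed
   chains of l edges, and a random subset of density about s^(1-l), with one
   edge removed from each surviving chain, is free of loose cycles.  Otherwise
   most edges contain a pair of codegree above s.  After a random bipartition of
   the vertices keep the edges having such a pair in one part and the third
   vertex in the other part, and among them those whose pairs belong to a heavy
   family of disjoint pairs.  In the result, two edges meeting in one vertex
   meet in the second part, where every edge has only one vertex, so there is no
   loose cycle.

   Upper bound, l = 2r.  With n = k^(l-2) = k q, take H to consist of the triples
   (x, y, (i, h(x, y, i))) for x, y < n and i < k, where h is a random function
   with values below q.  Then |H| = n^2 k and the degrees are O(n k).  A set F
   of the n^3 possible triples with |F| >> n^2 carries a measure on
   loose l-cycles with small marginals, so the container method covers all
   loose-cycle-free sets by exp(O(n k log^2 k)) sets of size O(n^2), and the union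
   bound shows that h meets each of them in O(n k log^2 k) triples.

   The measure comes from the random walk on the edges of F that alternately
   resamples the edge through its x-vertex and through its y-vertex.  Closed walks
   of length 2h have total weight at least 1, this weight is log-convex in h, and
   the closed walks that repeat a vertex, or meet a saturated set of edges, carry
   only a small proportion of it. *)

(** * Random functions *)

(** In the lower bound s is about D^(1/l), the value at which both cases lose the same factor
    O(s^(l-1)) = O(D^(1-1/l)). In the upper bound the degrees are about nk = k^(l-1), and a
    loose-cycle-free part has about nk of the n^2 k edges, a proportion 1/n = (nk)^(-1+1/(l-1));
    logarithms and constants go into the o(1). An alternating walk closes up only after an even
    number of steps, whence the parity of l. The exponent in n = k^(l-2) comes from the walk. Its
    vertices have degree about |F|/n, and codegrees are O(sqrt(degree)) once a suitable pair of the
    three vertex classes plays the part of x and y. So the ratio theta of codegree to degree is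
    O(sqrt(n/|F|)), which is O(n^(-1/2)) for |F| >> n^2, and closed walks of length 2 weigh O(sqrt
    n). The obstacle is a pattern that prescribes a short block of consecutive edges: a supremum
    bound gains only one theta, so such patterns are compared with shorter closed walks, which
    log-convexity controls if sqrt n <= k^(l/2-1). *)

Lemma leq_expl a b e : a <= b -> a ^ e <= b ^ e.
Proof. by move=> ab; case: e => [|e] //; rewrite leq_exp2r. Qed.

(** A substitute for Stirling's formula: a^a a! <= (2a)! = C(2a, a) (a!)^2, and the binomial
    coefficient is at most 4^a. *)
Lemma expnn_fact a : a ^ a <= a`! * 4 ^ a.
Proof.
have h b : a ^ b * a`! <= (a + b)`!.
  elim: b => [|b IH]; first by rewrite mul1n addn0.
  by rewrite expnS addnS factS -mulnA leq_mul // leqW // leq_addr.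
have h2 : (a + a)`! = 'C(a + a, a) * (a`! * a`!) by rewrite -{1}(@bin_fact (a + a) a) ?addnK // leq_addr.
have h3 : 'C(a + a, a) <= 4 ^ a.
  have : \sum_(i < (a + a).+1) 'C(a + a, i) = 2 ^ (a + a).
    have := expnDn 1 1 (a + a); rewrite add1n => ->.
    by apply: eq_bigr => i _; rewrite !exp1n !muln1.
  rewrite addnn -mul2n expnM => <-.
  have ha : a < (2 * a).+1 by lia.
  by rewrite (bigD1 (Ordinal ha)) //= leq_addr.
rewrite -(leq_pmul2r (fact_gt0 a)); apply: leq_trans (h a) _; rewrite h2.
by rewrite [a`! * 4 ^ a]mulnC -mulnA leq_mul2r h3 orbT.
Qed.

Section RandomChoice.
Variables (T Q : finType).
Implicit Types (h : {ffun T -> Q}) (C : T -> {set Q}).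

Definition hits C h := [set j | h j \in C j].

Lemma card_hit_on C a (f : {ffun 'I_a -> T}) : injective f ->
  #|[set h : {ffun T -> Q} | [forall i, f i \in hits C h]]| * #|Q| ^ a =
  #|Q| ^ #|T| * \prod_i #|C (f i)|.
Proof.
move=> fi.
pose w j q : nat := (j \in [set f i | i : 'I_a]) ==> (q \in C j).
have -> : #|[set h : {ffun T -> Q} | [forall i, f i \in hits C h]]| =
    \prod_j \sum_q w j q.
  rewrite bigA_distr_bigA /= -sum1_card big_mkcond /=; apply: eq_bigr => h _.
  rewrite inE; case: ifP => [/forallP H|/negP H].
    rewrite big1 // => j _; rewrite /w.
    case: imsetP => //= -[i _ ->].
    by have := H i; rewrite inE => ->.
  case: (pickP (fun i => f i \notin hits C h)) => [i hi|none]; last first.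
    by case: H; apply/forallP => i; have := none i => /negbFE.
  rewrite (bigD1 (f i)) //= /w imset_f //=.
  by move: hi; rewrite inE => /negPf ->.
rewrite (bigID (mem [set f i | i : 'I_a])) /=.
have -> : \prod_(j in [set f i | i : 'I_a]) \sum_q w j q = \prod_i #|C (f i)|.
  rewrite big_imset /=; last by move=> i j _ _ /fi.
  apply: eq_bigr => i _; rewrite -sum1_card [RHS]big_mkcond /=; apply: eq_bigr => q _.
  by rewrite /w imset_f //=; case: (q \in _).
have -> : \prod_(j | j \notin [set f i | i : 'I_a]) \sum_q w j q =
    #|Q| ^ #|[set j | j \notin [set f i | i : 'I_a]]|.
  rewrite -prod_nat_const; apply: eq_big => [j|j hj]; first by rewrite inE.
  rewrite -[RHS]sum1_card; apply: eq_bigr => q _; by rewrite /w (negPf hj).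
rewrite -mulnA mulnC -expnD; congr (_ ^ _ * _).
have ca : #|[set f i | i : 'I_a]| = a by rewrite card_imset ?card_ord.
rewrite -(cardsC [set f i | i : 'I_a]) ca addnC; congr (_ + _).
Qed.

(** Factorial moment: [a] or more hits give at least a! injective a-tuples of hits, and a fixed
    tuple is hit with the product of the probabilities. Dropping injectivity turns the sum of these
    products into a power. *)
Lemma bad_count C a :
  #|[set h : {ffun T -> Q} | a <= #|hits C h|]| * (a`! * #|Q| ^ a) <=
  #|Q| ^ #|T| * (\sum_j #|C j|) ^ a.
Proof.
set bad := [set h | _].
pose good (h : {ffun T -> Q}) (f : {ffun 'I_a -> T}) :=
  injectiveb f && [forall i, f i \in hits C h].
have h1 : #|bad| * a`! <= \sum_(h : {ffun T -> Q}) \sum_(f | good h f) 1.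
  rewrite -sum1_card big_distrl /= big_mkcond /=.
  apply: leq_sum => h _; case: ifP => //; rewrite inE mul1n => ha.
  rewrite sum1_card.
  have -> : #|[pred f | good h f]| = #|hits C h| ^_ a.
    have := card_inj_ffuns_on 'I_a (mem (hits C h)); rewrite card_ord => <-.
    apply: eq_card => f; rewrite inE [RHS]inE [LHS]andbC; congr (_ && _).
  by rewrite -bin_ffact leq_pmull // bin_gt0.
apply: leq_trans (_ : (\sum_(h : {ffun T -> Q}) \sum_(f | good h f) 1) * #|Q| ^ a <= _).
  by rewrite mulnA leq_mul2r h1 orbT.
rewrite (exchange_big_dep (fun f : {ffun 'I_a -> T} => injectiveb f)) /=; last first.
  by move=> h f _ /andP[].
have -> : (\sum_j #|C j|) ^ a = \sum_(f : {ffun 'I_a -> T}) \prod_i #|C (f i)|.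
  by rewrite -(bigA_distr_bigA (fun (_ : 'I_a) j => #|C j|)) prod_nat_const card_ord.
rewrite big_distrl big_distrr /= [X in _ <= X](bigID (fun f : {ffun 'I_a -> T} => injectiveb f)) /=.
apply: leq_trans (leq_addr _ _); apply: leq_sum => f /injectiveP fi.
rewrite -(card_hit_on C fi) leq_mul2r; apply/orP; right.
rewrite sum1_card; apply/subset_leq_card/subsetP => h.
by rewrite !inE => /andP[].
Qed.

(** With S the sum of the cardinals, the tail is at most (S / |Q|)^a / a! <= (a/8)^a / a!, and
    [expnn_fact] leaves (4/8)^a. *)
Lemma bad_small C a : 0 < #|Q| -> 8 * \sum_j #|C j| <= a * #|Q| ->
  #|[set h : {ffun T -> Q} | a <= #|hits C h|]| * 2 ^ a <= #|Q| ^ #|T|.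
Proof.
move=> Q0 hS; set bad := #|_|; set S := \sum_j _ in hS.
have w0 : 0 < a`! * #|Q| ^ a by rewrite muln_gt0 fact_gt0 expn_gt0 Q0.
rewrite -(leq_pmul2r w0).
have h1 : 2 ^ a * S ^ a <= a`! * #|Q| ^ a.
  have p4 : 0 < 4 ^ a by rewrite expn_gt0.
  rewrite -(leq_pmul2r p4) -!expnMn.
  have -> : 2 * S * 4 = 8 * S by lia.
  apply: leq_trans (_ : (a * #|Q|) ^ a <= _).
    by case: (a) hS => [|b] // hS; rewrite leq_exp2r.
  by rewrite expnMn mulnAC leq_mul2r expnn_fact orbT.
apply: leq_trans (_ : #|Q| ^ #|T| * S ^ a * 2 ^ a <= _).
  by rewrite mulnAC leq_mul2r bad_count orbT.
by rewrite -mulnA leq_mul2l [S ^ a * _]mulnC h1 orbT.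
Qed.

(** Union bound; the failure probabilities 2^(-a i) are scaled by 2^N to stay in [nat]. *)
Lemma exists_choice (I : eqType) (cs : seq I) (C : I -> T -> {set Q}) (a : I -> nat) (N : nat) :
  0 < #|Q| -> (forall i, i \in cs -> 8 * \sum_j #|C i j| <= a i * #|Q|) ->
  (forall i, i \in cs -> a i <= N) -> \sum_(i <- cs) 2 ^ (N - a i) < 2 ^ N ->
  exists h : {ffun T -> Q}, forall i, i \in cs -> #|hits (C i) h| < a i.
Proof.
move=> Q0 hS hN hs.
pose bad i := [set h : {ffun T -> Q} | a i <= #|hits (C i) h|].
have hb i : i \in cs -> #|bad i| * 2 ^ N <= 2 ^ (N - a i) * #|Q| ^ #|T|.
  move=> ic; rewrite -[in 2 ^ N](subnK (hN i ic)) expnD mulnCA leq_mul2l.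
  by rewrite bad_small ?orbT // hS.
have [h hh|none] := pickP (fun h : {ffun T -> Q} => h \notin \bigcup_(i <- cs) bad i).
  exists h => i ic; rewrite ltnNge; apply/negP => ha; case/negP: hh.
  by rewrite (big_rem i ic) /= inE inE ha.
have full : \bigcup_(i <- cs) bad i = [set: {ffun T -> Q}].
  by apply/setP => h; have := none h; rewrite inE => /negbFE ->.
have h1 : #|[set: {ffun T -> Q}]| <= \sum_(i <- cs) #|bad i|.
  rewrite -full; elim/big_rec2: _ => [|i x A _ h]; first by rewrite cards0.
  by apply: leq_trans (leq_card_setU _ _) _; rewrite leq_add2l.
have h2 : (\sum_(i <- cs) #|bad i|) * 2 ^ N <= (\sum_(i <- cs) 2 ^ (N - a i)) * #|Q| ^ #|T|.
  rewrite !big_distrl /= big_seq [X in _ <= X]big_seq.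
  by apply: leq_sum => i ic; rewrite hb.
have : #|Q| ^ #|T| * 2 ^ N <= (\sum_(i <- cs) 2 ^ (N - a i)) * #|Q| ^ #|T|.
  apply: leq_trans h2; rewrite leq_mul2r; apply/orP; right.
  by apply: leq_trans h1; rewrite cardsT card_ffun.
by rewrite mulnC leq_pmul2r ?expn_gt0 ?Q0 // leqNgt hs.
Qed.

End RandomChoice.

(** * Loose cycles and the random host *)

(** [v i] is the vertex common to [e i] and [e (ordS i)], [w i] the private vertex of [e i]; the
    edge listed at index [i] is [e (ordS i)]. The last clause allows an embedding to be defined by
    its values on [v] and [w]. *)
Lemma loose_cycle_coords (U : finType) (C : {set {set U}}) l :
  2 < l -> loose_cycle 3 l C ->
  exists v w : 'I_l -> U,
    [/\ C = [set [set v i; v (ordS i); w (ordS i)] | i : 'I_l],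
        injective v, injective w, forall i j, v i != w j &
        forall u, (exists i, u = v i) \/ (exists i, u = w i)].
Proof.
move=> hl [unif [cov [e [v [einj [CE [vinj [inter disj]]]]]]]].
have c3 i : #|e i| = 3 by apply: unif; rewrite CE imset_f.
have vi i : v i \in e i by have : v i \in e i :&: e (ordS i); [rewrite inter set11|rewrite inE => /andP[]].
have vS i : v i \in e (ordS i) by have : v i \in e i :&: e (ordS i); [rewrite inter set11|rewrite inE => /andP[]].
have vp i : v (ord_pred i) \in e i by have := vS (ord_pred i); rewrite ord_predK.
have vneq i : v i != v (ord_pred i).
  apply/eqP => /vinj h; have := ordS_neq (ord_pred i) (ltnW hl).
  by rewrite ord_predK {1}h eqxx.
have hw i : exists u, e i :\ v i :\ v (ord_pred i) == [set u].
  have : #|e i :\ v i :\ v (ord_pred i)| == 1.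
    have := cardsD1 (v i) (e i); rewrite vi c3.
    have := cardsD1 (v (ord_pred i)) (e i :\ v i).
    rewrite !inE vp andbT eq_sym vneq; lia.
  by case/cards1P => u ->; exists u.
pose w i := xchoose (hw i).
have wE i : e i :\ v i :\ v (ord_pred i) = [set w i] by apply/eqP; exact: (xchooseP (hw i)).
have wP i : [/\ w i \in e i, w i != v i & w i != v (ord_pred i)].
  have : w i \in e i :\ v i :\ v (ord_pred i) by rewrite wE set11.
  by rewrite !inE => /and3P[].
have eE i : e i = [set v (ord_pred i); v i; w i].
  apply/setP => u; have := wE i => /setP/(_ u); rewrite !inE.
  have [->|_] := eqVneq u (v (ord_pred i)); first by rewrite vp.
  by have [->|_] := eqVneq u (v i); first by rewrite vi.
have eSE i : e (ordS i) = [set v i; v (ordS i); w (ordS i)].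
  by rewrite eE ordSK.
have common i j u : i != j -> u \in e i -> u \in e j ->
    (u = v i /\ j = ordS i) \/ (u = v j /\ i = ordS j).
  move=> ij ui uj; have [ji|ji] := eqVneq i (ordS j).
    right; split=> //; have : u \in e j :&: e (ordS j) by rewrite inE uj -ji.
    by rewrite inter inE => /eqP.
  have [ij'|ij'] := eqVneq j (ordS i).
    left; split=> //; have : u \in e i :&: e (ordS i) by rewrite inE ui -ij'.
    by rewrite inter inE => /eqP.
  by have := disj i j ij ij' ji => /setP/(_ u); rewrite !inE ui uj.
exists v, w; split=> //.
- rewrite CE; apply/setP => A; apply/imsetP/imsetP => [[i _ ->]|[i _ ->]].
    by exists (ord_pred i); rewrite // -eSE ord_predK.
  by exists (ordS i).
- move=> i j wij; apply/eqP/negPn/negP => ij.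
  have [wi wiv _] := wP i; have [wj wjv _] := wP j.
  have wj' : w i \in e j by rewrite wij.
  case: (common i j (w i) ij wi wj') => -[h _]; first by rewrite h eqxx in wiv.
  by rewrite -wij h eqxx in wjv.
- move=> i j; apply/eqP => vw.
  have [wj wjv wjp] := wP j; rewrite -vw in wj wjv wjp.
  have [ij|ij] := eqVneq i j; first by rewrite ij eqxx in wjv.
  case: (common i j (v i) ij (vi i) wj) => -[h h'].
    by rewrite h' ordSK eqxx in wjp.
  by rewrite (vinj _ _ h) eqxx in ij.
- move=> u; have : u \in cover C by rewrite cov inE.
  rewrite CE => /bigcupP[_ /imsetP[i _ ->]]; rewrite eE !inE -orbA.
  by case/or3P => /eqP ->; [left; exists (ord_pred i)|left; exists i|right; exists i].
Qed.

Section RandomHypergraph.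
Variables (n k q : nat).
Notation E := ('I_n * 'I_n * ('I_k * 'I_q))%type.
Notation V := ('I_n + 'I_n + ('I_k * 'I_q))%type.
Notation T := ('I_n * 'I_n * 'I_k)%type.

(* The triple ((x, y), (i, j)) stands for the edge {x, y, (i, j)} with x, y and
   (i, j) in three disjoint vertex classes. *)
Definition vx (e : E) : V := inl (inl e.1.1).
Definition vy (e : E) : V := inl (inr e.1.2).
Definition vz (e : E) : V := inr e.2.
Definition tri (e : E) : {set V} := [set vx e; vy e; vz e].

Definition graph (h : {ffun T -> 'I_q}) : {set E} := [set e | h (e.1, e.2.1) == e.2.2].

(** A triple of [D] lies in [graph h] exactly when [h] hits the corresponding slice, so the bounds
    for random functions apply to [graph h :&: D]. *)
Definition slice (D : {set E}) (j : T) : {set 'I_q} := [set i | (j.1, (j.2, i)) \in D].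

Lemma sum_slice D : \sum_j #|slice D j| = #|D|.
Proof.
rewrite -sum1_card.
rewrite (reindex (fun p : T * 'I_q => (p.1.1, (p.1.2, p.2)) : E)) /=; last first.
  by exists (fun e : E => ((e.1, e.2.1), e.2.2)) => [[[a b] c]|[a [b c]]] _.
rewrite [RHS](eq_bigl (fun p : T * 'I_q => (xpredT p.1) && (p.2 \in slice D p.1))); last first.
  by move=> p; rewrite inE.
rewrite -(pair_big_dep xpredT (fun j i => i \in slice D j) (fun _ _ => 1)) /=.
by apply: eq_bigr => j _; rewrite sum1_card.
Qed.

Lemma hits_slice D h : #|hits (slice D) h| = #|graph h :&: D|.
Proof.
have inj : injective (fun j : T => (j.1, (j.2, h j)) : E) by move=> [a b] [c d] [-> ->].
rewrite -(card_imset _ inj); apply: eq_card => e; rewrite !inE.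
apply/imsetP/andP => [[j]|[/eqP he De]].
  rewrite !inE => hj -> /=; split=> //; by case: (j).
exists (e.1, e.2.1); first by rewrite !inE /= he; case: (e) De => [a [b c]].
by rewrite /= he; case: (e) => [a [b c]].
Qed.

Lemma card_graph h : #|graph h| = n * n * k.
Proof.
have inj : injective (fun j : T => (j.1, (j.2, h j)) : E) by move=> [a b] [c d] [-> ->].
have := card_imset [set: T] inj; rewrite cardsT !card_prod !card_ord => <-.
apply: eq_card => e; rewrite !inE; apply/eqP/imsetP => [he|[j _ ->]] /=.
  by exists (e.1, e.2.1) => //=; rewrite ?inE // he; case: (e) => [a [b c]].
by case: (j).
Qed.

Lemma tri_inj : injective tri.
Proof.
move=> [[x y] z] [[x' y'] z'] /setP h.
have := h (inl (inl x)); have := h (inl (inr y)); have := h (inr z).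
rewrite /tri /vx /vy /vz !inE !(inj_eq (@inl_inj _ _)) !(inj_eq (@inr_inj _ _)) /= !eqxx /=.
by rewrite ?orbF ?orbT /= => /esym/eqP -> /esym/eqP -> /esym/eqP ->.
Qed.

Lemma tri_uniform (A : {set E}) : uniform 3 (tri @: A).
Proof.
move=> _ /imsetP[e _ ->]; rewrite /tri /vx /vy /vz.
by rewrite setUC cardsU1 !inE cards2.
Qed.

Lemma degree_tri (A : {set E}) v : degree (tri @: A) v = #|[set e in A | v \in tri e]|.
Proof.
rewrite /degree -(card_imset _ tri_inj); apply: eq_card => S; rewrite inE.
apply/andP/imsetP => [[/imsetP[e eA ->] ve]|[e]]; first by exists e; rewrite // inE eA.
by rewrite inE => /andP[eA ve] ->; rewrite imset_f.
Qed.

Lemma max_degree_graph h d : n * k <= d ->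
  (forall z, #|graph h :&: [set e | e.2 == z]| <= d) -> max_degree (tri @: graph h) <= d.
Proof.
move=> nk hd; apply/bigmax_leqP => v _; rewrite degree_tri.
case: v => [[x|y]|z].
- apply: leq_trans nk.
  have inj : injective (fun j : 'I_n * 'I_k => ((x, j.1), (j.2, h ((x, j.1), j.2))) : E).
    by move=> [a b] [c d'] [-> ->].
  have := card_imset [set: 'I_n * 'I_k] inj; rewrite cardsT !card_prod !card_ord => <-.
  apply/subset_leq_card/subsetP => -[[a b] [c i]].
  rewrite !inE /= => /andP[/eqP hi /orP[/orP[]|] /eqP // [xa]].
  by apply/imsetP; exists (b, c); rewrite ?inE //= xa hi.
- apply: leq_trans nk.
  have inj : injective (fun j : 'I_n * 'I_k => ((j.1, y), (j.2, h ((j.1, y), j.2))) : E).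
    by move=> [a b] [c d'] [-> ->].
  have := card_imset [set: 'I_n * 'I_k] inj; rewrite cardsT !card_prod !card_ord => <-.
  apply/subset_leq_card/subsetP => -[[a b] [c i]].
  rewrite !inE /= => /andP[/eqP hi]; rewrite orbF => /eqP[yb].
  by apply/imsetP; exists (a, c); rewrite ?inE //= yb hi.
- apply: leq_trans (hd z); apply/subset_leq_card/subsetP => e; rewrite !inE /=.
  by case/andP=> ->; rewrite /vz => /eqP[->] /=.
Qed.

(** Two families of events: the sets of [cs] with threshold [m], and the n vertices of the third
    class, whose expected degree is n^2 / q = n k, with threshold 8 n k. Each family gets half of
    the failure budget. *)
Lemma random_graph (cs : seq {set E}) (m : nat) :
  n = k * q -> 0 < n -> 8 * n * k <= m -> (size cs).*2 < 2 ^ m ->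
  (forall D, D \in cs -> 8 * #|D| <= m * q) ->
  exists h, (forall D, D \in cs -> #|graph h :&: D| < m) /\
            (forall z, #|graph h :&: [set e | e.2 == z]| < 8 * n * k).
Proof.
move=> nkq n0 hm hcs hD.
have k0 : 0 < k by move: n0; rewrite nkq muln_gt0 => /andP[].
have q0 : 0 < q by move: n0; rewrite nkq muln_gt0 => /andP[].
pose C (i : {set E} + ('I_k * 'I_q)) : {set E} :=
  match i with inl D => D | inr z => [set e | e.2 == z] end.
pose a (i : {set E} + ('I_k * 'I_q)) : nat := match i with inl _ => m | inr _ => 8 * n * k end.
pose ix := map inl cs ++ map inr (enum {: 'I_k * 'I_q}).
have [||||h hh] := @exists_choice T 'I_q _ ix (fun i => slice (C i)) a m.
- by rewrite card_ord.
- move=> i; rewrite mem_cat sum_slice card_ord => /orP[|] /mapP[x xc ->] /=; first exact: hD.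
  have -> : #|[set e : E | e.2 == x]| = n * n.
    have := card_imset [set: 'I_n * 'I_n] (_ : injective (fun p => (p, x) : E)).
    rewrite cardsT card_prod card_ord => <-; last by move=> p p' [].
    apply: eq_card => e; rewrite !inE; apply/eqP/imsetP => [<-|[p _ ->]] //.
    by exists e.1; rewrite ?inE // -surjective_pairing.
  by rewrite {2}nkq; nia.
- by move=> i; rewrite mem_cat => /orP[|] /mapP[x xc ->] /=.
- rewrite big_cat !big_map /= subnn.
  rewrite [X in X + _](_ : _ = size cs); last by rewrite -sum1_size; apply: eq_bigr.
  have sz : size (enum {: 'I_k * 'I_q}) = n by rewrite -cardE card_prod !card_ord.
  rewrite big_const_seq iter_addn_0 count_predT -?enumT sz.
  have h2 : n.*2 <= 2 ^ (8 * n * k).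
    apply: leq_trans (_ : 2 ^ n.+1 <= _); first by rewrite expnS mul2n leq_double ltnW // ltn_expl.
    by rewrite leq_exp2l //; nia.
  have : n.*2 * 2 ^ (m - 8 * n * k) <= 2 ^ m.
    by rewrite -[X in _ <= 2 ^ X](subnKC hm) expnD leq_mul2r h2 orbT.
  move: hcs; rewrite mulnC -!muln2; move: (2 ^ (m - _)) (2 ^ m) => u v; nia.
exists h; split=> [D Dc|z].
  by have := hh (inl D); rewrite hits_slice => -> //; rewrite mem_cat map_f.
by have := hh (inr z); rewrite hits_slice => -> //; rewrite mem_cat orbC map_f // mem_enum.
Qed.

End RandomHypergraph.

(** * The lower bound *)

Fixpoint nsum (T : finType) n (F : seq T -> nat) : nat :=
  if n is n'.+1 then \sum_x nsum n' (fun s => F (x :: s)) else F [::].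

Section Nsum.
Variable T : finType.
Implicit Types (F : seq T -> nat) (s : seq T).

Lemma leq_nsum n F F' : (forall s, size s = n -> F s <= F' s) -> nsum n F <= nsum n F'.
Proof.
elim: n F F' => [|n IH] F F' h /=; first exact: h.
by apply: leq_sum => x _; apply: IH => s hs; apply: h; rewrite /= hs.
Qed.

Lemma nsum0 n : nsum n (fun _ : seq T => 0) = 0.
Proof. by elim: n => //= n IH; rewrite big1. Qed.

Lemma eq_nsum n F F' : (forall s, size s = n -> F s = F' s) -> nsum n F = nsum n F'.
Proof.
by move=> h; apply/eqP; rewrite eqn_leq !leq_nsum // => s /h ->.
Qed.

Lemma nsum_sum (I : finType) n (F : I -> seq T -> nat) :
  \sum_i nsum n (F i) = nsum n (fun s => \sum_i F i s).
Proof.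
elim: n F => [|n IH] F //=; rewrite exchange_big /=.
by apply: eq_bigr => x _; rewrite IH.
Qed.

Lemma nsumMr n F m : nsum n F * m = nsum n (fun s => F s * m).
Proof.
elim: n F => [|n IH] F //=; rewrite big_distrl /=.
by apply: eq_bigr => x _; rewrite IH.
Qed.

Lemma nsum_gt0 n F s : size s = n -> 0 < F s -> 0 < nsum n F.
Proof.
elim: n F s => [|n IH] F [|x s] //= [hs] Fs.
by rewrite (bigD1 x) //= addn_gt0 (IH (fun s => F (x :: s)) s).
Qed.

End Nsum.

Lemma seq_hit (T Q : finType) (C : T -> {set Q}) (t : seq T) : uniq t ->
  #|[set h : {ffun T -> Q} | all (fun j => h j \in C j) t]| * #|Q| ^ size t =
  #|Q| ^ #|T| * \prod_(j <- t) #|C j|.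
Proof.
move=> ut; pose f := [ffun i => tnth (in_tuple t) i].
have fi : injective f by move=> i j; rewrite !ffunE => /tuple_uniqP; apply; rewrite in_tupleE.
have -> : \prod_(j <- t) #|C j| = \prod_i #|C (f i)|.
  by rewrite big_tnth; apply: eq_bigr => i _; rewrite ffunE.
rewrite -(card_hit_on C fi); congr (_ * _); apply: eq_card => h; rewrite !inE.
apply/allP/forallP => [H i|H j jt].
  by rewrite inE; apply: H; rewrite ffunE; apply: mem_tnth.
have /tnthP[i ->] : j \in in_tuple t by [].
by have := H i; rewrite inE ffunE.
Qed.

(** Deletion method: a random colouring with [c] colours keeps each element with probability 1/c,
    and the first entry of each surviving bad tuple is removed. In expectation |H| / c elements are
    kept, and the surviving bad tuples number at most half of that. *)
Lemma sampling (T : finType) (H : {set T}) (bad : seq T -> bool) l c :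
  0 < c -> (forall t, bad t -> uniq t) ->
  2 * nsum l.+1 bad <= #|H| * c ^ l ->
  exists G : {set T}, [/\ G \subset H, #|H| <= 2 * c * #|G| &
    forall t, size t = l.+1 -> all (mem G) t -> ~~ bad t].
Proof.
case: c => [//|c] _ ub hN.
pose col (h : {ffun T -> 'I_c.+1}) e := h e \in [set ord0].
pose G0 h := [set e in H | col h e].
pose b h t := bad t && all (col h) t.
pose B h := nsum l.+1 (b h).
pose W := c.+1 ^ #|T|.
have mono (t : seq T) : uniq t -> #|[set h | all (col h) t]| * c.+1 ^ size t = W.
  move=> ut; have := @seq_hit T 'I_c.+1 (fun=> [set ord0]) t ut.
  by rewrite big1 ?card_ord ?muln1 // => j _; rewrite cards1.
have sG : (\sum_h #|G0 h|) * c.+1 = #|H| * W.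
  have -> : \sum_h #|G0 h| = \sum_(e in H) #|[set h | all (col h) [:: e]]|.
    under eq_bigr do rewrite -sum1_card.
    rewrite (exchange_big_dep (mem H)) /=; last by move=> h e _; rewrite inE => /andP[].
    apply: eq_bigr => e eH; rewrite -sum1_card; apply: eq_bigl => h.
    by rewrite !inE eH /= andbT.
  rewrite big_distrl /= (eq_bigr (fun=> W)) ?sum_nat_const // => e _.
  by have := mono [:: e] isT; rewrite expn1.
have sB : (\sum_h B h) * c.+1 ^ l.+1 = nsum l.+1 bad * W.
  rewrite nsum_sum !nsumMr; apply: eq_nsum => t ht.
  have [bt|nb] := boolP (bad t); last by rewrite big1 // => h _; rewrite /b (negPf nb).
  rewrite mul1n -(mono t (ub t bt)) ht; congr (_ * _).
  rewrite -sum1_card [RHS]big_mkcond /=; apply: eq_bigr => h _.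
  by rewrite /b bt inE; case: (all _ _).
have [m mE] : exists m, m = 2 * c.+1 by eexists.
have [h hh|none] := pickP (fun h => #|H| + m * B h <= m * #|G0 h|); last first.
  have W0 : 0 < W by rewrite expn_gt0.
  have : \sum_h (m * #|G0 h| + 1) <= \sum_h (#|H| + m * B h).
    by apply: leq_sum => h _; rewrite addn1 ltnNge none.
  rewrite !big_split /= -!big_distrr /= !sum_nat_const card_ffun card_ord -/W muln1.
  have -> : m * \sum_i #|G0 i| = 2 * (#|H| * W) by rewrite -sG mE; ring.
  have h2 : m * \sum_i B i <= #|H| * W.
    rewrite -(leq_pmul2r (_ : 0 < c.+1 ^ l)) ?expn_gt0 //.
    have -> : m * (\sum_i B i) * c.+1 ^ l = 2 * nsum l.+1 bad * W.
      by rewrite -[RHS]mulnA -sB mE expnS; ring.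
    by rewrite [X in _ <= X]mulnAC leq_mul2r hN orbT.
  have aux u v w : 0 < w -> v <= u -> 2 * u + w <= u + v -> False by clear; lia.
  by rewrite [W * _]mulnC => /(aux _ _ _ W0 h2).
rewrite -mE.
pose D := [set e | 0 < nsum l (fun s => b h (e :: s))].
have cD : #|D| <= B h.
  rewrite /B /= -sum1_card big_mkcond /=; apply: leq_sum => e _.
  by rewrite inE; case: (nsum _ _).
exists (G0 h :\: D); split.
- by apply/subsetP => e; rewrite !inE => /and3P[].
- have : #|G0 h| <= #|G0 h :\: D| + #|D|.
    by rewrite -(cardsID D (G0 h)) addnC leq_add2l subset_leq_card // subsetIr.
  move=> h1; have : m * #|G0 h| <= m * (#|G0 h :\: D| + B h).
    by rewrite leq_mul2l (leq_trans h1) ?orbT // leq_add2l.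
  rewrite mulnDr; lia.
- move=> [//|e s] [hs] aG; apply/negP => bt.
  have : e \in G0 h :\: D by move: aG => /= /andP[].
  rewrite inE => /andP[/negP[]]; rewrite inE.
  have bt' : b h (e :: s).
    by rewrite /b bt; apply: sub_all aG => x /=; rewrite !inE => /and3P[].
  by apply: (nsum_gt0 hs); rewrite bt'.
Qed.

(** Greedy choice: take an element of largest weight and discard the at most [d] elements in
    conflict with it, itself included; none of them weighs more. *)
Lemma disjoint_subfamily (T : finType) (conf : rel T) (w : T -> nat) d (S : {set T}) :
  symmetric conf ->
  (forall x, x \in S -> conf x x) ->
  (forall x, x \in S -> #|[set y in S | conf x y]| <= d) ->
  exists M : {set T}, [/\ M \subset S,
    (forall x y, x \in M -> y \in M -> conf x y -> x = y) &
    \sum_(x in S) w x <= d * \sum_(x in M) w x].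
Proof.
move=> cs; have [m] := ubnP #|S|; elim: m S => // m IH S; rewrite ltnS => Sm cr hd.
have [S0|[x0 x0S]] := set_0Vmem S.
  by exists set0; split; [rewrite sub0set|move=> x y; rewrite inE|rewrite S0 !big_set0].
have [x xS xmax] : exists2 x, x \in S & forall y, y \in S -> w y <= w x.
  by case: (arg_maxnP w x0S) => x xS xmax; exists x.
pose N := [set y in S | conf x y].
have NS : N \subset S by apply/subsetP => y; rewrite inE => /andP[].
have [||y|M [MS Mi Mw]] := IH (S :\: N).
- apply: leq_trans Sm; apply: proper_card; apply/properP; split; first exact: subsetDl.
  by exists x => //; rewrite !inE xS cr.
- by move=> y; rewrite inE => /andP[_]; apply: cr.
- rewrite inE => /andP[_ yS]; apply: leq_trans (hd y yS).
  apply/subset_leq_card/subsetP => z; rewrite !inE => /andP[/andP[_ ->] ->] //.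
have xM : x \notin M.
  by apply/negP => /(subsetP MS); rewrite !inE xS cr.
have cx y : y \in M -> conf x y = false.
  by move=> /(subsetP MS); rewrite !inE => /andP[h yS]; rewrite yS /= in h; apply/negbTE.
exists (x |: M); split.
- by rewrite subUset sub1set xS (subset_trans MS) ?subsetDl.
- move=> y z; rewrite !inE => /orP[/eqP->|yM] /orP[/eqP->|zM] //; last exact: Mi.
    by rewrite cx.
  by rewrite cs cx.
- rewrite big_setU1 //= mulnDr (big_setID N) /=; apply: leq_add => //.
  rewrite (setIidPr NS); apply: (@leq_trans (\sum_(y in N) w x)).
    by apply: leq_sum => y; rewrite inE => /andP[yS _]; apply: xmax.
  by rewrite sum_nat_const leq_mul2r hd ?orbT.
Qed.

Lemma copy_coords (U V : finType) (C : {set {set U}}) (G : {set {set V}}) l :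
  2 < l -> loose_cycle 3 l C -> contains_copy C G ->
  exists a b : 'I_l -> V,
    [/\ injective a, injective b, forall i j, a i != b j &
        forall i, [set a i; a (ordS i); b (ordS i)] \in G].
Proof.
move=> l2 /(loose_cycle_coords l2)[v [w [-> vi wi vw _]]].
case/existsP=> f /andP[/injectiveP fi /forall_inP fG].
exists (f \o v), (f \o w); split=> [i j /fi/vi|i j /fi/wi|i j|i] //=.
  by rewrite (inj_eq fi).
by have := fG _ (imset_f _ (isT : i \in predT)); rewrite !imsetU !imset_set1.
Qed.

Lemma leq_card_cover (I T : finType) (P : pred I) (A : {set T}) (B : I -> {set T}) :
  (forall x, x \in A -> exists2 i, P i & x \in B i) -> #|A| <= \sum_(i | P i) #|B i|.
Proof.
move=> h; under eq_bigr do rewrite -sum1_card big_mkcond /=.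
rewrite exchange_big -sum1_card big_mkcond /=; apply: leq_sum => x _.
by case: ifP => // /h[i Pi xi]; rewrite (bigD1 i) //= xi.
Qed.

Definition codegree (V : finType) (H : {set {set V}}) (p : {set V}) : nat :=
  #|[set f in H | p \subset f]|.

Section ClosingWalks.
Variables (T : finType) (r : rel T) (cl : T -> T -> pred T).

(** All steps but the last obey [r]; the last obeys [cl], which also sees the starting element [e0]
    and so can require the walk to close up. *)
Fixpoint closing e0 e s : bool :=
  if s is f :: s' then
    if s' is [::] then cl e0 e f else r e f && closing e0 f s'
  else false.

Lemma closing_count (P : pred T) d M m e0 e :
  (forall e f, P e -> r e f -> P f) ->
  (forall e, P e -> #|[set f | r e f]| <= d) ->
  (forall e e', P e -> P e' -> #|[set f | cl e e' f]| <= M) ->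
  P e0 -> P e -> nsum m.+1 (closing e0 e) <= d ^ m * M.
Proof.
move=> Pr hd hM P0; elim: m e => [|m IH] e Pe.
  rewrite mul1n; apply: leq_trans (hM e0 e P0 Pe).
  by rewrite -sum1_card [X in _ <= X]big_mkcond /=; apply: leq_sum => f _; rewrite inE; case: (cl _ _ _).
rewrite expnS -mulnA; apply: leq_trans (_ : \sum_(f | r e f) d ^ m * M <= _); last first.
  by rewrite sum_nat_cond_const leq_mul2r hd ?orbT.
rewrite [X in _ <= X]big_mkcond; apply: leq_sum => f _.
rewrite -[X in X <= _]/(nsum m.+1 (fun s => closing e0 e (f :: s))).
have [ef|nef] := boolP (r e f).
  apply: leq_trans (IH f (Pr e f Pe ef)).
  by apply: leq_nsum => -[//|g s] _; rewrite /= ef.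
rewrite -[X in _ <= X](nsum0 T m.+1).
by apply: leq_nsum => -[//|g s] _; rewrite /= (negPf nef).
Qed.

End ClosingWalks.

Section Lower.
Variables (U V : finType) (C : {set {set U}}) (m : nat).
Notation l := m.+2.
Hypotheses (m0 : 0 < m) (hC : loose_cycle 3 l C).
Variables (H : {set {set V}}) (D s : nat).
Hypotheses (unif : uniform 3 H) (maxD : max_degree H <= D).
Hypotheses (s0 : 0 < s) (Ds : D <= s ^ l).

Lemma degree_le x : degree H x <= D.
Proof. by apply: leq_trans maxD; apply: (leq_bigmax x). Qed.

Section SmallCodegree.
Variable L : {set {set V}}.
Hypothesis LH : L \subset H.
Hypothesis cod : forall e (p : {set V}), e \in L -> p \subset e -> #|p| = 2 -> codegree H p <= s.

Let meet (e f : {set V}) := (f \in L) && (e :&: f != set0).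
(** The last edge of a cycle meets its predecessor and the first edge in different vertices, so it
    contains one of at most 9 pairs. This is where the codegree bound enters and saves a factor D /
    s. *)
Let close (e0 e f : {set V}) := (f \in L) &&
  [exists x, exists y, [&& x != y, x \in e :&: f & y \in e0 :&: f]].

(** The number of chains per edge is at most (3D)^(l-2) 9s <= 3^l s^((l-1)^2), since l(l-2) + 1 =
    (l-1)^2. This explains c = 18 s^(l-1), with 18 = 6 * 3: one factor 3 per step, and the factor 6
    covers the remaining constants. *)
Lemma sparse_copy_free : exists G : {set {set V}},
  [/\ G \subset H, #|L| <= 36 * s ^ m.+1 * #|G| & ~~ contains_copy C G].
Proof.
pose bad t := if t is e :: t' then [&& e \in L, closing meet close e e t' & uniq t] else false.
have c3 e : e \in L -> #|e| = 3 by move=> eL; apply: unif; apply: (subsetP LH).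
have count e : e \in L -> nsum m.+1 (closing meet close e e) <= (3 * D) ^ m * (9 * s).
  move=> eL; apply: (@closing_count _ meet close (mem L)) => //.
  - by move=> f g _ /andP[].
  - move=> f fL; rewrite -(c3 f fL) -sum_nat_const.
    apply: leq_trans (_ : \sum_(x in f) degree H x <= _); last by apply: leq_sum => x _; apply: degree_le.
    apply: leq_card_cover => g; rewrite inE => /andP[gL /set0Pn[x]].
    by rewrite inE => /andP[xf xg]; exists x; rewrite // inE (subsetP LH).
  - move=> f g fL gL.
    pose P (q : V * V) := [&& q.1 \in g, q.2 \in f & q.1 != q.2].
    apply: leq_trans (_ : \sum_(q | P q) #|[set e' in L | [set q.1; q.2] \subset e']| <= _).
      apply: leq_card_cover => e'; rewrite inE => /andP[eL' /existsP[x /existsP[y]]].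
      rewrite !inE => /and3P[xy /andP[xg xe] /andP[yf ye]].
      by exists (x, y); rewrite /P /= ?xg ?yf // inE eL' subUset !sub1set xe ye.
    apply: leq_trans (_ : \sum_(q in setX g f) s <= _); last first.
      by rewrite sum_nat_const cardsX !c3.
    rewrite big_mkcond [X in _ <= X]big_mkcond; apply: leq_sum => -[x y] _.
    rewrite /P in_setX /=; case: (x \in g) (y \in f) => [] [] //=; case: ifP => // xy.
    have [E0|[e' he]] := set_0Vmem [set e' in L | [set x; y] \subset e']; first by rewrite E0 cards0.
    move: he; rewrite inE => /andP[eL' xye].
    apply: leq_trans (cod eL' xye _); last by rewrite cards2 xy.
    apply/subset_leq_card/subsetP => z; rewrite !inE => /andP[zL ->].
    by rewrite (subsetP LH).
have tot : 2 * nsum m.+2 bad <= #|L| * (18 * s ^ m.+1) ^ m.+1.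
  have h1 : nsum m.+2 bad <= #|L| * ((3 * D) ^ m * (9 * s)).
    rewrite -sum_nat_const [X in _ <= X]big_mkcond; apply: leq_sum => e _.
    rewrite -[X in X <= _]/(nsum m.+1 (fun t => bad (e :: t))).
    case: ifP => eL.
      apply: leq_trans (count e eL); apply: leq_nsum => t _.
      by rewrite /bad eL; case: closing; case: uniq.
    rewrite -[X in _ <= X](nsum0 {set V} m.+1).
    by apply: leq_nsum => t _; rewrite /bad eL.
  apply: leq_trans (_ : 2 * (#|L| * ((3 * D) ^ m * (9 * s))) <= _); first by rewrite leq_mul2l h1.
  rewrite mulnCA leq_mul2l; apply/orP; right.
  apply: leq_trans (_ : 2 * ((3 * s ^ m.+2) ^ m * (9 * s)) <= _).
    by rewrite leq_mul2l leq_mul2r; apply/orP; right; apply/orP; right; rewrite leq_expl ?leq_mul2l.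
  have -> : 2 * ((3 * s ^ m.+2) ^ m * (9 * s)) = 6 * 3 ^ m.+1 * s ^ (m.+1 * m.+1).
    have -> : m.+1 * m.+1 = m.+2 * m + 1 by lia.
    by rewrite expnMn -expnM expnD expn1 [3 ^ m.+1]expnS; ring.
  rewrite expnMn -expnM leq_mul2r; apply/orP; right.
  rewrite (_ : 18 = 6 * 3) // expnMn leq_mul2r; apply/orP; right.
  by rewrite -{1}(expn1 6) leq_exp2l.
have c0 : 0 < 18 * s ^ m.+1 by rewrite muln_gt0 expn_gt0 s0.
have [|G [GL hG nb]] := @sampling _ L bad m.+1 _ c0 _ tot.
  by case=> // e t /and3P[].
exists G; split; first exact: subset_trans GL LH.
  by apply: leq_trans hG _; rewrite mulnA.
apply/negP => /(copy_coords _ hC)[//|a [b [ai bi ab XG]]].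
pose X i := [set a i; a (ordS i); b (ordS i)].
have GLi i : X i \in L by apply: (subsetP GL); apply: XG.
pose g i := X (inord i).
have Si i : i < m.+1 -> ordS (inord i : 'I_m.+2) = inord i.+1.
  move=> im; apply: val_inj; rewrite /= !inordK //; last by rewrite ltnW.
  by rewrite modn_small.
have Sm : ordS (inord m.+1 : 'I_m.+2) = inord 0.
  by apply: val_inj; rewrite /= !inordK // modnn.
have Xi : injective X.
  move=> i j /setP/(_ (b (ordS i))); rewrite !inE eqxx !orbT.
  rewrite ![b (ordS i) == a _]eq_sym !(negPf (ab _ _)) /= => /esym/eqP/bi.
  exact: ordS_inj.
(* Induction backwards from the closing edge [g m.+1], which meets [g m] and [g 0]. *)
have path j i : i + j = m -> closing meet close (g 0) (g i) (map g (iota i.+1 j.+1)).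
  elim: j i => [|j IH] i.
    rewrite addn0 => -> /=; rewrite /close GLi /=.
    apply/existsP; exists (a (inord m.+1)); apply/existsP; exists (a (inord 0)).
    rewrite (inj_eq ai) -val_eqE /= !inordK //= !inE eqxx Si // Sm !eqxx /=.
    by rewrite !orbT.
  move=> ij; have := IH i.+1; rewrite addSnnS => /(_ ij) h.
  have im : i < m.+1 by rewrite -ij; lia.
  have -> : closing meet close (g 0) (g i) (map g (iota i.+1 j.+2)) =
    meet (g i) (g i.+1) && closing meet close (g 0) (g i.+1) (map g (iota i.+2 j.+1)) by [].
  rewrite h andbT.
  rewrite /meet GLi; apply/set0Pn; exists (a (inord i.+1)).
  by rewrite !inE Si // !eqxx !orbT.
have sz : size (map g (iota 0 m.+2)) = m.+2 by rewrite size_map size_iota.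
have aG : all (mem G) (map g (iota 0 m.+2)).
  by apply/allP => _ /mapP[i _ ->]; apply: XG.
case/negP: (nb _ sz aG).
rewrite /bad -[iota 0 m.+2]/(0 :: iota 1 m.+1) map_cons.
rewrite GLi path // -map_cons -[0 :: _]/(iota 0 m.+2) andTb andTb.
rewrite map_inj_in_uniq ?iota_uniq // => i j; rewrite !mem_iota !add0n /= => hi hj /Xi.
by move/(congr1 val); rewrite /= !inordK.
Qed.

End SmallCodegree.

Section LargeCodegree.
Variable L : {set {set V}}.
Hypothesis LH : L \subset H.
Hypothesis cod : forall e, e \in L -> exists2 p : {set V}, p \subset e /\ #|p| = 2 & s < codegree H p.

(** The factor 48 is 8 * 6: a random bipartition separates an edge in the required way with
    probability 1/8, and passing to disjoint pairs loses 6 D / s <= 6 s^(l-1). *)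
Lemma heavy_copy_free : exists G : {set {set V}},
  [/\ G \subset H, #|L| <= 48 * s ^ m.+1 * #|G| & ~~ contains_copy C G].
Proof.
pose heavy (p : {set V}) := (#|p| == 2) && (s < codegree H p).
pose p (e : {set V}) := odflt set0 [pick q : {set V} | (q \subset e) && heavy q].
have pP e : e \in L -> (p e \subset e) && heavy (p e).
  move=> /cod[q [qe q2] hq]; rewrite /p; case: pickP => [//|/(_ q)].
  by rewrite qe /heavy q2 hq.
have p2 e : e \in L -> #|p e| = 2 by case/pP/andP => _ /andP[/eqP].
have pe e : e \in L -> p e \subset e by case/pP/andP.
have c3 e : e \in L -> #|e| = 3 by move=> eL; apply: unif; apply: (subsetP LH).
pose L' (h : {ffun V -> bool}) := [set e in L | [forall x in e, h x == (x \in p e)]].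
have [h hh] : exists h, #|L| <= 8 * #|L' h|.
  have [h hh|none] := pickP (fun h => #|L| <= 8 * #|L' h|); first by exists h.
  have : \sum_h (8 * #|L' h| + 1) <= \sum_(h : {ffun V -> bool}) #|L|.
    by apply: leq_sum => h _; rewrite addn1 ltnNge none.
  rewrite big_split /= -big_distrr /= !sum_nat_const card_ffun card_bool.
  have -> : \sum_h #|L' h| = \sum_(e in L) #|[set h : {ffun V -> bool} | all (fun j => h j \in [set j \in p e]) (enum e)]|.
    under eq_bigr do rewrite -sum1_card.
    rewrite (exchange_big_dep (mem L)) /=; last by move=> h e _; rewrite inE => /andP[].
    apply: eq_bigr => e eL; rewrite -sum1_card; apply: eq_bigl => h.
    rewrite !inE eL /=; apply/forall_inP/allP => hx x.
      by rewrite mem_enum => /hx; rewrite inE.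
    by rewrite -mem_enum => /hx; rewrite inE.
  rewrite big_distrr /= (eq_bigr (fun=> 2 ^ #|V|)) ?sum_nat_const; last first.
    move=> e eL; have := @seq_hit V bool (fun j => [set j \in p e]) (enum e) (enum_uniq _).
    rewrite -cardE c3 // card_bool big1 ?muln1 => [<-|j _]; last by rewrite cards1.
    by rewrite mulnC.
  have : 0 < 2 ^ #|V| by rewrite expn_gt0.
  by move: (2 ^ _) => W W0; rewrite muln1 [W * _]mulnC -[X in _ <= X]addn0 leq_add2l leqNgt W0.
pose S := [set p e | e in L' h].
pose conf (q q' : {set V}) := q :&: q' != set0.
pose w q := #|[set e in L' h | p e == q]|.
have L'L : L' h \subset L by apply/subsetP => e; rewrite inE => /andP[].
have SP q : q \in S -> heavy q.
  by case/imsetP=> e /(subsetP L'L) /pP/andP[_ hq] ->.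
(* Double counting: at most 2D edges meet [q], each contains at most 3 pairs, and each heavy pair
   meeting [q] lies in more than [s] of these edges. *)
have nbr q : q \in S -> #|[set q' in S | conf q q']| * s <= 6 * D.
  move=> qS; have /andP[/eqP q2 _] := SP q qS.
  rewrite -sum_nat_const; apply: leq_trans (_ : \sum_(q' in [set q' in S | conf q q']) codegree H q' <= _).
    by apply: leq_sum => q'; rewrite inE => /andP[/SP/andP[_ /ltnW]].
  under eq_bigr do rewrite /codegree -sum1_card.
  rewrite (exchange_big_dep (fun f : {set V} => (f \in H) && (q :&: f != set0))) /=; last first.
    move=> q' f; rewrite !inE => /andP[_ /set0Pn[x]]; rewrite inE => /andP[xq xq'] /andP[-> qf].
    by apply/set0Pn; exists x; rewrite inE xq (subsetP qf).
  apply: leq_trans (_ : \sum_(f : {set V} | (f \in H) && (q :&: f != set0)) 3 <= _).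
    apply: leq_sum => f /andP[fH _]; rewrite sum1_card.
    rewrite -[X in _ <= X]/('C(3, 2)) -(unif fH) -(cards_draws f).
    apply/subset_leq_card/subsetP => q'; rewrite unfold_in !inE.
    by case/andP=> /andP[/SP/andP[-> _] _] /andP[_ ->].
  rewrite sum_nat_const mulnC (_ : 6 = 3 * 2) // -mulnA leq_mul2l /= -{1}q2 -sum_nat_const.
  apply: leq_trans (_ : \sum_(x in q) degree H x <= _); last by apply: leq_sum => x _; apply: degree_le.
  rewrite -[X in X <= _]cardsE; apply: leq_card_cover => f; rewrite inE => /andP[fH /set0Pn[x]].
  by rewrite inE => /andP[xq xf]; exists x; rewrite // inE fH.
have [|||M [MS Mi Mw]] := @disjoint_subfamily _ conf w ((6 * D) %/ s) S.
- by move=> q q'; rewrite /conf setIC.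
- move=> q /SP/andP[/eqP q2 _]; rewrite /conf setIid.
  by apply/eqP => q0; rewrite q0 cards0 in q2.
- by move=> q qS; rewrite leq_divRL // nbr.
pose G := [set e in L' h | p e \in M].
have sw (A : {set {set V}}) : \sum_(q in A) w q = #|[set e in L' h | p e \in A]|.
  rewrite -sum1_card [RHS](partition_big p (mem A)) /=; last by move=> e; rewrite inE => /andP[].
  apply: eq_bigr => q qA; rewrite /w -sum1_card; apply: eq_bigl => e.
  by rewrite !inE -!andbA; case: eqP => [->|]; rewrite ?qA ?andbF ?andbT.
have GL : G \subset L by apply: subset_trans L'L; apply/subsetP => e; rewrite inE => /andP[].
exists G; split; first exact: subset_trans GL LH.
- rewrite -(leq_pmul2r s0).
  have E1 : #|L' h| <= (6 * D) %/ s * #|G|.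
    move: Mw; rewrite !sw; apply: leq_trans; apply/subset_leq_card/subsetP => e eL.
    by rewrite inE eL imset_f.
  apply: leq_trans (_ : 8 * ((6 * D) %/ s * #|G|) * s <= _).
    by rewrite leq_mul2r (leq_trans hh) ?orbT // leq_mul2l E1 orbT.
  have -> : 8 * ((6 * D) %/ s * #|G|) * s = 8 * #|G| * ((6 * D) %/ s * s) by ring.
  have -> : 48 * s ^ m.+1 * #|G| * s = 8 * #|G| * (6 * s ^ m.+2) by rewrite [s ^ m.+2]expnS; ring.
  rewrite leq_mul2l; apply/orP; right; apply: leq_trans (leq_trunc_div _ _) _.
  by rewrite leq_mul2l Ds orbT.
apply/negP => /(copy_coords _ hC)[//|a [b [ai bi ab XG]]].
pose X i := [set a i; a (ordS i); b (ordS i)].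
have XL i : X i \in L by apply: (subsetP GL); apply: XG.
have Xh i x : x \in X i -> h x = (x \in p (X i)).
  move=> xX; have := XG i; rewrite !inE => /andP[/andP[_ /forall_inP/(_ x xX)/eqP]] //.
have XM i : p (X i) \in M by have := XG i; rewrite inE => /andP[].
have one i : X i :&: X (ordS i) \subset [set a (ordS i)].
  apply/subsetP => x; rewrite !inE => /andP[].
  rewrite -!orbA => /or3P[] /eqP -> //; rewrite ?(inj_eq ai) ?(inj_eq bi) ?(negPf (ab _ _)) ?orbF //.
  - rewrite [i == ordS (ordS i)]eq_sym (negPf (ordS2_neq i _)) //.
    by rewrite orbF.
  - by rewrite ![b _ == a _]eq_sym !(negPf (ab _ _)) /= eq_sym (negPf (ordS_neq _ _)).
(* A shared vertex in the first part would lie in the heavy pairs of both its edges. These pairs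
   would be equal by disjointness, and the two edges would share two vertices. *)
have nh i : ~~ h (a (ordS i)).
  apply/negP => ha.
  have h1 : a (ordS i) \in p (X i) by rewrite -Xh // !inE eqxx !orbT.
  have h2 : a (ordS i) \in p (X (ordS i)) by rewrite -Xh // !inE eqxx.
  have eqp : p (X i) = p (X (ordS i)).
    by apply: Mi => //; apply/set0Pn; exists (a (ordS i)); rewrite inE h1.
  have : p (X i) \subset [set a (ordS i)].
    by apply: subset_trans (one i); rewrite subsetI pe // eqp pe.
  by move/subset_leq_card; rewrite p2 // cards1.
pose i0 : 'I_m.+2 := ord0.
(* The heavy pair of an edge lies in the first part and so avoids both shared vertices; only one
   vertex is left for it. *)
have : p (X i0) \subset [set b (ordS i0)].
  apply/subsetP => x xp; have xX := subsetP (pe _ (XL i0)) _ xp.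
  have hx : h x by rewrite (Xh i0).
  move: xX; rewrite !inE -orbA => /or3P[] /eqP xE; last by rewrite xE.
    by have := nh (ord_pred i0); rewrite ord_predK -xE hx.
  by have := nh i0; rewrite -xE hx.
by move/subset_leq_card; rewrite p2 // cards1.
Qed.

End LargeCodegree.

Lemma ex_in_lower : #|H| <= 96 * s ^ m.+1 * ex_in H C.
Proof.
pose light (e : {set V}) := [forall p : {set V}, (p \subset e) && (#|p| == 2) ==> (codegree H p <= s)].
pose L := [set e in H | light e].
have exG (G : {set {set V}}) : G \subset H -> ~~ contains_copy C G -> #|G| <= ex_in H C.
  by move=> GH nc; apply: leq_bigmax_cond; rewrite GH.
have cH : #|H| = #|L| + #|H :\: L|.
  rewrite -(cardsID L H); congr (_ + _); apply: eq_card => e.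
  by rewrite !inE; case: (e \in H); rewrite ?andbF.
have [||G1 [G1H c1 n1]] := @sparse_copy_free L _ _.
- by apply/subsetP => e; rewrite inE => /andP[].
- move=> e p; rewrite inE => /andP[_ /forallP/(_ p)/implyP h] pe p2.
  by apply: h; rewrite pe p2.
have [||G2 [G2H c2 n2]] := @heavy_copy_free (H :\: L) _ _.
- exact: subsetDl.
- move=> e; rewrite !inE => /andP[he eH]; rewrite eH /= in he.
  case/forallPn: he => p; rewrite negb_imply -ltnNge => /andP[/andP[pe /eqP p2] hp].
  by exists p.
have e1 := exG G1 G1H n1; have e2 := exG G2 G2H n2.
have h1 : #|L| <= 36 * s ^ m.+1 * ex_in H C by apply: leq_trans c1 _; rewrite leq_mul2l e1 orbT.
have h2 : #|H :\: L| <= 48 * s ^ m.+1 * ex_in H C by apply: leq_trans c2 _; rewrite leq_mul2l e2 orbT.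
by rewrite cH -!mulnA in h1 h2 *; move: (s ^ _ * _) h1 h2 => W; lia.
Qed.

End Lower.

(** * Choosing two of the three vertex classes with small codegrees *)

Section Select.
Variables (E V : finType).
Implicit Types (F G : {set E}) (a b c : E -> V).

Definition vdeg F a e := #|[set f in F | a f == a e]|.
Definition pdeg F a b e := #|[set f in F | (a f == a e) && (b f == b e)]|.

Lemma pdegC F a b e : pdeg F a b e = pdeg F b a e.
Proof. by apply: eq_card => f; rewrite !inE; congr (_ && _); apply: andbC. Qed.

(** If k is the smallest size of a heavy fibre, then |Y| k <= |F|, and k^2 > 4 |F| gives the bound
    on |Y|. *)
Lemma heavy_fibers F b : 0 < #|F| ->
  4 * #|[set y | 4 * #|F| < #|[set f in F | b f == y]| ^ 2]| ^ 2 <= #|F|.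
Proof.
move=> F0; set Y := [set y | _].
have [->|[y0 y0Y]] := set_0Vmem Y; first by rewrite cards0.
pose k y := #|[set f in F | b f == y]|.
have sk : \sum_(y in Y) k y <= #|F|.
  rewrite -sum1_card (partition_big b predT) //= [X in _ <= X](bigID (mem Y)) /=.
  apply: leq_trans (leq_addr _ _); apply: leq_sum => y _.
  by rewrite /k -sum1_card; apply/eq_leq/eq_bigl => f; rewrite !inE.
pose y1 := [arg min_(y < y0 in Y) k y].
have [y1Y y1m] : y1 \in Y /\ forall y, y \in Y -> k y1 <= k y.
  by rewrite /y1; case: arg_minnP.
have h1 : #|Y| * k y1 <= #|F|.
  by apply: leq_trans sk; rewrite -sum_nat_const; apply: leq_sum => y /y1m.
have h2 : 4 * #|F| < k y1 ^ 2 by move: y1Y; rewrite inE.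
have h3 : (#|Y| * k y1) ^ 2 <= #|F| ^ 2 by rewrite leq_sqr.
move: h3; rewrite expnMn => h3.
have : #|Y| ^ 2 * (4 * #|F|) <= #|F| ^ 2.
  by apply: leq_trans h3; rewrite leq_mul2l (ltnW h2) orbT.
by rewrite mulnA -[X in _ <= X]mulnn leq_pmul2r // mulnC.
Qed.

(** Within the fibre F_u of one value of [a], such an edge is determined by its values of [b] and
    [c]; by [heavy_fibers] each takes at most sqrt(|F_u|) / 2 values. *)
Lemma heavy_pairs F a b c :
  {in F &, forall e f, a e = a f -> b e = b f -> c e = c f -> e = f} ->
  4 * #|[set e in F | (4 * vdeg F a e < pdeg F a b e ^ 2) &&
                      (4 * vdeg F a e < pdeg F a c e ^ 2)]| <= #|F|.
Proof.
move=> inj; set Bd := [set e in F | _].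
rewrite -[X in _ <= X]sum1_card -[#|Bd|]sum1_card.
rewrite (partition_big a predT) //= [X in _ <= X](partition_big a predT) //=.
rewrite big_distrr; apply: leq_sum => u _.
pose Fu := [set e in F | a e == u].
have -> : \sum_(i in F | a i == u) 1 = #|Fu|.
  by rewrite -sum1_card; apply: eq_bigl => f; rewrite !inE.
have -> : \sum_(i in Bd | a i == u) 1 = #|[set e in Bd | a e == u]|.
  by rewrite -sum1_card; apply: eq_bigl => f; rewrite !inE.
set Bu := [set e in Bd | _].
have [Fu0|Fu0] := posnP #|Fu|.
  suff -> : Bu = set0 by rewrite cards0.
  apply/setP => e; rewrite in_set0; apply/negP; rewrite !inE => /andP[/andP[eF _] eu].
  by have := cards0_eq Fu0 => /setP/(_ e); rewrite !inE eF eu.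
pose Y d := [set y : V | 4 * #|Fu| < #|[set f in Fu | d f == y]| ^ 2].
have dgE e : a e = u -> vdeg F a e = #|Fu|.
  by move=> eu; apply: eq_card => f; rewrite !inE eu.
have cdgE d e : a e = u -> pdeg F a d e = #|[set f in Fu | d f == d e]|.
  by move=> eu; apply: eq_card => f; rewrite !inE eu andbA.
have h : #|Bu| <= #|Y b| * #|Y c|.
  rewrite -cardsX -(card_in_imset (f := fun e => (b e, c e))); last first.
    move=> e f; rewrite !inE => /andP[/andP[eF _] /eqP eu] /andP[/andP[fF _] /eqP fu] [].
    by apply: inj => //; rewrite eu fu.
  apply/subset_leq_card/subsetP => _ /imsetP[e + ->].
  rewrite !inE => /andP[/andP[eF /andP[h1 h2]] /eqP eu] /=.
  by rewrite -!(cdgE _ _ eu) -(dgE e) // h1 h2.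
have hb : 4 * #|Y b| ^ 2 <= #|Fu| by apply: heavy_fibers.
have hc : 4 * #|Y c| ^ 2 <= #|Fu| by apply: heavy_fibers.
apply: leq_trans (_ : 4 * (#|Y b| * #|Y c|) <= _); first by rewrite leq_mul2l.
rewrite -leq_sqr; apply: leq_trans (leq_mul hb hc).
by rewrite expnMn [(#|Y b| * _) ^ 2]expnMn mulnACA.
Qed.

(** A codegree of at most twice the square root of the degree, at both ends; this bounds the
    codegree ratio [theta] of the walk through [a] and [b]. *)
Definition light F a b := [set e in F | (pdeg F a b e ^ 2 <= 4 * vdeg F a e) &&
                                        (pdeg F a b e ^ 2 <= 4 * vdeg F b e)].

(** Off the three exceptional sets of [heavy_pairs], of size at most |F| / 4 each, the pair of least
    codegree is light: if it were heavy at one of its vertices, so would be the other pair at that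
    vertex. *)
Lemma light_sum F a b c :
  {in F &, forall e f, a e = a f -> b e = b f -> c e = c f -> e = f} ->
  #|F| <= 4 * (#|light F a b| + #|light F a c| + #|light F b c|).
Proof.
move=> inj.
have ia := heavy_pairs inj.
have ib : 4 * #|[set e in F | (4 * vdeg F b e < pdeg F b a e ^ 2) &&
                      (4 * vdeg F b e < pdeg F b c e ^ 2)]| <= #|F|.
  by apply: heavy_pairs => e f eF fF h1 h2 h3; apply: inj.
have ic : 4 * #|[set e in F | (4 * vdeg F c e < pdeg F c a e ^ 2) &&
                      (4 * vdeg F c e < pdeg F c b e ^ 2)]| <= #|F|.
  by apply: heavy_pairs => e f eF fF h1 h2 h3; apply: inj.
set A1 := [set e in F | _] in ia; set A2 := [set e in F | _] in ib.
set A3 := [set e in F | _] in ic.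
have : F \subset A1 :|: A2 :|: A3 :|: light F a b :|: light F a c :|: light F b c.
  apply/subsetP => e eF; rewrite !inE eF /=.
  rewrite !(pdegC F b a) !(pdegC F c a) !(pdegC F c b).
  set x := pdeg F a b e ^ 2; set y := pdeg F a c e ^ 2; set t := pdeg F b c e ^ 2.
  lia.
move=> /subset_leq_card h.
have h1 : #|F| <= #|A1| + #|A2| + #|A3| + #|light F a b| + #|light F a c| + #|light F b c|.
  apply: leq_trans h _.
  do 4 (apply: leq_trans (leq_card_setU _ _) _; rewrite leq_add2r).
  by apply: leq_card_setU.
lia.
Qed.

End Select.

Import Order.TTheory GRing.Theory Num.Theory.
Local Open Scope ring_scope.

(** * Measures on tuples and containers *)

Section Marginals.
Variables (R : realFieldType) (E : finType).
Implicit Types (w u v : seq E -> R) (p : seq (option E)) (m : bitseq) (s t : seq E).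

Fixpoint tot n w : R :=
  if n is n'.+1 then \sum_a tot n' (fun s => w (a :: s)) else w [::].

(* A pattern p prescribes the entries of a tuple at the positions where it is
   Some _; marg p w is the mass of w on the tuples that match p. *)
Fixpoint marg p w : R :=
  match p with
  | [::] => w [::]
  | Some a :: p' => marg p' (fun s => w (a :: s))
  | None :: p' => \sum_a marg p' (fun s => w (a :: s))
  end.

Fixpoint pat m s : seq (option E) :=
  match m, s with
  | b :: m', a :: s' => (if b then Some a else None) :: pat m' s'
  | _, _ => [::]
  end.

Definition psize p := count isSome p.

Lemma totS n w : tot n.+1 w = \sum_a tot n (fun s => w (a :: s)).
Proof. by []. Qed.

Lemma eq_tot n w u : (forall s, size s = n -> w s = u s) -> tot n w = tot n u.
Proof.
elim: n w u => [|n IH] w u h /=; first exact: h.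
by apply: eq_bigr => a _; apply: IH => s hs; apply: h; rewrite /= hs.
Qed.

Lemma ler_tot n w u : (forall s, size s = n -> w s <= u s) -> tot n w <= tot n u.
Proof.
elim: n w u => [|n IH] w u h /=; first exact: h.
by apply: ler_sum => a _; apply: IH => s hs; apply: h; rewrite /= hs.
Qed.

Lemma totD n w u : tot n (fun s => w s + u s) = tot n w + tot n u.
Proof.
elim: n w u => [|n IH] w u //=.
by rewrite -big_split; apply: eq_bigr => a _; rewrite IH.
Qed.

Lemma totZ n c w : tot n (fun s => c * w s) = c * tot n w.
Proof.
elim: n w => [|n IH] w //=.
by rewrite mulr_sumr; apply: eq_bigr => a _; rewrite IH.
Qed.

Lemma tot0 n : tot n (fun=> 0) = 0.
Proof. by elim: n => [|n IH] //=; rewrite big1. Qed.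

Lemma tot_sum n (I : Type) (r : seq I) (P : pred I) (f : I -> seq E -> R) :
  tot n (fun s => \sum_(i <- r | P i) f i s) = \sum_(i <- r | P i) tot n (f i).
Proof.
elim: n f => [|n IH] f //=.
by rewrite exchange_big; apply: eq_bigr => a _; rewrite IH.
Qed.

Lemma tot_ge0 n w : (forall s, size s = n -> 0 <= w s) -> 0 <= tot n w.
Proof. by move=> h; rewrite -(tot0 n); apply: ler_tot. Qed.

Lemma tot_gt0_ex n w : 0 < tot n w -> exists2 s, size s = n & 0 < w s.
Proof.
elim: n w => [|n IH] w /=; first by exists [::].
move=> h; have [a ha|/= a0] := pickP (fun a => 0 < tot n (fun s => w (a :: s))).
  by have [s hs hw] := IH _ ha; exists (a :: s) => //=; rewrite hs.
by move: h; rewrite ltNge sumr_le0 // => a _; rewrite leNgt a0.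
Qed.

Lemma marg_nseq n w : marg (nseq n None) w = tot n w.
Proof. by elim: n w => [|n IH] w //=; apply: eq_bigr => a _. Qed.

Lemma eq_marg p w u :
  (forall s, size s = size p -> w s = u s) -> marg p w = marg p u.
Proof.
elim: p w u => [|[a|] p IH] w u h /=; first exact: h.
  by apply: IH => s hs; apply: h; rewrite /= hs.
by apply: eq_bigr => a _; apply: IH => s hs; apply: h; rewrite /= hs.
Qed.

Lemma ler_marg p w u :
  (forall s, size s = size p -> w s <= u s) -> marg p w <= marg p u.
Proof.
elim: p w u => [|[a|] p IH] w u h /=; first exact: h.
  by apply: IH => s hs; apply: h; rewrite /= hs.
by apply: ler_sum => a _; apply: IH => s hs; apply: h; rewrite /= hs.
Qed.

Lemma margD p w u : marg p (fun s => w s + u s) = marg p w + marg p u.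
Proof.
elim: p w u => [|[a|] p IH] w u //=.
by rewrite -big_split; apply: eq_bigr => a _; rewrite IH.
Qed.

Lemma marg0 p : marg p (fun=> 0) = 0.
Proof. by elim: p => [|[a|] p IH] //=; rewrite big1. Qed.

Lemma marg_sum p (I : Type) (r : seq I) (f : I -> seq E -> R) :
  marg p (fun s => \sum_(i <- r) f i s) = \sum_(i <- r) marg p (f i).
Proof.
elim: p f => [|[a|] p IH] f //=.
by rewrite exchange_big; apply: eq_bigr => a _; rewrite IH.
Qed.

Lemma marg_ge0 p w : (forall s, size s = size p -> 0 <= w s) -> 0 <= marg p w.
Proof. by move=> h; rewrite -(marg0 p); apply: ler_marg. Qed.

Lemma marg_eq0 p w : (forall s, size s = size p -> w s = 0) -> marg p w = 0.
Proof. by move=> h; rewrite -(marg0 p); apply: eq_marg. Qed.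

Lemma marg_eq0_match p w :
  (forall s, size s = size p -> pat (map isSome p) s = p -> w s = 0) ->
  marg p w = 0.
Proof.
elim: p w => [|[a|] p IH] w h /=; first exact: h.
  by apply: IH => s hs hp; apply: h; rewrite /= ?hs ?hp.
by apply: big1 => a _; apply: IH => s hs hp; apply: h; rewrite /= ?hs ?hp.
Qed.

Lemma size_pat m s : size m = size s -> size (pat m s) = size s.
Proof. by elim: m s => [|b m IH] [|a s] //= [/IH ->]. Qed.

Lemma psize_pat m s : size m = size s -> psize (pat m s) = count id m.
Proof. by rewrite /psize; elim: m s => [|[] m IH] [|a s] //= [/IH ->]. Qed.

(* Both sides sum u s * v t over the pairs (s, t) that agree on the mask m. *)
Lemma marg_exchange m u v :
  tot (size m) (fun s => u s * marg (pat m s) v) =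
  tot (size m) (fun s => v s * marg (pat m s) u).
Proof.
elim: m u v => [|[] m IH] u v /=; first by rewrite mulrC.
  by apply: eq_bigr => a _; rewrite -(IH (fun s => u (a :: s))).
under eq_bigr do under eq_tot do rewrite mulr_sumr.
under eq_bigr do rewrite tot_sum.
rewrite exchange_big; apply: eq_bigr => b _ /=.
under eq_bigr do rewrite IH.
by rewrite -tot_sum; apply: eq_tot => s _; rewrite mulr_sumr.
Qed.

Lemma marg_exchange_le m u v c :
  (forall s, size s = size m -> 0 <= u s) ->
  (forall s, size s = size m -> marg (pat m s) v <= c) ->
  tot (size m) (fun s => v s * marg (pat m s) u) <= c * tot (size m) u.
Proof.
move=> u0 vc; rewrite -marg_exchange -totZ; apply: ler_tot => s hs.
by rewrite mulrC ler_wpM2r ?u0 ?vc.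
Qed.

End Marginals.

Arguments tot : simpl never.

(** * The container algorithm *)

Section Containers.
Variables (R : realFieldType) (E : finType) (F : {set E}) (tau : R) (t : nat).
Hypothesis tau0 : 0 < tau.
Hypothesis tauF : tau * #|F|%:R <= t%:R.
Implicit Types (w u : seq E -> R) (p : seq (option E)) (m : bitseq) (I T Q C : {set E}).

Definition indep n w I :=
  forall s, size s = n -> all (mem I) s -> w s = 0.

(** The degree condition of the container method, with a measure on n-tuples in place of an
    n-uniform hypergraph: [B] bounds the vertex degrees, and each further prescribed entry costs a
    factor [tau]. *)
Record spread n w (B mu : R) : Prop := Spread {
  spread_ge0 : forall s, size s = n -> 0 <= w s;
  spread_in : forall s, size s = n -> ~~ all (mem F) s -> w s = 0;
  spread_tot : mu <= tot n w;
  spread_marg : forall p, size p = n -> (0 < psize p)%N ->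
    marg p w <= B * tau ^+ (psize p).-1
}.

(** One stage passes from [B] and [mu] to [2 * tau * B] and [tau * mu / 2 ^+ n.+3], which divides mu
    / B by 2^(n+4). *)
Fixpoint cconst n : R := if n is n'.+1 then 2 ^+ n'.+4 * cconst n' else 8.

Lemma cconst_ge8 n : 8 <= cconst n.
Proof.
elim: n => [|n IH] //=; apply: le_trans IH _.
rewrite ler_peMl //; last by rewrite exprn_ege1 // ler1n.
by elim: n => [|n IH] //=; rewrite mulr_ge0 // exprn_ge0.
Qed.

Definition covered (P : {set E} -> Prop) (k : nat) (b : R) :=
  exists cs : seq {set E},
    [/\ (size cs <= k)%N,
        forall C, C \in cs -> C \subset F /\ #|C|%:R <= b &
        forall I, I \subset F -> P I -> exists2 C, C \in cs & I \subset C].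

Lemma covered_sub P P' k k' b b' : (forall I, P' I -> P I) -> (k <= k')%N ->
  b <= b' -> covered P k b -> covered P' k' b'.
Proof.
move=> PP kk bb [cs [h1 h2 h3]]; exists cs; split.
- exact: leq_trans kk.
- by move=> C /h2 [? h]; split=> //; apply: le_trans bb.
- by move=> I IF /PP; apply: h3.
Qed.

Lemma covered_split P (v : E) k1 k2 b :
  covered (fun I => P I /\ v \in I) k1 b ->
  covered (fun I => P I /\ v \notin I) k2 b -> covered P (k1 + k2) b.
Proof.
move=> [c1 [a1 b1 d1]] [c2 [a2 b2 d2]]; exists (c1 ++ c2); split.
- by rewrite size_cat leq_add.
- by move=> C; rewrite mem_cat => /orP[/b1|/b2].
- move=> I IF PI; have [vI|vI] := boolP (v \in I).
    by have [C hC IC] := d1 I IF (conj PI vI); exists C => //; rewrite mem_cat hC.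
  by have [C hC IC] := d2 I IF (conj PI vI); exists C => //; rewrite mem_cat hC orbT.
Qed.

Lemma covered_one P b C : C \subset F -> #|C|%:R <= b ->
  (forall I, I \subset F -> P I -> I \subset C) -> covered P 1 b.
Proof.
move=> CF Cb h; exists [:: C]; split => //.
  by move=> C'; rewrite inE => /eqP ->.
by move=> I IF /(h I IF) IC; exists C; rewrite ?mem_head.
Qed.

Fixpoint masks n : seq bitseq :=
  if n is n'.+1 then map (cons true) (masks n') ++ map (cons false) (masks n')
  else [:: [::]].

Lemma size_masks n : size (masks n) = (2 ^ n)%N.
Proof. by elim: n => //= n IH; rewrite size_cat !size_map IH expnS mul2n addnn. Qed.

Lemma mem_masks n m : (m \in masks n) = (size m == n).
Proof.
elim: n m => [|n IH] [|b m] //=.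
  by apply/negbTE/negP; rewrite mem_cat => /orP[] /mapP[].
rewrite eqSS -IH mem_cat; case: b.
  rewrite mem_map; last by move=> ? ? [].
  by rewrite orb_idr // => /mapP[].
rewrite orbC mem_map; last by move=> ? ? [].
by rewrite orb_idr // => /mapP[].
Qed.

(** Half of the marginal allowed in the next stage, whose constant is [2 * tau * B]; an unsaturated
    pattern still has room for one more link. *)
Definition sat B w p := (0 < psize p)%N && (B * tau ^+ (psize p) < marg p w).

Definition dead B w n s := has (fun m => sat B w (pat m s)) (masks n).

(* Markov's inequality: marg p w / (B * tau ^+ psize p) > 1 on the saturated
   patterns, and marg_exchange trades marg p w against marg p u. *)
Lemma dead_mass n B w u : 0 < B -> (forall s, size s = n -> 0 <= w s) ->
  (forall s, size s = n -> 0 <= u s) ->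
  (forall p, size p = n -> (0 < psize p)%N -> marg p u <= B * tau ^+ (psize p).-1) ->
  tot n (fun s => (dead B w n s)%:R * u s) <= 2 ^+ n * (tot n w / tau).
Proof.
move=> B0 w0 u0 hu.
have h1 : tot n (fun s => (dead B w n s)%:R * u s) <=
    tot n (fun s => \sum_(m <- masks n) (sat B w (pat m s))%:R * u s).
  apply: ler_tot => s hs; rewrite -mulr_suml ler_wpM2r ?u0 //.
  rewrite /dead; elim: (masks n) => [|m ms IH] /=; first by rewrite big_nil.
  rewrite big_cons; case: (sat _ _ _) => /=; last by rewrite add0r.
  by rewrite lerDl; apply: sumr_ge0 => i _.
apply: le_trans h1 _; rewrite tot_sum.
have -> : 2 ^+ n * (tot n w / tau) = \sum_(m <- masks n) (tot n w / tau).
  by rewrite big_const_seq count_predT size_masks iter_addr_0 -[RHS]mulr_natl natrX.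
rewrite big_seq [leRHS]big_seq; apply: ler_sum => m; rewrite mem_masks => /eqP hm.
have [c0|c0] := posnP (count id m).
  rewrite (eq_tot (u := fun=> 0)) ?tot0 ?divr_ge0 ?tot_ge0 ?ltW //.
  by move=> s hs; rewrite /sat psize_pat ?hm // c0 mul0r.
set c := B * tau ^+ (count id m).
have cp : 0 < c by rewrite mulr_gt0 ?exprn_gt0.
have h2 : tot n (fun s => (sat B w (pat m s))%:R * u s) <=
    tot n (fun s => c^-1 * (u s * marg (pat m s) w)).
  apply: ler_tot => s hs; have ps : psize (pat m s) = count id m.
    by rewrite psize_pat // hm hs.
  have mg : 0 <= marg (pat m s) w.
    by apply: marg_ge0 => s'; rewrite size_pat ?hm // hs => /w0.
  rewrite /sat ps c0 /=; case: ltP => h; last first.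
    by rewrite mul0r !mulr_ge0 ?invr_ge0 ?(ltW cp) ?u0.
  by rewrite mul1r mulrCA ler_peMr ?u0 // ler_pdivlMl // mulr1 ltW.
apply: le_trans h2 _; rewrite totZ -hm.
have h3 := @marg_exchange_le _ _ m w u (B * tau ^+ (count id m).-1).
apply: le_trans (ler_wpM2l _ (h3 _ _)) _.
- by rewrite invr_ge0 ltW.
- by move=> s hs; apply: w0; rewrite hs.
- move=> s hs; have ps : psize (pat m s) = count id m by rewrite psize_pat.
  by have := hu (pat m s); rewrite ps size_pat // hs hm; apply.
rewrite /c -{1}(prednK c0) exprS mulrA le_eqVlt; apply/orP; left; apply/eqP.
have tn : tau != 0 by rewrite gt_eqF.
have Bn : B != 0 by rewrite gt_eqF.
have tk : tau ^+ (count id m).-1 != 0 by rewrite expf_neq0 // pnatr_eq0.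
by field; rewrite tn Bn tk.
Qed.

Lemma container_base w B mu : 0 < B -> spread 1 w B mu ->
  covered (indep 1 w) 1 (#|F|%:R - mu / B).
Proof.
move=> B0 [w0 wF wt wm].
have wB v : w [:: v] <= B.
  by have := wm [:: Some v]; rewrite /= expr0 mulr1; apply.
pose C := F :&: [set v | w [:: v] == 0].
apply: (@covered_one _ _ C); first exact: subsetIl.
  have hF : \sum_(v in F) w [:: v] = tot 1 w.
    rewrite totS /tot [RHS](bigID (mem F)) /= [X in _ + X]big1 ?addr0 // => v vF.
    by apply: wF => //=; rewrite andbT.
  have h1 : \sum_(v in F) w [:: v] <= \sum_(v in F :\: C) B.
    rewrite (big_setID C) /= big1 ?add0r; last first.
      by move=> v; rewrite !inE => /andP[_ /andP[_ /eqP]].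
    exact: ler_sum.
  rewrite sumr_const -mulr_natr in h1.
  have h2 : (#|F|%:R : R) = #|C|%:R + #|F :\: C|%:R.
    by rewrite -natrD -(cardsID C F) (setIidPr _) // subsetIl.
  have h3 : mu / B <= #|F :\: C|%:R.
    by rewrite ler_pdivrMr // mulrC (le_trans _ h1) // hF.
  by rewrite h2; lra.
move=> I IF hI; apply/subsetP => v vI; rewrite !inE (subsetP IF) //=.
by apply/eqP/hI => //=; rewrite vI.
Qed.

Lemma leq_expS_split x a k : (x ^ a * k + x ^ a.+1 * k <= x.+1 ^ a.+1 * k)%N.
Proof.
rewrite -mulnDl leq_mul2r !expnS -mulSn leq_mul2l /=.
by case: a => [|a]; rewrite ?leqnn ?orbT // leq_exp2r ?leqnSn ?orbT.
Qed.

(** [T] holds elements known to be in the independent set, [Q] elements known to be outside, and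
    [w'] the links collected so far. Without a suitable [v] the mass of [w] would be below mu: at
    most mu/64 comes from [T], mu/8 from [Q], mu/4 from dead tuples and mu/2 from the other elements
    of [F]. *)
Lemma alive_step n w B mu T Q w' : 0 < B -> 0 < mu ->
  spread n.+2 w B mu -> 2 * tau * #|F|%:R * B * cconst n.+1 <= mu ->
  (forall s, size s = n.+1 -> 0 <= w' s) ->
  #|T|%:R * (mu / (2 * #|F|%:R)) <= tot n.+1 w' ->
  tot n.+1 w' < tau * mu / 2 ^+ n.+3 -> #|Q|%:R < mu / (8 * B) ->
  (#|T| < t)%N /\
  exists2 v, v \in F :\: (T :|: Q) &
    mu / (2 * #|F|%:R) <=
      tot n.+1 (fun s => (~~ dead B w' n.+1 s)%:R * w (v :: s)).
Proof.
move=> B0 mu0 [w0 wF wt wm] sm w'0 wT wM QB.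
have c8 := cconst_ge8 n.+1.
have F0 : 0 < #|F|%:R :> R.
  rewrite ltr0n lt0n; apply/negP => /eqP/cards0_eq F0.
  suff : tot n.+2 w = 0 by move=> h; rewrite h in wt; lra.
  rewrite (eq_tot (u := fun=> 0)) ?tot0 // => -[|a s] //= hs.
  by apply: wF => //=; rewrite F0 inE.
have tB : 16 * (tau * #|F|%:R * B) <= mu.
  apply: le_trans sm; set c := cconst _ in c8 *.
  have h : 0 <= tau * #|F|%:R * B by rewrite !mulr_ge0 // ltW.
  have -> : 2 * tau * #|F|%:R * B * c = 2 * (tau * #|F|%:R * B) * c by ring.
  have c8' : 0 <= c - 8 by lra.
  have := mulr_ge0 h c8'; lra.
have p2 : 8 <= (2 : R) ^+ n.+3.
  have : 1 <= (2 : R) ^+ n by rewrite exprn_ege1 // ler1n.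
  by rewrite !exprS; lra.
have wM' : tot n.+1 w' < tau * mu / 8.
  apply: lt_le_trans wM _; rewrite -!mulrA ler_wpM2l ?(ltW tau0) //.
  rewrite ler_wpM2l ?(ltW mu0) // lef_pV2 ?posrE ?exprn_gt0 //.
have hT : 4 * #|T|%:R < tau * #|F|%:R.
  have := le_lt_trans wT wM'; rewrite mulrA ltr_pdivrMr ?mulr_gt0 //.
  by rewrite -(ltr_pM2r mu0); nra.
have Tt : (#|T| < t)%N.
  rewrite -(ltr_nat R); apply: lt_le_trans tauF; apply: le_lt_trans hT.
  by rewrite ler_peMl // ler1n.
split=> //.
have [v /andP[vF hv]|/= none] := pickP (fun v => (v \in F :\: (T :|: Q)) &&
    (mu / (2 * #|F|%:R) <=
      tot n.+1 (fun s => (~~ dead B w' n.+1 s)%:R * w (v :: s)))).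
  by exists v.
pose dm v := tot n.+1 (fun s => (dead B w' n.+1 s)%:R * w (v :: s)).
pose al v := tot n.+1 (fun s => (~~ dead B w' n.+1 s)%:R * w (v :: s)).
have dm0 v : 0 <= dm v.
  by apply: tot_ge0 => s hs; rewrite mulr_ge0 // w0 //= hs.
have wE v : tot n.+1 (fun s => w (v :: s)) = al v + dm v.
  rewrite -totD; apply: eq_tot => s _.
  by case: (dead _ _ _ _); rewrite /= mul1r mul0r ?add0r ?addr0.
have wB v : tot n.+1 (fun s => w (v :: s)) <= B.
  rewrite -(marg_nseq n.+1 (fun s => w (v :: s))).
  have p1 : psize (Some v :: nseq n.+1 None) = 1%N.
    by rewrite /psize /= count_nseq mul0n.
  have := wm (Some v :: nseq n.+1 None).
  by rewrite p1 expr0 mulr1; apply => //=; rewrite size_nseq.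
have dmT : \sum_v dm v <= mu / 4.
  rewrite -tot_sum; under eq_tot do rewrite -mulr_sumr.
  apply: le_trans (dead_mass B0 w'0 _ _) _.
  - by move=> s hs; apply: sumr_ge0 => v _; apply: w0; rewrite /= hs.
  - move=> p sp pp; rewrite marg_sum.
    exact: (wm (None :: p) (congr1 S sp) pp).
  rewrite mulrA ler_pdivrMr //.
  have -> : mu / 4 * tau = 2 ^+ n.+1 * (tau * mu / 2 ^+ n.+3).
    have pn : 2 ^+ n != 0 :> R by rewrite expf_neq0 // pnatr_eq0.
    by rewrite !exprS; field.
  by rewrite ler_wpM2l ?exprn_ge0 // ltW.
have : tot n.+2 w <= \sum_(v in T :|: Q) B + \sum_(v in F) (mu / (2 * #|F|%:R)) + mu / 4.
  rewrite -addrA; apply: le_trans (_ : _ <= \sum_(v in T :|: Q) B +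
     (\sum_(v in F) (mu / (2 * #|F|%:R)) + \sum_v dm v)) _; last first.
    by rewrite !lerD2l.
  rewrite totS [\sum_(v in T :|: Q) _]big_mkcond [\sum_(v in F) _]big_mkcond -!big_split /=.
  apply: ler_sum => v _; case: ifP => vTQ.
    apply: le_trans (wB v) _; rewrite lerDl addr_ge0 //.
    by case: ifP => // _; rewrite divr_ge0 ?mulr_ge0 // ltW.
  rewrite add0r wE; case: ifP => vF.
    rewrite lerD2r; have := none v; rewrite inE vTQ vF /= => /negbT.
    by rewrite -ltNge => /ltW.
  rewrite add0r gerDr /al (eq_tot (u := fun=> 0)) ?tot0 // => s hs.
  by rewrite wF ?mulr0 //= ?hs // vF.
rewrite !sumr_const => h1.
have h2 : (B *+ #|T :|: Q|) <= (#|T|%:R + #|Q|%:R) * B.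
  by rewrite -[leLHS]mulr_natl ler_wpM2r ?(ltW B0) // -natrD ler_nat cardsU leq_subr.
have h3 : (mu / (2 * #|F|%:R)) *+ #|F| = mu / 2.
  by rewrite -[LHS]mulr_natl; field; rewrite gt_eqF.
have h4 : #|Q|%:R * B < mu / 8.
  by move: QB; rewrite invfM mulrA ltr_pdivlMr.
have h5 : 4 * (#|T|%:R * B) <= tau * #|F|%:R * B.
  by rewrite mulrA ler_wpM2r ?(ltW B0) // ltW.
lra.
Qed.

(** The algorithm asks whether the element [v] of [alive_step] lies in the independent set. On yes,
    [v] joins [T] and its link, without the dead tuples, is added to [w']; on no, [v] joins [Q]. It
    stops when [Q] is large, with container [F :\: Q], or when [w'] is heavy enough for the next
    stage. A yes lowers the exponent of the count, and both answers lower its base. *)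
Lemma container_stage n w B mu S b : 0 < B -> 0 < mu ->
  spread n.+2 w B mu -> 2 * tau * #|F|%:R * B * cconst n.+1 <= mu ->
  (forall w', spread n.+1 w' (2 * tau * B) (tau * mu / 2 ^+ n.+3) ->
     covered (indep n.+1 w') S b) ->
  (0 < S)%N -> #|F|%:R - mu / (8 * B) <= b ->
  forall d T Q w', (#|F :\: (T :|: Q)| <= d)%N -> (#|T| <= t)%N ->
  Q \subset F ->
  (forall s, size s = n.+1 -> 0 <= w' s) ->
  (forall s, size s = n.+1 -> ~~ all (mem F) s -> w' s = 0) ->
  (forall p, size p = n.+1 -> (0 < psize p)%N ->
    marg p w' <= (2 * tau * B) * tau ^+ (psize p).-1) ->
  #|T|%:R * (mu / (2 * #|F|%:R)) <= tot n.+1 w' ->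
  (forall I, indep n.+2 w I -> T \subset I -> indep n.+1 w' I) ->
  covered (fun I => [/\ indep n.+2 w I, T \subset I & [disjoint Q & I]])
    (d.+1 ^ (t - #|T|) * S) b.
Proof.
move=> B0 mu0 sw sm IH S0 hb; elim=> [|d IHd] T Q w' hd Tt QF w'0 w'F w'm w'T w'I.
all: have S1 k a : (S <= k.+1 ^ a * S)%N by rewrite leq_pmull // expn_gt0.
all: have [Qb|Qs] := leP (mu / (8 * B)) #|Q|%:R.
1,3: apply: (@covered_sub (fun I => [/\ indep n.+2 w I, T \subset I & [disjoint Q & I]]) _ 1 _ b) => //;
  [by rewrite (leq_trans S0)
  |apply: (@covered_one _ _ (F :\: Q)); first exact: subsetDl];
  [have := cardsID Q F; rewrite (setIidPr QF) => hF;
   apply: le_trans hb; rewrite -hF natrD; lra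
  |by move=> I IF [_ _ QI]; rewrite subsetD IF disjoint_sym].
all: have [wb|ws] := leP (tau * mu / 2 ^+ n.+3) (tot n.+1 w').
1,3: apply: (@covered_sub (indep n.+1 w') _ S _ b) => //;
  by [move=> I [hI TI _]; apply: w'I | apply: IH].
all: have [Tt' [v vF hv]] := alive_step B0 mu0 sw sm w'0 w'T ws Qs.
  by move: hd; rewrite leqn0 cards_eq0 => /eqP h; rewrite h inE in vF.
have [w0 wF wt wm] := sw.
have tn0 : 0 <= tau by apply: ltW.
have hd' X : X = v |: (T :|: Q) -> (#|F :\: X| <= d)%N.
  move=> ->; rewrite -ltnS; apply: leq_trans hd.
  by rewrite (cardsD1 v (F :\: (T :|: Q))) vF setUC setDDl.
move: vF; rewrite !inE negb_or => /andP[/andP[vT vQ] vF].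
pose w2 s := w' s + (~~ dead B w' n.+1 s)%:R * w (v :: s).
have -> : (t - #|T|)%N = (t - #|v |: T|).+1.
  by rewrite cardsU1 vT add1n subnSK.
apply: (@covered_sub (fun I => [/\ indep n.+2 w I, T \subset I & [disjoint Q & I]])
  _ _ _ b b _ (leq_expS_split _ _ _) (lexx b)) => //.
apply: (@covered_split _ v).
  apply: (@covered_sub _ _ _ _ b _ _ (leqnn _) (lexx b)
     (IHd (v |: T) Q w2 _ _ QF _ _ _ _ _)).
  - move=> I [[hI TI QI] vI]; split=> //.
    by rewrite subUset sub1set vI.
  - by apply: hd'; rewrite setUA.
  - by rewrite cardsU1 vT.
  - by move=> s hs; rewrite addr_ge0 ?w'0 // mulr_ge0 // w0 //= hs.
  - by move=> s hs hF; rewrite /w2 w'F // wF ?mulr0 ?addr0 //= ?hs // (negPf hF) andbF.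
  - move=> p sp pp; rewrite /w2 margD.
    (* A saturated pattern gains nothing, since all tuples matching it are dead; any other gains at
       most [B * tau ^+ psize p], the marginal of [w] with [v] prescribed as well. *)
    have [st|st] := boolP (sat B w' p).
      rewrite [X in _ + X]marg_eq0_match ?addr0; first exact: w'm.
      move=> s hs ps; have -> : dead B w' n.+1 s; last by rewrite mul0r.
      apply/hasP; exists (map isSome p); last by rewrite ps.
      by rewrite mem_masks size_map sp.
    have h1 : marg p w' <= B * tau ^+ (psize p).
      by move: st; rewrite /sat pp /= -leNgt.
    have h2 : marg p (fun s => (~~ dead B w' n.+1 s)%:R * w (v :: s)) <= B * tau ^+ (psize p).
      have := wm (Some v :: p); rewrite /= sp => /(_ erefl isT); apply: le_trans.
      apply: ler_marg => s hs; rewrite ler_piMl ?w0 //= ?hs ?sp //.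
      by case: dead.
    apply: le_trans (lerD h1 h2) _.
    by rewrite -{1 2}(prednK pp) exprS; lra.
  - rewrite cardsU1 vT natrD mulrDl mul1r addrC /w2 totD lerD //.
  - move=> I hI; rewrite subUset sub1set => /andP[vI TI] s hs hsI.
    by rewrite /w2 (w'I I) // add0r hI ?mulr0 //= ?hs // hsI andbT.
apply: (@covered_sub _ _ _ _ b _ _ _ (lexx b)
     (IHd T (v |: Q) w' _ _ _ _ _ _ _ _)) => //.
- move=> I [[hI TI QI] vI]; split=> //.
  by rewrite -setI_eq0 setIUl setU_eq0 !setI_eq0 disjoints1 vI.
- by rewrite cardsU1 vT add1n subnSK.
- by apply: hd'; rewrite setUCA.
- by rewrite subUset sub1set vF.
Qed.

(** Induction on the length of the tuples: a stage started with empty [T] and [Q] and the zero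
    measure ends in measures on tuples with one entry less. *)
Lemma container n w B mu : 0 < B -> 0 < mu -> spread n.+1 w B mu ->
  2 * tau * #|F|%:R * B * cconst n <= mu ->
  covered (indep n.+1 w) ((#|F|.+1 ^ t) ^ n) (#|F|%:R - mu / (B * cconst n)).
Proof.
elim: n w B mu => [|n IH] w B mu B0 mu0 sw sm.
  apply: (covered_sub _ _ _ (container_base B0 sw)) => //.
  rewrite lerD2l lerN2 ler_wpM2l ?(ltW mu0) // lef_pV2 ?posrE //.
    by rewrite /= ler_peMr ?(ltW B0) //; lra.
  by rewrite mulr_gt0.
have c8 := cconst_ge8 n.+1; have c8n := cconst_ge8 n.
have p0 : 0 < (2 : R) ^+ n by rewrite exprn_gt0.
have pn : 2 ^+ n != 0 :> R by rewrite gt_eqF.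
have Bn : B != 0 by rewrite gt_eqF.
have tn : tau != 0 by rewrite gt_eqF.
have cn : cconst n != 0 by rewrite gt_eqF //; lra.
have S0 : (0 < (#|F|.+1 ^ t) ^ n)%N by rewrite !expn_gt0.
pose b := #|F|%:R - mu / (B * cconst n.+1).
have hb : #|F|%:R - mu / (8 * B) <= b.
  rewrite lerD2l lerN2 ler_wpM2l ?(ltW mu0) // lef_pV2 ?posrE //.
  - by rewrite mulrC ler_wpM2l // ltW.
  - by rewrite mulr_gt0 //; lra.
  - by rewrite mulr_gt0.
have := @container_stage n w B mu _ b B0 mu0 sw sm _ S0 hb #|F| set0 set0 (fun=> 0).
rewrite setU0 setD0 sub0set cards0 subn0 -expnS => h.
apply: (covered_sub _ _ _ (h _ _ _ _ _ _ _ _ _)) => //.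
- by move=> I hI; split; rewrite ?sub0set ?disjoint_set0 // -setI_eq0 set0I.
- move=> w' sw'; apply: (@covered_sub (indep n.+1 w') _ _ _
    (#|F|%:R - (tau * mu / 2 ^+ n.+3) / (2 * tau * B * cconst n)) _ (fun I h => h) (leqnn _) _ _).
    rewrite /b lerD2l lerN2 le_eqVlt; apply/orP; left; apply/eqP => /=.
    by rewrite !exprS; field; rewrite Bn tn cn pn.
  apply: (IH w' _ _ _ _ sw').
  - by rewrite !mulr_gt0.
  - by apply: divr_gt0; [apply: mulr_gt0|apply: exprn_gt0].
  rewrite ler_pdivlMr ?exprn_gt0 //.
  move: sm; rewrite -(ler_pM2l tau0); apply: le_trans.
  by rewrite le_eqVlt; apply/orP; left; apply/eqP => /=; rewrite !exprS; ring.
- by move=> p sp pp; rewrite marg0 mulr_ge0 ?exprn_ge0 ?mulr_ge0 ?ltW.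
- by rewrite mul0r tot_ge0.
Qed.

End Containers.

(** * Alternating walks on edges *)

Section Rotation.
Variables (R : realFieldType) (E : finType).
Implicit Types (w : seq E -> R) (p : seq (option E)) (m : bitseq) (s : seq E).

Lemma marg_rcons p o w : marg (rcons p o) w =
  if o is Some a then marg p (fun s => w (rcons s a))
  else \sum_a marg p (fun s => w (rcons s a)).
Proof.
elim: p w => [|[b|] p IH] w /=; first by case: o.
  by rewrite IH {IH}; case: o.
case: o IH => [a|] IH; first by apply: eq_bigr => b _; rewrite IH.
by rewrite exchange_big; apply: eq_bigr => b _; rewrite IH.
Qed.

Lemma marg_rot1 p w : marg (rot 1 p) w = marg p (fun s => w (rot 1 s)).
Proof.
case: p => [|o p] //; rewrite rot1_cons marg_rcons /=; case: o => [a|].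
  by apply: eq_marg => s _; rewrite rot1_cons.
by apply: eq_bigr => a _; apply: eq_marg => s _; rewrite rot1_cons.
Qed.

Lemma marg_rot k p w : (k <= size p)%N ->
  marg (rot k p) w = marg p (fun s => w (rot k s)).
Proof.
elim: k w => [|k IH] w hk; first by rewrite rot0; apply: eq_marg => s _; rewrite rot0.
rewrite (rotS hk) marg_rot1 (IH (fun s => w (rot 1 s)) (ltnW hk)).
by apply: eq_marg => s hs; rewrite -rotS ?hs.
Qed.

Lemma tot_rot k n w : (k <= n)%N -> tot n w = tot n (fun s => w (rot k s)).
Proof.
move=> kn; rewrite -!marg_nseq -marg_rot ?size_nseq //; congr marg.
have /all_pred1P : all (pred1 (@None E)) (rot k (nseq n None)).
  by rewrite (eq_all_r (mem_rot k _)) all_nseq /= orbT.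
by rewrite size_rot size_nseq.
Qed.

Lemma pat_cat m1 m2 s1 s2 : size m1 = size s1 ->
  pat (m1 ++ m2) (s1 ++ s2) = pat m1 s1 ++ pat m2 s2.
Proof. by elim: m1 s1 => [|b m1 IH] [|a s1] //= [/IH ->]. Qed.

Lemma pat_take k m s : pat (take k m) (take k s) = take k (pat m s).
Proof. by elim: m s k => [|b m IH] [|a s] [|k] //=; rewrite ?IH //; case: take. Qed.

Lemma pat_drop k m s : size m = size s ->
  pat (drop k m) (drop k s) = drop k (pat m s).
Proof. by elim: m s k => [|b m IH] [|a s] [|k] //= [/IH ->]. Qed.

Lemma pat_rot k m s : size m = size s -> pat (rot k m) (rot k s) = rot k (pat m s).
Proof.
move=> h; rewrite /rot pat_cat ?size_drop ?h // pat_drop // pat_take //.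
Qed.

Lemma tot_cat a b w : tot (a + b) w = tot a (fun u => tot b (fun v => w (u ++ v))).
Proof.
elim: a w => [|a IH] w //.
by rewrite addSn !totS; apply: eq_bigr => x _; rewrite IH.
Qed.

Lemma tot_rcons n w : tot n.+1 w = \sum_a tot n (fun s => w (rcons s a)).
Proof.
rewrite -marg_nseq -addn1 nseqD /= cats1 marg_rcons.
by apply: eq_bigr => a _; rewrite marg_nseq.
Qed.

Lemma tot_marg_cat j p w :
  tot j (fun u => marg (map Some u ++ p) w) = marg (nseq j None ++ p) w.
Proof.
elim: j w => [|j IH] w //; rewrite totS /=.
by apply: eq_bigr => a _; rewrite IH.
Qed.

End Rotation.

Lemma sqr_sum_le (R : realFieldType) (I : finType) (a b : I -> R) :
  (\sum_i a i * b i) ^+ 2 <= (\sum_i a i ^+ 2) * (\sum_i b i ^+ 2).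
Proof.
have h : 0 <= \sum_i \sum_j (a i * b j - a j * b i) ^+ 2.
  by apply: sumr_ge0 => i _; apply: sumr_ge0 => j _; apply: sqr_ge0.
have e : \sum_i \sum_j (a i * b j - a j * b i) ^+ 2 =
    \sum_i \sum_j a i ^+ 2 * b j ^+ 2 + \sum_i \sum_j a j ^+ 2 * b i ^+ 2
    - 2 * \sum_i \sum_j (a i * b i) * (a j * b j).
  rewrite mulr_sumr -big_split -sumrB; apply: eq_bigr => i _ /=.
  rewrite mulr_sumr -big_split -sumrB; apply: eq_bigr => j _ /=.
  by ring.
have d f g : \sum_i \sum_j f i * g j = (\sum_i f i) * (\sum_i g i) :> R.
  by rewrite mulr_suml; apply: eq_bigr => i _; rewrite mulr_sumr.
have d' : \sum_i \sum_j a j ^+ 2 * b i ^+ 2 = (\sum_i a i ^+ 2) * (\sum_i b i ^+ 2).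
  by rewrite exchange_big -d.
by move: h; rewrite e d' !d expr2; lra.
Qed.

(** A log-convex sequence is largest at one of its ends: if [u n] exceeded [c], the drop from [u n]
    to [u n.+1] would force a drop at every earlier step, and then [u 0] would exceed [c]. *)
Lemma log_convex_le (R : realFieldType) (u : nat -> R) n c :
  (forall i, (i <= n)%N -> 0 < u i) ->
  (forall i, (i.+2 <= n)%N -> u i.+1 ^+ 2 <= u i * u i.+2) ->
  u 0%N <= c -> u n <= c -> forall i, (i <= n)%N -> u i <= c.
Proof.
elim: n => [|n IH] u0 uc c0 cn i; first by rewrite leqn0 => /eqP ->.
rewrite leq_eqVlt => /orP[/eqP -> //|]; rewrite ltnS => hi.
have [h|h] := leP (u n) c.
  by apply: IH => // j hj; [apply: u0|apply: uc]; apply: leqW.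
suff : forall j, (j <= n)%N -> c < u (n - j)%N /\ u (n - j).+1 < u (n - j)%N.
  by move/(_ n (leqnn n)); rewrite subnn => -[]; lra.
elim=> [|j IHj] hj; first by rewrite subn0; split=> //; lra.
have [h1 h2] := IHj (ltnW hj).
have e : (n - j)%N = (n - j.+1).+1 by lia.
rewrite e in h1 h2.
have := uc (n - j.+1)%N; rewrite -e; move=> /(_ _) h3.
have {h3} : u (n - j.+1).+1 ^+ 2 <= u (n - j.+1)%N * u (n - j.+1).+2.
  by rewrite -e; apply: h3; lia.
have p1 : 0 < u (n - j.+1)%N by apply: u0; lia.
have p2 : 0 < u (n - j.+1).+1 by apply: u0; lia.
have p3 : 0 < u (n - j.+1).+2 by apply: u0; lia.
rewrite expr2 => h3.
have h4 : u (n - j.+1).+1 < u (n - j.+1)%N.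
  by rewrite -(ltr_pM2r p2); apply: le_lt_trans h3 _; rewrite ltr_pM2l.
by split; [exact: lt_trans h1 h4|rewrite e].
Qed.

Section Kernels.
Variables (R : realFieldType) (E V : finType) (G : {set E}) (pt : bool -> E -> V).
Implicit Types (b : bool) (e f c : E) (s t : seq E).

Definition edeg b e := #|[set f in G | pt b f == pt b e]|.

(* One step of the walk on edges: from e move to a uniformly random edge of G
   through the endpoint pt b e. *)
Definition K b e f : R :=
  if [&& e \in G, f \in G & pt b e == pt b f] then (edeg b e)%:R^-1 else 0.

Fixpoint alt b n e f : R :=
  if n is n'.+1 then \sum_c K b e c * alt (~~ b) n' c f else K b e f.

Arguments alt : simpl never.

Lemma altS b n e f : alt b n.+1 e f = \sum_c K b e c * alt (~~ b) n c f.
Proof. by []. Qed.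

Fixpoint chain b e s f : R :=
  if s is c :: s' then K b e c * chain (~~ b) c s' f else K b e f.

Definition cw b t : R := if t is e :: s then chain b e s e else 0.

Lemma edeg_gt0 b e : e \in G -> (0 < edeg b e)%N.
Proof. by move=> eG; apply/card_gt0P; exists e; rewrite inE eG eqxx. Qed.

Lemma eq_edeg b e f : pt b e = pt b f -> edeg b e = edeg b f.
Proof. by rewrite /edeg => ->. Qed.

Lemma K_ge0 b e f : 0 <= K b e f.
Proof. by rewrite /K; case: ifP => // _; rewrite invr_ge0. Qed.

Lemma K_sym b e f : K b e f = K b f e.
Proof.
rewrite /K eq_sym andbCA; case: ifP => // /and3P[_ _ /eqP h].
by rewrite (eq_edeg (esym h)).
Qed.

Lemma alt_ge0 b n e f : 0 <= alt b n e f.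
Proof.
elim: n b e f => [|n IH] b e f; first exact: K_ge0.
by rewrite altS; apply: sumr_ge0 => c _; rewrite mulr_ge0 ?K_ge0.
Qed.

Lemma chain_ge0 b e s f : 0 <= chain b e s f.
Proof.
by elim: s b e => [|c s IH] b e /=; rewrite ?K_ge0 // mulr_ge0 ?K_ge0.
Qed.

Lemma K_out b e f : e \notin G -> K b e f = 0.
Proof. by rewrite /K => /negPf ->. Qed.

Lemma K_row b e : \sum_f K b e f = (e \in G)%:R.
Proof.
have [eG|eG] := boolP (e \in G); last by rewrite big1 // => f _; apply: K_out.
rewrite /K eG /= -big_mkcond /= sumr_const -[LHS]mulr_natl.
have -> : #|[pred f | (f \in G) && (pt b e == pt b f)]| = edeg b e.
  by apply: eq_card => f; rewrite !inE eq_sym.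
by rewrite divff // pnatr_eq0 -lt0n edeg_gt0.
Qed.

(** Resampling twice through the same vertex amounts to resampling once: [K b] is an orthogonal
    projection. *)
Lemma K_idem b e f : \sum_c K b e c * K b c f = K b e f.
Proof.
have [h|h] := boolP [&& e \in G, f \in G & pt b e == pt b f]; last first.
  rewrite {3}/K (negPf h) big1 // => c _; rewrite /K; case: ifP => [|_]; last by rewrite mul0r.
  case/and3P=> eG cG /eqP ec; case: ifP => [|_]; last by rewrite mulr0.
  by case/and3P=> _ fG /eqP cf; case/negP: h; rewrite eG fG ec cf eqxx.
have [eG fG /eqP ef] := and3P h.
transitivity (\sum_c K b e c * (edeg b e)%:R^-1).
  apply: eq_bigr => c _; rewrite {1 3}/K; case: ifP => [|_]; last by rewrite !mul0r.
  case/and3P => _ cG /eqP ec; congr (_ * _).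
  by rewrite /K cG fG -ec ef eqxx (eq_edeg (esym ec)).
by rewrite -mulr_suml K_row eG mul1r /K h.
Qed.

Lemma alt_cat b m n e f :
  alt b (m + n).+1 e f = \sum_c alt b m e c * alt (b (+) odd m.+1) n c f.
Proof.
elim: m b e => [|m IH] b e; first by rewrite add0n addbT.
rewrite addSn altS; under eq_bigr do rewrite IH mulr_sumr.
rewrite exchange_big; apply: eq_bigr => c _; rewrite altS mulr_suml.
by apply: eq_bigr => g _; rewrite mulrA addNb -addbN.
Qed.

Lemma alt_catr b n e f :
  alt b n.+1 e f = \sum_c alt b n e c * K (b (+) odd n.+1) c f.
Proof. by rewrite -[n in LHS]addn0 alt_cat. Qed.

Lemma alt_sym b n e f : alt b n e f = alt (b (+) odd n) n f e.
Proof.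
elim: n b e f => [|n IH] b e f; first by rewrite addbF; apply: K_sym.
rewrite altS alt_catr; apply: eq_bigr => c _; rewrite mulrC IH; congr (_ * _).
  by rewrite /= addNb addbN.
by rewrite K_sym -addbA addbb addbF.
Qed.

(** The last step of the first walk and the first step of the second go through the same kind of
    vertex and merge by [K_idem]; m+1 and n+1 steps make m+n+1. *)
Lemma alt_overlap b m n e f :
  \sum_c alt b m e c * alt (b (+) odd m) n c f = alt b (m + n) e f.
Proof.
elim: m b e => [|m IH] b e.
  rewrite addbF add0n; case: n => [|n]; first exact: K_idem.
  under eq_bigr do rewrite altS mulr_sumr.
  rewrite exchange_big altS; apply: eq_bigr => c _.
  by under eq_bigr do rewrite mulrA; rewrite -mulr_suml K_idem.
rewrite addSn altS; under eq_bigr do rewrite altS mulr_suml.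
rewrite exchange_big; apply: eq_bigr => c _; rewrite -IH mulr_sumr.
by apply: eq_bigr => g _; rewrite mulrA addNb /= addbN.
Qed.

Definition trc b n : R := \sum_e alt b n e e.

(* Closed walks of length 2 h: alt b n makes n + 1 steps. *)
Definition cyc h := trc false h.*2.-1.

Lemma trc_odd b n : odd n -> trc b n = trc (~~ b) n.
Proof.
case: n => [|n] // hn; rewrite /trc; under eq_bigr do rewrite altS.
rewrite exchange_big; apply: eq_bigr => c _.
rewrite alt_catr hn addbT negbK.
by apply: eq_bigr => e _; rewrite mulrC.
Qed.

Lemma trc_cyc b h : (0 < h)%N -> trc b h.*2.-1 = cyc h.
Proof.
by case: h b => [|h] // [] _; rewrite /cyc // trc_odd //= odd_double.
Qed.

(** A closed walk of 2h+1 steps begins and ends with the same kind of step; around the base point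
    these two merge and 2h steps remain. *)
Lemma trc_even b h : (0 < h)%N -> trc b h.*2 = cyc h.
Proof.
case: h => [|h] // _; rewrite -(trc_cyc b) // doubleS /trc.
under eq_bigr do rewrite alt_catr.
rewrite exchange_big; apply: eq_bigr => c _.
rewrite -[RHS]/(alt b (0 + h.*2.+1) c c) -alt_overlap addbF.
by apply: eq_bigr => g _; rewrite mulrC /= odd_double /= addbF.
Qed.

Lemma alt_norm b n : (0 < n)%N -> \sum_e \sum_f alt b n e f ^+ 2 = cyc n.
Proof.
move=> n0; rewrite -(trc_even b) // -addnn; apply: eq_bigr => e _.
rewrite -alt_overlap; apply: eq_bigr => f _.
by rewrite expr2; congr (_ * _); apply: alt_sym.
Qed.

(** Cauchy-Schwarz: [alt_overlap] writes the closed walks counted by [cyc h.+1] as an inner product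
    of [alt h] and [alt h.+2], whose square norms are [cyc h] and [cyc h.+2] by [alt_norm]. *)
Lemma cyc_convex h : (0 < h)%N -> cyc h.+1 ^+ 2 <= cyc h * cyc h.+2.
Proof.
move=> h0; rewrite -(trc_even false (h := h.+1)) // -(alt_norm false) //.
rewrite -(alt_norm false (n := h.+2)) //.
rewrite !pair_bigA /= -[leLHS]/(_ ^+ 2).
apply: le_trans (sqr_sum_le (fun p => alt false h p.1 p.2)
  (fun p => alt false h.+2 p.1 p.2)).
rewrite le_eqVlt; apply/orP; left; apply/eqP; congr (_ ^+ 2).
rewrite -(pair_bigA _ (fun e f => alt false h e f * alt false h.+2 e f)) /=.
apply: eq_bigr => e _; have -> : h.+1.*2 = (h + h.+2)%N by lia.
rewrite -alt_overlap; apply: eq_bigr => f _; congr (_ * _).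
by rewrite alt_sym /= negbK addbb.
Qed.

End Kernels.

Arguments alt : simpl never.

(** * Marginals of the walk *)

Section WalkBounds.
Variables (R : realFieldType) (E V : finType) (G : {set E}) (pt : bool -> E -> V).
Variables (D theta : R).
Hypothesis D0 : 0 < D.
Hypothesis th0 : 0 < theta.
Hypothesis hdeg : forall b e, e \in G -> D <= (edeg G pt b e)%:R.
Hypothesis hcod : forall b e f, e \in G -> f \in G ->
  #|[set g in G | (pt b g == pt b e) && (pt (~~ b) g == pt (~~ b) f)]|%:R
    <= theta * (edeg G pt b e)%:R.
Implicit Types (b : bool) (e f c : E) (s t : seq E).

Notation K := (K R G pt).
Notation alt := (alt R G pt).
Notation chain := (chain R G pt).
Notation cw := (cw R G pt).
Notation cyc := (cyc R G pt).

Lemma K_le b e f : K b e f <= D^-1.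
Proof.
rewrite /K; case: ifP => [/andP[eG _]|_]; last by rewrite invr_ge0 ltW.
by rewrite lef_pV2 ?posrE ?ltr0n ?edeg_gt0 ?hdeg.
Qed.

(** The chance that a step through one endpoint arrives at an edge with a prescribed other endpoint
    is a codegree divided by a degree. *)
Lemma K_land b e v : \sum_f (pt b f == v)%:R * K (~~ b) e f <= theta.
Proof.
have [eG|eG] := boolP (e \in G); last first.
  by rewrite big1 ?ltW // => f _; rewrite K_out ?mulr0.
have dp : 0 < (edeg G pt (~~ b) e)%:R :> R by rewrite ltr0n edeg_gt0.
have [f0 /andP[f0G /eqP f0v]|none] := pickP (fun f => (f \in G) && (pt b f == v)).
  rewrite -(ler_pM2r dp) mulr_suml.
  have := hcod (~~ b) eG f0G; rewrite negbK; apply: le_trans.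
  rewrite -sum1_card natr_sum [leRHS]big_mkcond; apply: ler_sum => f _.
  rewrite /K; case: ifP => [/and3P[_ fG /eqP ef]|_]; last first.
    by rewrite mulr0 mul0r; case: ifP.
  by rewrite inE fG ef eqxx f0v /= -mulrA mulVf ?gt_eqF // mulr1; case: ifP.
rewrite big1 ?ltW // => f _; rewrite /K; case: ifP => [/and3P[_ fG _]|_].
  by have := none f; rewrite fG /= => ->; rewrite mul0r.
by rewrite mulr0.
Qed.

Lemma K2_le b e f : \sum_c K b e c * K (~~ b) c f <= theta / D.
Proof.
apply: le_trans (_ : \sum_c (D^-1 * ((pt (~~ b) c == pt (~~ b) f)%:R * K b e c)) <= _).
  apply: ler_sum => c _; rewrite [leLHS]mulrC.
  have [h|h] := eqVneq (pt (~~ b) c) (pt (~~ b) f).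
    by rewrite mul1r ler_wpM2r ?K_ge0 ?K_le.
  by rewrite {1}/K (negPf h) !andbF /= !mul0r mulr0.
rewrite -mulr_sumr mulrC ler_wpM2r ?invr_ge0 ?(ltW D0) //.
by have := K_land (~~ b) e (pt (~~ b) f); rewrite negbK.
Qed.

Lemma avg_le b e (g : E -> R) x : 0 <= x -> (forall c, g c <= x) ->
  \sum_c K b e c * g c <= x.
Proof.
move=> x0 gx; apply: le_trans (_ : \sum_c K b e c * x <= _).
  by apply: ler_sum => c _; rewrite ler_wpM2l ?K_ge0.
by rewrite -mulr_suml K_row; case: (e \in G); rewrite ?mul1r ?mul0r.
Qed.

Lemma thD_ge0 : 0 <= theta / D. Proof. by rewrite divr_ge0 // ltW. Qed.

Lemma alt_le b n e f : alt b n.+1 e f <= theta / D.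
Proof.
elim: n b e => [|n IH] b e; rewrite altS; first exact: K2_le.
by apply: avg_le thD_ge0 _ => c; apply: IH.
Qed.

Lemma alt_row b n e : \sum_f alt b n e f = (e \in G)%:R.
Proof.
elim: n b e => [|n IH] b e; first exact: K_row.
under eq_bigr do rewrite altS.
rewrite exchange_big /=; under eq_bigr do rewrite -mulr_sumr IH.
rewrite -(K_row R G pt b e); apply: eq_bigr => c _.
have [cG|cG] := boolP (c \in G); first by rewrite mulr1.
by rewrite mulr0 K_sym K_out.
Qed.

Lemma tot_chain b n e f : tot n (fun s => chain b e s f) = alt b n e f.
Proof.
elim: n b e => [|n IH] b e //; rewrite totS altS.
by apply: eq_bigr => c _; rewrite -IH -totZ.
Qed.

Lemma tot_cw b n : tot n.+1 (cw b) = trc R G pt b n.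
Proof. by rewrite totS; apply: eq_bigr => e _; rewrite /= tot_chain. Qed.

(** The number of gaps, that is of maximal blocks of [None]; [gap] records that a block is already
    under way. *)
Fixpoint runs (gap : bool) (p : seq (option E)) : nat :=
  match p with
  | [::] => 0
  | Some _ :: p' => runs false p'
  | None :: p' => ~~ gap + runs true p'
  end.

Lemma margZ (p : seq (option E)) (x : R) (w : seq E -> R) :
  marg p (fun s => x * w s) = x * marg p w.
Proof.
elim: p w => [|[a|] p IH] w //=.
by rewrite mulr_sumr; apply: eq_bigr => a _; rewrite IH.
Qed.

(** Each prescribed edge, and the final one, costs 1/D; each gap costs a further [theta], as in
    [K2_le]. The second claim is the same bound from inside a gap, which the induction needs. *)
Lemma marg_chain_aux (p : seq (option E)) :
  (forall b e f, marg p (fun s => chain b e s f)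
     <= theta ^+ runs false p * D^-1 ^+ (psize p).+1) /\
  (forall b e f, \sum_c K b e c * marg p (fun s => chain (~~ b) c s f)
     <= theta ^+ (runs true p).+1 * D^-1 ^+ (psize p).+1).
Proof.
have Di : 0 <= D^-1 by rewrite invr_ge0 ltW.
have pos k l : 0 <= theta ^+ k * D^-1 ^+ l by rewrite mulr_ge0 ?exprn_ge0 // ltW.
elim: p => [|[v|] p [IH1 IH2]]; split=> b e f.
- by rewrite /= expr0 mul1r expr1 K_le.
- by rewrite /= !expr1; apply: K2_le.
- rewrite /= margZ exprS mulrCA.
  by apply: ler_pM; rewrite ?K_ge0 ?K_le ?IH1 // marg_ge0 // => s _; apply: chain_ge0.
- rewrite /=; under eq_bigr do rewrite margZ mulrA.
  rewrite -mulr_suml exprS [_ ^+ (1 + _).+1]exprS mulrACA.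
  apply: ler_pM; rewrite ?IH1 //.
  + by apply: sumr_ge0 => c _; rewrite mulr_ge0 ?K_ge0.
  + by apply: marg_ge0 => s _; apply: chain_ge0.
  + exact: K2_le.
- rewrite [marg _ _]/=; under eq_bigr do rewrite margZ.
  exact: IH2.
- rewrite [runs _ _]/= add0n; apply: avg_le; first exact: pos.
  move=> c; rewrite [marg _ _]/=; under eq_bigr do rewrite margZ.
  exact: IH2.
Qed.

Lemma marg_cw b a (p : seq (option E)) :
  marg (Some a :: p) (cw b) <= theta ^+ runs false p * D^-1 ^+ (psize p).+1.
Proof. by have [h _] := marg_chain_aux p; rewrite /=; apply: h. Qed.

End WalkBounds.

Section BadEvents.
Variables (R : realFieldType) (E V : finType) (G : {set E}) (pt : bool -> E -> V).
Variables (D theta : R).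
Hypothesis D0 : 0 < D.
Hypothesis th0 : 0 < theta.
Hypothesis hdeg : forall b e, e \in G -> D <= (edeg G pt b e)%:R.
Hypothesis hcod : forall b e f, e \in G -> f \in G ->
  #|[set g in G | (pt b g == pt b e) && (pt (~~ b) g == pt (~~ b) f)]|%:R
    <= theta * (edeg G pt b e)%:R.
Variables (B tau : R).
Hypothesis B0 : 0 < B.
Hypothesis tau0 : 0 < tau.
Implicit Types (b : bool) (e f c : E) (s t : seq E) (w : seq E -> R) (m : bitseq).

Notation K := (K R G pt).
Notation alt := (alt R G pt).
Notation chain := (chain R G pt).
Notation cw := (cw R G pt).
Notation cyc := (cyc R G pt).

(** Half of the marginal allowed in [balanced]; the other half leaves room for adding a small
    multiple of a tuple. *)
Definition psat w (p : seq (option E)) := B * tau ^+ (psize p).-1 / 2 < marg p w.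

Lemma cw_ge0 b t : 0 <= cw b t.
Proof. by case: t => //= a s; apply: chain_ge0. Qed.

Lemma psat_le w (p : seq (option E)) :
  (forall s, size s = size p -> 0 <= w s) ->
  (psat w p)%:R <= 2 / (B * tau ^+ (psize p).-1) * marg p w.
Proof.
move=> w0; have c0 : 0 < B * tau ^+ (psize p).-1 by rewrite mulr_gt0 ?exprn_gt0.
rewrite /psat; case: ltP => h; last by rewrite mulr_ge0 ?marg_ge0 // divr_ge0 // ltW.
by rewrite mulrAC ler_pdivlMr // mul1r; lra.
Qed.

Fixpoint mruns (gap : bool) m : nat :=
  match m with
  | [::] => 0
  | true :: m' => mruns false m'
  | false :: m' => ~~ gap + mruns true m'
  end.

Lemma runs_pat gap m s : size m = size s -> runs gap (pat m s) = mruns gap m.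
Proof. by elim: m gap s => [|[] m IH] gap [|a s] //= [h]; rewrite IH. Qed.

(** Markov's inequality as in [dead_mass]: [marg_exchange_le] trades the marginal of [w] for the
    largest marginal of [cw], where each gap contributes [theta]. *)
Lemma bad_sup b w m n : size m = n ->
  (forall s, size s = n.+1 -> 0 <= w s) -> tot n.+1 w <= 1 ->
  tot n.+1 (fun t => cw b t * (psat w (pat (true :: m) t))%:R) <=
    2 / (B * tau ^+ (count id m)) * (theta ^+ mruns false m * D^-1 ^+ (count id m).+1).
Proof.
move=> mn w0 w1; subst n; set n := size m; set c := 2 / _; set d := _ * _ ^+ _.
have c0 : 0 <= c by rewrite divr_ge0 // mulr_ge0 ?exprn_ge0 // ltW.
have d0 : 0 <= d by rewrite mulr_ge0 ?exprn_ge0 ?invr_ge0 // ltW.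
apply: le_trans (_ : tot n.+1 (fun t => c * (cw b t * marg (pat (true :: m) t) w)) <= _).
  apply: ler_tot => s hs; rewrite mulrCA ler_wpM2l ?cw_ge0 //.
  have sp : size (pat (true :: m) s) = n.+1 by rewrite size_pat // hs.
  have := @psat_le w (pat (true :: m) s).
  by rewrite psize_pat ?hs //=; apply; rewrite sp.
rewrite totZ ler_wpM2l //; apply: le_trans (_ : d * tot n.+1 w <= _); last first.
  by rewrite ler_piMr.
apply: (@marg_exchange_le R E (true :: m) w (cw b) d) => // -[|a s] //= [hs].
rewrite /d -(@runs_pat false _ s) // -(psize_pat (esym hs)).
have := marg_cw D0 th0 hdeg hcod b a (pat m s).
by rewrite /=; apply.
Qed.

Fixpoint pw b e s : R := if s is c :: s' then K b e c * pw (~~ b) c s' else 1.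

Lemma pw_ge0 b e s : 0 <= pw b e s.
Proof. by elim: s b e => [|c s IH] b e //=; rewrite mulr_ge0 ?K_ge0. Qed.

Lemma pw_le b e s : pw b e s <= D^-1 ^+ size s.
Proof.
elim: s b e => [|c s IH] b e; first by rewrite expr0.
by rewrite /= exprS ler_pM ?K_ge0 ?pw_ge0 // (K_le D0 hdeg).
Qed.

Lemma chain_cat b e s s' f : chain b e (s ++ s') f =
  pw b e s * chain (b (+) odd (size s)) (last e s) s' f.
Proof.
elim: s b e => [|c s IH] b e /=; first by rewrite mul1r addbF.
by rewrite IH mulrA addNb -addbN.
Qed.

Lemma alt_amgm b h h' e f : alt b (h + h') e f <=
  (\sum_c alt b h e c ^+ 2 + \sum_c alt (b (+) odd h) h' c f ^+ 2) / 2.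
Proof.
rewrite -alt_overlap -big_split mulr_suml; apply: ler_sum => c _ /=.
set x := alt _ _ _ _; set y := alt _ _ _ _.
by have := sqr_ge0 (x - y); rewrite sqrrB; lra.
Qed.

Lemma psize_Some v (p : seq (option E)) : psize (map Some v ++ p) = (size v + psize p)%N.
Proof. by rewrite /psize count_cat count_map; congr addn; rewrite -[RHS](count_predT v). Qed.

Lemma psize_None n : psize (nseq n (@None E)) = 0%N.
Proof. by rewrite /psize count_nseq mul0n. Qed.

(* Summed over the paths through a fixed first (or last) edge, the number of
   saturated paths is controlled by the marginal of that single edge. *)
Lemma psat_count_first w j q a : let n := (j.+1 + q)%N in
  (forall s, size s = n -> 0 <= w s) ->
  (forall p, size p = n -> psize p = 1%N -> marg p w <= B) ->
  tot j (fun u => (psat w (map Some (a :: u) ++ nseq q None))%:R) <= 2 / tau ^+ j.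
Proof.
move=> n w0 w1.
apply: le_trans (_ : tot j (fun u => 2 / (B * tau ^+ j) *
    marg (map Some u ++ nseq q None) (fun s => w (a :: s))) <= _).
  apply: ler_tot => u hu; have := @psat_le w (map Some (a :: u) ++ nseq q None).
  by rewrite psize_Some psize_None addn0 /= hu size_cat size_map size_nseq hu; apply.
rewrite totZ tot_marg_cat.
apply: le_trans (ler_wpM2l _ (_ : _ <= B)) _.
- by rewrite divr_ge0 // mulr_ge0 ?exprn_ge0 // ltW.
- have := w1 (Some a :: nseq j None ++ nseq q None); rewrite /=; apply.
    by rewrite size_cat !size_nseq.
  by rewrite -nseqD; have := psize_None (j + q); rewrite /psize /= => ->.
- rewrite le_eqVlt; apply/orP; left; apply/eqP.
  by field; rewrite expf_neq0 ?gt_eqF.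
Qed.

Lemma psat_count_last w j q f : let n := (j.+1 + q)%N in
  (forall s, size s = n -> 0 <= w s) ->
  (forall p, size p = n -> psize p = 1%N -> marg p w <= B) ->
  tot j (fun u => (psat w (map Some (rcons u f) ++ nseq q None))%:R) <= 2 / tau ^+ j.
Proof.
move=> n w0 w1.
apply: le_trans (_ : tot j (fun u => 2 / (B * tau ^+ j) *
    marg (map Some u ++ Some f :: nseq q None) w) <= _).
  apply: ler_tot => u hu; have := @psat_le w (map Some (rcons u f) ++ nseq q None).
  rewrite psize_Some psize_None addn0 size_rcons /= hu map_rcons cat_rcons.
  by apply; rewrite size_cat size_map /= size_nseq hu -addSnnS.
rewrite totZ tot_marg_cat.
apply: le_trans (ler_wpM2l _ (_ : _ <= B)) _.
- by rewrite divr_ge0 // mulr_ge0 ?exprn_ge0 // ltW.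
- apply: w1; first by rewrite size_cat /= !size_nseq -addSnnS.
  by rewrite /psize count_cat -/(psize _) -/(psize _) psize_None /psize /= count_nseq mul0n.
- rewrite le_eqVlt; apply/orP; left; apply/eqP.
  by field; rewrite expf_neq0 ?gt_eqF.
Qed.

Lemma pat_path j q v s : size v = j -> size s = q ->
  pat (nseq j true ++ nseq q false) (v ++ s) = map Some v ++ nseq q None.
Proof.
move=> hv hs; rewrite pat_cat ?size_nseq ?hv //; congr (_ ++ _).
  by elim: v j hv => [|a v IH] [|j] //= [/IH ->].
by elim: s q hs => [|a s IH] [|q] //= [/IH ->].
Qed.

(** For a short block of prescribed edges followed by one long gap, the single [theta] of [bad_sup]
    is too weak. Here [alt_amgm] cuts the walk across the gap into two pieces with square norms
    [cyc h] and [cyc h'], each attached to one end of the block, and the saturated blocks with that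
    end fixed are counted by [psat_count_last] or [psat_count_first]. *)
Lemma bad_path b w j h h' n : n = (j.+2 + (h + h'))%N ->
  (0 < h)%N -> (0 < h')%N ->
  (forall s, size s = n -> 0 <= w s) ->
  (forall p, size p = n -> psize p = 1%N -> marg p w <= B) ->
  tot n (fun t => cw b t *
     (psat w (pat (nseq j.+2 true ++ nseq (h + h') false) t))%:R) <=
    (cyc h + cyc h') / (tau * D) ^+ j.+1.
Proof.
move=> nE h0 h'0 w0 w1; subst n; set q := (h + h')%N.
pose b' := b (+) odd j.+1.
pose g v : R := (psat w (map Some v ++ nseq q None))%:R.
pose U f := \sum_c alt b' h f c ^+ 2.
pose W a := \sum_c alt (b' (+) odd h) h' c a ^+ 2.
have U0 f : 0 <= U f by apply: sumr_ge0 => c _; apply: sqr_ge0.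
have W0 f : 0 <= W f by apply: sumr_ge0 => c _; apply: sqr_ge0.
have g0 v : 0 <= g v by [].
pose F1 v := if v is a :: u then g v * U (last a u) else 0.
pose F2 v := if v is a :: u then g v * W a else 0.
have Di : 0 <= D^-1 ^+ j.+1 by rewrite exprn_ge0 // invr_ge0 ltW.
have t0 : 0 <= 2 / tau ^+ j.+1 by rewrite divr_ge0 // exprn_ge0 // ltW.
apply: le_trans (_ : tot j.+2 (fun v => (D^-1 ^+ j.+1 / 2) * (F1 v + F2 v)) <= _).
  rewrite tot_cat; apply: ler_tot => -[|a u] // hu0; have hu : size u = j.+1 by case: hu0.
  apply: le_trans (_ : pw b a u * g (a :: u) * alt b' q (last a u) a <= _).
    rewrite -(tot_chain R G pt) -totZ le_eqVlt; apply/orP; left; apply/eqP.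
    apply: eq_tot => s hs; rewrite (@pat_path j.+2 q (a :: u) s) //.
    by rewrite -[cw b _]/(chain b a (u ++ s) a) chain_cat hu -/b' /g mulrAC.
  have := alt_amgm b' h h' (last a u) a; rewrite -/(U _) -/(W _) => h1.
  apply: le_trans (ler_wpM2l _ h1) _; first by rewrite mulr_ge0 ?pw_ge0.
  have -> : D^-1 ^+ j.+1 / 2 * (F1 (a :: u) + F2 (a :: u)) =
      D^-1 ^+ j.+1 * (g (a :: u) * ((U (last a u) + W a) / 2)).
    by rewrite /F1 /F2; field.
  rewrite -mulrA ler_wpM2r ?mulr_ge0 ?addr_ge0 ?invr_ge0 //.
  by rewrite -hu pw_le.
rewrite totZ totD.
have h1 : tot j.+2 F1 <= 2 / tau ^+ j.+1 * cyc h.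
  rewrite tot_rcons -(alt_norm R G pt b' h0) mulr_sumr; apply: ler_sum => f _.
  apply: le_trans (_ : tot j.+1 (fun s => U f * g (rcons s f)) <= _).
    by apply: ler_tot => -[|a s] //= _; rewrite last_rcons mulrC.
  rewrite totZ mulrC ler_wpM2r // /g.
  exact: (psat_count_last f w0 w1).
have h2 : tot j.+2 F2 <= 2 / tau ^+ j.+1 * cyc h'.
  rewrite totS -(alt_norm R G pt (b' (+) odd h) h'0).
  rewrite [X in _ * X]exchange_big mulr_sumr.
  apply: ler_sum => a _ /=.
  apply: le_trans (_ : tot j.+1 (fun s => W a * g (a :: s)) <= _).
    by apply: ler_tot => s _ /=; rewrite mulrC.
  rewrite totZ mulrC ler_wpM2r // /g.
  exact: (psat_count_first a w0 w1).
apply: le_trans (ler_wpM2l _ (lerD h1 h2)) _; first by rewrite divr_ge0.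
rewrite le_eqVlt; apply/orP; left; apply/eqP.
by rewrite exprVn exprMn; field; rewrite !expf_neq0 ?gt_eqF.
Qed.

End BadEvents.

Lemma mruns_ge1 m : last true m = false -> (1 <= mruns false m)%N.
Proof. by elim: m => [|[] m IH] //= h; apply: IH. Qed.

Lemma mruns_true m : has id m -> last false m = false -> (1 <= mruns true m)%N.
Proof.
by elim: m => [|[] m IH] // h l; apply: mruns_ge1 l.
Qed.

Lemma mruns_cases m : last true m = false ->
  (2 <= mruns false m)%N \/ exists j q, m = nseq j true ++ nseq q.+1 false.
Proof.
elim: m => [|[] m IH] //= l.
  by have [h|[j [q ->]]] := IH l; [left|right; exists j.+1, q].
have [h|h] := boolP (has id m); first by left; rewrite ltnS mruns_true.
right; exists 0%N, (size m); rewrite /= -/(nseq _ _); congr cons.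
by elim: m h {IH l} => [|[] m IH] //= /IH {1}->.
Qed.

(** Closed walks may be rotated, so a mask that is not constant may be taken to begin with [true]
    and end with [false]; by [mruns_cases] it then is one block and one gap, or has two gaps. *)
Lemma mask_rot_ind (P : bitseq -> Prop) m :
  (forall k m', (k <= size m')%N -> size m' = size m -> P m' -> P (rot k m')) ->
  has id m ->
  (P (nseq (size m) true)) ->
  (forall j q, size m = (j.+1 + q.+1)%N -> P (nseq j.+1 true ++ nseq q.+1 false)) ->
  (forall m', size m = (size m').+1 -> (2 <= mruns false m')%N -> P (true :: m')) ->
  P m.
Proof.
move=> Prot hm Pt Pp Pr.
have Protr k m' : size m' = size m -> P (rot k m') -> P m'.
  move=> sm; rewrite -{2}(rotK k m') => h.
  by apply: Prot; rewrite ?size_rot ?leq_subr.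
have [/all_pred1P ->//|/allPn[x xm xt]] := boolP (all (pred1 true) m).
have {x xm xt} fm : false \in m by case: x xm xt.
(* First a [false] is rotated to the front, then the first [true] after it; what stands before that
   [true] moves to the end and is [false]. *)
apply: (Protr (index false m)) => //; set m1 := rot _ m.
have s1 : size m1 = size m by rewrite size_rot.
have i0 : (index false m < size m)%N by rewrite index_mem.
have [m2 e1] : exists m2, m1 = false :: m2.
  by exists (drop (index false m).+1 m ++ take (index false m) m);
    rewrite /m1 /rot (drop_nth false i0) nth_index.
have tm : true \in m1 by rewrite mem_rot; case/hasP: hm => -[].
apply: (Protr (index true m1)) => //.
have i1 : (index true m1 < size m1)%N by rewrite index_mem.
have [m3 e3 l3] : exists2 m3, rot (index true m1) m1 = true :: m3 & last true m3 = false.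
  exists (drop (index true m1).+1 m1 ++ take (index true m1) m1).
    by rewrite /rot (drop_nth false i1) nth_index.
  have {2}-> : index true m1 = (index true m2).+1 by rewrite e1.
  rewrite last_cat e1 /=.
  apply/negbTE/negP => h; have : true \in false :: take (index true m2) m2.
    by rewrite -[X in X \in _]h mem_last.
  by rewrite inE /= => /index_ltn; rewrite ltnn.
rewrite e3; have s3 : size m = (size m3).+1.
  by rewrite -s1 -(size_rot (index true m1)) e3.
have [h|[j [q e]]] := mruns_cases l3; first exact: Pr.
by rewrite e; apply: Pp; rewrite s3 e size_cat !size_nseq.
Qed.

(** * Closed walks with repetitions, and the growth of [cyc] *)

Section Existence.
Variables (R : realFieldType) (E V : finType) (G : {set E}) (pt : bool -> E -> V).
Variables (D theta : R).
Hypothesis D0 : 0 < D.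
Hypothesis th0 : 0 < theta.
Hypothesis th1 : theta <= 1.
Hypothesis hdeg : forall b e, e \in G -> D <= (edeg G pt b e)%:R.
Hypothesis hcod : forall b e f, e \in G -> f \in G ->
  #|[set g in G | (pt b g == pt b e) && (pt (~~ b) g == pt (~~ b) f)]|%:R
    <= theta * (edeg G pt b e)%:R.
Implicit Types (b : bool) (e f c : E) (s t : seq E) (w : seq E -> R) (m : bitseq).

Notation K := (K R G pt).
Notation alt := (alt R G pt).
Notation chain := (chain R G pt).
Notation cw := (cw R G pt).
Notation cyc := (cyc R G pt).

Lemma chain_mid b e s f s' g : chain b e (s ++ f :: s') g =
  chain b e s f * chain (b (+) ~~ odd (size s)) f s' g.
Proof.
have h := chain_cat R G pt b e s [::] f; rewrite cats0 in h.
by rewrite h chain_cat /= mulrA addbN.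
Qed.

Lemma cw_rot1 b t : ~~ odd (size t) -> cw b (rot 1 t) = cw (~~ b) t.
Proof.
case: t => [|a [|c s]] // ht; rewrite rot1_cons /=.
rewrite -cats1 chain_mid mulrC /= negbK; congr (_ * _).
by move: ht; rewrite /= negbK => /negPf ->; rewrite addbT.
Qed.

Lemma cw_rot b k t : ~~ odd (size t) -> (k <= size t)%N ->
  cw b (rot k t) = cw (b (+) odd k) t.
Proof.
move=> ht; elim: k b => [|k IH] b hk; first by rewrite rot0 addbF.
by rewrite (rotS hk) (@cw_rot1 b (rot k t)) ?size_rot // IH ?(ltnW hk) //= addNb addbN.
Qed.

(** The outward walk ends at a given edge with probability at most theta / D by [alt_le], and the
    walk back ends at the prescribed vertex with probability at most [theta] by [K_land]. *)
Lemma rep_bound b i i' x0 :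
  tot (i.*2.+1 + i'.*2.+2).+1
    (fun t => cw b t * (pt b (nth x0 t 0) == pt b (nth x0 t i.*2.+2))%:R)
   <= #|G|%:R * theta ^+ 2 / D.
Proof.
rewrite totS.
have e1 a : tot (i.*2.+1 + i'.*2.+2)
     (fun s => cw b (a :: s) * (pt b (nth x0 (a :: s) 0) == pt b (nth x0 (a :: s) i.*2.+2))%:R)
   = \sum_f (pt b a == pt b f)%:R * (alt b i.*2.+1 a f * alt b i'.*2.+1 f a).
  rewrite tot_cat; under eq_tot do rewrite totS.
  rewrite tot_sum; apply: eq_bigr => f _.
  transitivity (tot i.*2.+1 (fun u => (pt b a == pt b f)%:R * alt b i'.*2.+1 f a * chain b a u f)).
    apply: eq_tot => u hu; rewrite mulrAC -(tot_chain R G pt) -totZ; apply: eq_tot => v hv.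
    rewrite /= chain_mid hu /= nth_cat hu ltnn subnn /= odd_double addbF.
    by rewrite mulrC mulrA.
  by rewrite totZ tot_chain -mulrA [alt _ _ f a * _]mulrC.
under eq_bigr do rewrite e1.
have tD0 := thD_ge0 D0 th0.
apply: le_trans (_ : \sum_a \sum_f theta / D * ((pt b a == pt b f)%:R * alt b i'.*2.+1 f a) <= _).
  apply: ler_sum => a _; apply: ler_sum => f _; rewrite mulrCA ler_wpM2r //.
    by rewrite mulr_ge0 ?alt_ge0.
  exact: alt_le.
rewrite exchange_big /=.
apply: le_trans (_ : \sum_f theta / D * ((f \in G)%:R * theta) <= _).
  apply: ler_sum => f _; rewrite -mulr_sumr ler_wpM2l //.
  under eq_bigr do rewrite alt_catr mulr_sumr.
  rewrite exchange_big /= -(alt_row R G pt b i'.*2) mulr_suml.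
  apply: ler_sum => c _; under eq_bigr do rewrite mulrCA.
  rewrite -mulr_sumr ler_wpM2l ?alt_ge0 //= odd_double /= addbT.
  exact: K_land.
rewrite -mulr_sumr -mulr_suml -natr_sum.
have -> : (\sum_f (f \in G))%N = #|G|.
  by rewrite -sum1_card [RHS]big_mkcond; apply: eq_bigr => f _; case: (f \in G).
by rewrite le_eqVlt; apply/orP; left; apply/eqP; rewrite expr2; ring.
Qed.

Variables (Z : finType) (z : E -> Z) (a0 : R).
Hypothesis a00 : 0 < a0.
Hypothesis hinj : forall e f, e \in G -> f \in G ->
  (forall b, pt b e = pt b f) -> z e = z f -> e = f.
Hypothesis hz : forall e, e \in G ->
  a0 <= #|[set g in G | (pt false g == pt false e) && (pt true g == pt true e)]|%:R.

Lemma K_eql b e e' f : e \in G -> e' \in G -> pt b e = pt b e' ->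
  K b e f = K b e' f.
Proof. by move=> eG eG' h; rewrite /K eG eG' h (eq_edeg G h). Qed.

Lemma chain_eq b e e' s : e \in G -> e' \in G ->
  (forall b, pt b e = pt b e') -> chain b e s e = chain b e' s e'.
Proof.
move=> eG eG' h; case: s => [|c s] /=; first by rewrite (K_eql _ eG eG') // K_sym (K_eql _ eG eG') // K_sym.
rewrite (K_eql _ eG eG') //; congr (_ * _).
elim: s (~~ b) c => [|d s IH] b' c /=; last by rewrite IH.
by rewrite K_sym (K_eql _ eG eG') // K_sym.
Qed.

(** The first edge may be exchanged for any of the at least [a0] edges with the same two walk
    vertices without changing the weight ([chain_eq]), and at most one of them has the prescribed
    value of [z]. *)
Lemma col_bound b n k x0 : (k < n)%N ->
  tot n.+1 (fun t => cw b t * (z (nth x0 t 0) == z (nth x0 t k.+1))%:R)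
   <= tot n.+1 (cw b) / a0.
Proof.
move=> kn; rewrite !totS -!tot_sum mulrC -totZ; apply: ler_tot => s hs /=.
set y := z _; rewrite ler_pdivlMl //.
pose cl e := [set g in G | (pt false g == pt false e) && (pt true g == pt true e)].
have clP e g : g \in cl e -> g \in G /\ forall b, pt b g = pt b e.
  by rewrite inE => /and3P[gG /eqP h1 /eqP h2]; split=> // -[].
have g0 e : e \notin G -> chain b e s e = 0.
  by move=> eG; case: s {hs y} => [|c s] /=; rewrite K_out ?mul0r.
apply: le_trans (_ : \sum_e \sum_(c in cl e) (e \in G)%:R * (z e == y)%:R * chain b c s c <= _).
  rewrite mulr_sumr; apply: ler_sum => e _.
  have [eG|eG] := boolP (e \in G); last first.
    by rewrite g0 // mul0r mulr0; apply: sumr_ge0 => c _; rewrite !mul0r.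
  rewrite mul1r (eq_bigr (fun=> (z e == y)%:R * chain b e s e)); last first.
    by move=> c /clP[cG h]; rewrite (chain_eq b s cG eG h).
  rewrite sumr_const -[leRHS]mulr_natl [chain _ _ _ _ * _]mulrC ler_wpM2r ?hz //.
  by rewrite mulr_ge0 ?chain_ge0.
rewrite (exchange_big_dep xpredT) //=; apply: ler_sum => c _.
rewrite -mulr_suml ler_piMl ?chain_ge0 //.
have [e0 /and3P[e0G ce0 /eqP ze0]|none] := pickP (fun e => [&& e \in G, c \in cl e & z e == y]).
  rewrite (bigD1 e0) //= e0G ze0 eqxx mul1r big1 ?addr0 // => e /andP[ce ne].
  have [eG|] := boolP (e \in G); last by rewrite mul0r.
  have [ze|] := eqVneq (z e) y; last by rewrite mulr0.
  case/negP: ne; apply/eqP; apply: hinj => //; last by rewrite ze.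
  by move=> b'; have [_ <-] := clP _ _ ce; have [_ ->] := clP _ _ ce0.
rewrite big1 // => e ce; have := none e; rewrite ce /=.
by case: (e \in G); rewrite ?mul0r //= => ->; rewrite mulr0.
Qed.

(** The rows of [alt] at edges of [G] sum to 1, so by Cauchy-Schwarz each has square norm at least 1
    / |G|. *)
Lemma cyc_ge1 n : (0 < #|G|)%N -> (0 < n)%N -> 1 <= cyc n.
Proof.
move=> G0 n0; rewrite -(alt_norm R G pt false n0).
have Gp : 0 < #|G|%:R :> R by rewrite ltr0n.
have nG f : (f \in G)%:R ^+ 2 = (f \in G)%:R :> R.
  by case: (f \in G); rewrite ?expr1n ?expr0n.
have sG : \sum_f (f \in G)%:R = #|G|%:R :> R.
  by rewrite -natr_sum -sum1_card [in RHS]big_mkcond; congr _%:R;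
    apply: eq_bigr => f _; case: (f \in G).
have h1 e : (e \in G)%:R <= #|G|%:R * \sum_f alt false n e f ^+ 2.
  rewrite -nG -(alt_row R G pt false n e) -sG.
  under [\sum_i (i \in G)%:R]eq_bigr do rewrite -nG.
  apply: le_trans (sqr_sum_le _ _); rewrite le_eqVlt; apply/orP; left; apply/eqP.
  congr (_ ^+ 2); apply: eq_bigr => f _.
  have [fG|fG] := boolP (f \in G); first by rewrite mul1r.
  rewrite mul0r; case: (n) => [|k]; first by rewrite /alt K_sym K_out.
  by rewrite alt_catr big1 // => c _; rewrite K_sym K_out ?mulr0.
rewrite -(ler_pM2l Gp) mulr1 -{1}sG mulr_sumr.
by apply: ler_sum => e _; apply: h1.
Qed.

Lemma cyc_gt0 n : (0 < #|G|)%N -> (0 < n)%N -> 0 < cyc n.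
Proof. by move=> G0 n0; apply: lt_le_trans (cyc_ge1 G0 n0). Qed.

Lemma cyc1_le : cyc 1 <= #|G|%:R * (theta / D).
Proof.
rewrite -(trc_cyc R G pt false (isT : (0 < 1)%N)) -[_.-1]/1%N /trc.
rewrite (bigID (mem G)) /= [X in _ + X]big1 ?addr0; last first.
  by move=> e eG; rewrite altS big1 // => c _; rewrite K_out ?mul0r.
rewrite [leRHS]mulr_natl -sumr_const; apply: ler_sum => e _.
exact: alt_le.
Qed.

(** Log-convexity applied to q^i cyc(i+1): at the left end [cyc1_le] and the hypothesis on |G| theta
    / D bound it by q^(r-1) <= q^(r-1) cyc(r), its value at the right end. *)
Lemma cyc_le q r h : (0 < #|G|)%N -> 0 < q -> (0 < h <= r)%N ->
  #|G|%:R * (theta / D) <= q ^+ r.-1 -> cyc h <= q ^+ (r - h) * cyc r.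
Proof.
move=> G0 q0 /andP[h0 hr] hq.
have r0 : (0 < r)%N by apply: leq_trans hr.
pose u i := q ^+ i * cyc i.+1.
have qi i : 0 < q ^+ i by rewrite exprn_gt0.
have := @log_convex_le R u r.-1 (u r.-1) _ _ _ (lexx _) h.-1.
rewrite /u expr0 mul1r prednK // prednK // => hh.
rewrite -(ler_pM2l (qi h.-1)) mulrA -exprD.
have -> : (h.-1 + (r - h) = r.-1)%N by lia.
apply: hh; last by lia.
- by move=> i _; rewrite mulr_gt0 ?cyc_gt0.
- move=> i _; rewrite exprMn -exprM.
  have -> : q ^+ i * cyc i.+1 * (q ^+ i.+2 * cyc i.+3) = q ^+ (i.+1 * 2) * (cyc i.+1 * cyc i.+3).
    have -> : (i.+1 * 2 = i + i.+2)%N by lia.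
    by rewrite exprD; ring.
  by rewrite ler_pM2l // cyc_convex.
- apply: le_trans cyc1_le _; apply: le_trans hq _.
  by rewrite ler_peMr ?(ltW (qi _)) // cyc_ge1.
Qed.

End Existence.

Lemma exists_avoid (R : realFieldType) (E : finType) n (I : eqType) (r : seq I)
    (ev : I -> seq E -> bool) (v : seq E -> R) (x : R) :
  (forall s, size s = n -> 0 <= v s) ->
  (forall i, i \in r -> tot n (fun t => v t * (ev i t)%:R) <= x) ->
  (size r)%:R * x < tot n v ->
  exists t, [/\ size t = n, 0 < v t & forall i, i \in r -> ~~ ev i t].
Proof.
move=> v0 hx hr.
have h : 0 < tot n (fun t => v t + (-1) * \sum_(i <- r) v t * (ev i t)%:R).
  rewrite totD totZ tot_sum mulN1r subr_gt0; apply: le_lt_trans hr.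
  rewrite big_seq; apply: le_trans (ler_sum _ _) _; first exact: hx.
  by rewrite -big_seq big_const_seq count_predT iter_addr_0 -[leLHS]mulr_natl.
have [t ht] := tot_gt0_ex h; rewrite -mulr_sumr => hp.
have vt := v0 t ht; exists t; split => //.
  rewrite lt_neqAle vt andbT; apply/eqP => v00; move: hp; rewrite -v00 mul0r; lra.
move=> i ir; apply/negP => ei.
have : 1 <= \sum_(i <- r) (ev i t)%:R :> R.
  by rewrite (big_rem i) //= ei lerDl sumr_ge0.
by move=> h1; move: hp; rewrite mulN1r subr_gt0 ltNge ler_peMr.
Qed.

Lemma nth_rotC (T : Type) (x0 : T) (u : seq T) i j : (i <= j < size u)%N ->
  nth x0 (rot (size u - i) u) j = nth x0 u (j - i).
Proof.
move=> /andP[ij ju]; rewrite /rot nth_cat size_drop subKn; last by lia.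
by rewrite ltnNge ij /= nth_take //; lia.
Qed.

(** Cutting the gap in the middle makes the losses q^(r-h) and q^(r-h') of [cyc_le] at most q^(j+1),
    which the denominator of [bad_path] absorbs. *)
Lemma half_split r j p : r.*2 = (j.+2 + p.+2)%N ->
  exists h h', [/\ (h + h' = p.+2)%N, (0 < h <= r)%N, (0 < h' <= r)%N,
    (r - h <= j.+1)%N & (r - h' <= j.+1)%N].
Proof.
by move=> e; exists (p.+2)./2, (p.+2 - (p.+2)./2)%N; split; lia.
Qed.

(** * A closed walk avoiding all bad events *)

Section CoreExistence.
Variables (R : realFieldType) (E V Z : finType) (G : {set E}).
Variables (pt : bool -> E -> V) (z : E -> Z) (D theta a0 : R).
Hypothesis D0 : 0 < D.
Hypothesis th0 : 0 < theta.
Hypothesis th1 : theta <= 1.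
Hypothesis hdeg : forall b e, e \in G -> D <= (edeg G pt b e)%:R.
Hypothesis hcod : forall b e f, e \in G -> f \in G ->
  #|[set g in G | (pt b g == pt b e) && (pt (~~ b) g == pt (~~ b) f)]|%:R
    <= theta * (edeg G pt b e)%:R.
Hypothesis a00 : 0 < a0.
Hypothesis hinj : forall e f, e \in G -> f \in G ->
  (forall b, pt b e = pt b f) -> z e = z f -> e = f.
Hypothesis hz : forall e, e \in G ->
  a0 <= #|[set g in G | (pt false g == pt false e) && (pt true g == pt true e)]|%:R.
Variables (r : nat) (B tau q eps : R).
Hypothesis r2 : (2 <= r)%N.
Hypothesis B0 : 0 < B.
Hypothesis tau0 : 0 < tau.
Hypothesis q1 : 1 <= q.
Hypothesis eps0 : 0 < eps.
Hypothesis eps1 : eps <= 1.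
(** One condition for each kind of event: [hq] and [hM] for a block with a gap of length at least
    two, [hfull] for a full pattern, [hone] for a gap of length one, [htwo] for at least two gaps,
    [hrep] for a repeated walk vertex and [hcol] for a repeated third vertex. *)
Hypothesis hq : #|G|%:R * (theta / D) <= q ^+ r.-1.
Hypothesis hM : 2 * q <= eps * (tau * D).
Hypothesis hfull : 2 / (B * D) <= eps * (tau * D) ^+ r.*2.-1.
Hypothesis hone : 2 / (B * D) * theta <= eps * (tau * D) ^+ r.*2.-2.
Hypothesis htwo : 2 / (B * D) * theta ^+ 2 <= eps.
Hypothesis hrep : #|G|%:R * theta ^+ 2 / D <= eps.
Hypothesis hcol : 1 <= eps * a0.
Hypothesis G0 : (0 < #|G|)%N.
Notation l := r.*2.
Notation cw := (cw R G pt).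
Notation cyc := (cyc R G pt).
Notation psat := (psat B tau).
Implicit Types (w : seq E -> R) (m : bitseq).

Record sparse w : Prop := Sparse {
  sparse_ge0 : forall s, size s = l -> 0 <= w s;
  sparse_tot : tot l w <= 1;
  sparse_one : forall p : seq (option E), size p = l -> psize p = 1%N -> marg p w <= B
}.

Lemma psize_rot k (p : seq (option E)) : psize (rot k p) = psize p.
Proof. by rewrite /psize; apply/permP; rewrite perm_rot. Qed.

Lemma sparse_rot k w : (k <= l)%N -> sparse w -> sparse (fun s => w (rot k s)).
Proof.
move=> kl [w0 w1 wB]; split.
- by move=> s hs; apply: w0; rewrite size_rot.
- by rewrite -tot_rot.
- by move=> p sp pp; rewrite -marg_rot ?sp //; apply: wB; rewrite ?size_rot ?psize_rot.
Qed.

Let r0 : (0 < r)%N. Proof. exact: ltnW r2. Qed.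
Let W1 : 1 <= cyc r. Proof. exact: cyc_ge1 G0 r0. Qed.
Let M1 : 1 <= tau * D.
Proof.
have h : eps * (tau * D) <= tau * D by rewrite ler_piMl // mulr_ge0 // ltW.
by move: q1 (le_trans hM h); lra.
Qed.
Let epsW x : x <= eps -> x <= eps * cyc r.
Proof. by move=> h; apply: le_trans h _; rewrite ler_peMr // ltW. Qed.

Lemma sup_eq c k : 2 / (B * tau ^+ c) * (theta ^+ k * D^-1 ^+ c.+1) =
  2 / (B * D) * theta ^+ k / (tau * D) ^+ c.
Proof.
rewrite exprVn exprMn exprS; field.
by rewrite !expf_neq0 ?gt_eqF.
Qed.

(** Masks with one prescribed position are left to [cover_step], which deletes the saturated edges
    beforehand; the others are treated by the cases of [mask_rot_ind]. *)
Lemma bad_mask b w m : size m = l -> (2 <= count id m)%N -> sparse w ->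
  tot l (fun t => cw b t * (psat w (pat m t))%:R) <= eps * cyc r.
Proof.
move=> sm cm; have hm : has id m by rewrite has_count (leq_trans _ cm).
pose P m := size m = l -> (2 <= count id m)%N -> forall b w, sparse w ->
  tot l (fun t => cw b t * (psat w (pat m t))%:R) <= eps * cyc r.
suff : P m by apply.
have Mi c : ((tau * D) ^+ c)^-1 <= 1 by rewrite invf_le1 ?exprn_ege1 // exprn_gt0 // mulr_gt0.
have n1 : 0 <= 2 / (B * D) by rewrite divr_ge0 // mulr_ge0 // ltW.
apply: mask_rot_ind => // [k m' km sm' Pm'||j q' sm'|m' sm' mr] sml cml b' w' sw.
- rewrite size_rot in sml; rewrite sml in km.
  rewrite (tot_rot _ (k := k)) //.
  rewrite (eq_tot (u := fun t => cw (b' (+) odd k) t *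
      (psat (fun s => w' (rot k s)) (pat m' t))%:R)); last first.
    move=> s hs; rewrite cw_rot ?hs ?odd_double // pat_rot ?sml //.
    by rewrite /psat psize_rot marg_rot // size_pat ?sml // hs.
  apply: Pm' => //; last exact: sparse_rot.
  by have /permP <- : perm_eq (rot k m') m' by rewrite perm_rot.
- rewrite sm; have lE : l = l.-1.+1 by rewrite prednK // double_gt0.
  have [w0 w1 _] := sw.
  have := @bad_sup R E V G pt D theta D0 th0 hdeg hcod B tau B0 tau0 b' w'
    (nseq l.-1 true) l.-1 (size_nseq _ _).
  rewrite -[true :: _]/(nseq l.-1.+1 true) -lE => /(_ w0 w1).
  move/le_trans; apply; rewrite sup_eq count_nseq mul1n.
  have -> : mruns false (nseq l.-1 true) = 0%N by elim: (l.-1).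
  rewrite expr0 mulr1; apply: epsW.
  by rewrite ler_pdivrMr // exprn_gt0 // mulr_gt0.
- have lE : l = (j.+1 + q'.+1)%N by rewrite -sm.
  have [w0 w1 wB] := sw.
  have j1 : (1 <= j)%N.
    by move: cml; rewrite count_cat !count_nseq mul1n mul0n addn0.
  case: q' sm' lE sml cml => [|q'] sm' lE sml cml.
    have := @bad_sup R E V G pt D theta D0 th0 hdeg hcod B tau B0 tau0 b' w'
      (nseq j true ++ [:: false]) j.+1.
    rewrite size_cat size_nseq addn1 => /(_ erefl).
    have -> : j.+2 = l by rewrite lE addn1.
    move=> /(_ w0 w1) /le_trans; apply; rewrite count_cat count_nseq /= mul1n !addn0 sup_eq.
    have -> : mruns false (nseq j true ++ [:: false]) = 1%N by elim: (j).
    rewrite expr1; apply: epsW; rewrite ler_pdivrMr ?exprn_gt0 ?mulr_gt0 //.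
    by have -> : j = l.-2 by rewrite lE addn1.
  case: j j1 {sm'} lE {sml cml} => [|j] // _ lE.
  have [h [h' [hh hr h'r hj h'j]]] := half_split lE.
  have [/andP[h0 _] /andP[h'0 _]] := (hr, h'r).
  have q0 : 0 < q by apply: lt_le_trans q1.
  have := @bad_path R E V G pt D D0 hdeg B tau B0 tau0 b' w' j h h' l.
  rewrite hh => /(_ lE h0 h'0 w0 wB) /le_trans; apply.
  have e1 : cyc h <= q ^+ (r - h) * cyc r by apply: (@cyc_le _ _ _ _ _ D theta).
  have e2 : cyc h' <= q ^+ (r - h') * cyc r by apply: (@cyc_le _ _ _ _ _ D theta).
  have W0 : 0 <= cyc r by apply: le_trans W1.
  have tD : 0 <= tau * D by apply: le_trans M1.
  have e3 k : (k <= j.+1)%N -> q ^+ k * cyc r <= q ^+ j.+1 * cyc r.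
    by move=> kj; rewrite ler_wpM2r // ler_weXn2l.
  have {e1} e1 := le_trans e1 (e3 _ hj); have {e2} e2 := le_trans e2 (e3 _ h'j).
  rewrite ler_pdivrMr ?exprn_gt0 ?mulr_gt0 //; apply: le_trans (lerD e1 e2) _.
  rewrite -mulrDl mulrAC ler_wpM2r //.
  apply: le_trans (_ : (2 * q) ^+ j.+1 <= _).
    rewrite exprMn -mulr2n -[leLHS]mulr_natl ler_wpM2r ?exprn_ge0 ?(ltW q0) //.
    by rewrite exprS ler_peMr // exprn_ege1 // ler1n.
  apply: le_trans (_ : (eps * (tau * D)) ^+ j.+1 <= _).
    by apply: lerXn2r => //; rewrite nnegrE mulr_ge0 // ltW.
  rewrite exprMn ler_wpM2r ?exprn_ge0 //.
  by rewrite exprS ler_piMr ?(ltW eps0) // exprn_ile1 // ltW.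
- have [w0 w1 _] := sw.
  have := @bad_sup R E V G pt D theta D0 th0 hdeg hcod B tau B0 tau0 b' w' m' _ erefl.
  rewrite -sm' sm => /(_ w0 w1) /le_trans; apply; rewrite sup_eq; apply: epsW.
  apply: le_trans htwo; rewrite -mulrA ler_wpM2l //.
  apply: le_trans (_ : theta ^+ mruns false m' <= _).
    by rewrite ler_piMr ?exprn_ge0 ?(ltW th0).
  by apply: ler_wiXn2l => //; apply: ltW.
Qed.

Lemma nth_rot0 (x0 : E) i j t : size t = l -> (i <= j < l)%N ->
  nth x0 (rot (l - i) t) j = nth x0 t (j - i).
Proof. by move=> st ij; rewrite -st nth_rotC // st. Qed.

Lemma odd_subl i : (i <= l)%N -> odd (l - i) = odd i.
Proof. by move=> il; rewrite oddB // odd_double addFb. Qed.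

Lemma rep_pair x0 i j : (i < j < l)%N -> odd i = odd j ->
  tot l (fun t => cw false t *
    (pt (odd i) (nth x0 t i) == pt (odd i) (nth x0 t j))%:R) <= eps.
Proof.
move=> /andP[ij jl] oij; apply: le_trans hrep.
have il : (i <= l)%N by apply: leq_trans (ltnW jl); apply: ltnW.
have [k [k' [kE lE]]] : exists k k', (j - i)%N = k.*2.+2 /\ l = (k.*2.+1 + k'.*2.+2).+1.
  clear -ij jl oij; exists (j - i - 2)./2, (l - (j - i) - 2)./2.
  have : odd (j - i) = false by rewrite oddB ?(ltnW ij) // oij addbb.
  by move: (j - i)%N (subn_gt0 i j) (leq_subr i j) => d; rewrite ij; lia.
rewrite (tot_rot _ (k := l - i)) ?leq_subr //.
have := rep_bound D0 th0 hdeg hcod (odd i) k k' x0.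
rewrite -lE; apply: le_trans; rewrite le_eqVlt; apply/orP; left; apply/eqP.
apply: eq_tot => t st; rewrite cw_rot ?st ?odd_double ?leq_subr //.
rewrite odd_subl // !nth_rot0 ?st ?leqnn ?(ltnW ij) ?(ltn_trans ij jl) //.
by rewrite subnn kE.
Qed.

Lemma col_pair x0 i j : (i < j < l)%N ->
  tot l (fun t => cw false t * (z (nth x0 t i) == z (nth x0 t j))%:R)
    <= eps * cyc r.
Proof.
move=> /andP[ij jl].
have il : (i <= l)%N by apply: leq_trans (ltnW jl); apply: ltnW.
have [k kE] : exists k, (j - i)%N = k.+1 by exists (j - i).-1; rewrite prednK ?subn_gt0.
have lE : l = l.-1.+1 by rewrite prednK // double_gt0.
have kl : (k < l.-1)%N.
  by rewrite -ltnS -lE -kE (leq_ltn_trans (leq_subr _ _)).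
rewrite (tot_rot _ (k := l - i)) ?leq_subr //.
have := col_bound a00 hinj hz (odd i) x0 kl; rewrite -lE => h.
apply: (@le_trans _ _ (tot l (cw (odd i)) / a0)).
  apply: le_trans h; rewrite le_eqVlt; apply/orP; left; apply/eqP.
  apply: eq_tot => t st; rewrite cw_rot ?st ?odd_double ?leq_subr //.
  rewrite odd_subl // !nth_rot0 ?st ?leqnn ?(ltnW ij) ?(ltn_trans ij jl) //.
  by rewrite subnn kE.
rewrite {1}lE tot_cw trc_cyc // mulrC ler_wpM2r //; first by apply: le_trans W1.
by rewrite -[a0^-1]mul1r ler_pdivrMr.
Qed.

(** Union bound over 2^l masks and, for each of the two kinds of repetition, l^2 pairs of positions;
    each event has at most a proportion [eps] of the total weight [cyc r]. *)
Lemma core_exists (x0 : E) w :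
  (2 ^ l + 2 * (l * l))%:R * eps < 1 -> sparse w ->
  exists t, [/\ size t = l, 0 < cw false t,
    forall m, size m = l -> (2 <= count id m)%N -> ~~ psat w (pat m t),
    forall i j, (i < j < l)%N -> odd i = odd j ->
      pt (odd i) (nth x0 t i) != pt (odd i) (nth x0 t j) &
    forall i j, (i < j < l)%N -> z (nth x0 t i) != z (nth x0 t j)].
Proof.
move=> heps sw.
pose I := (bitseq + bool * (nat * nat))%type.
pose prs := [seq (i, j) | i <- iota 0 l, j <- iota 0 l].
pose evs : seq I := [seq inl m | m <- masks l] ++
  [seq inr (true, p) | p <- prs] ++ [seq inr (false, p) | p <- prs].
pose ev (i : I) t := match i with
  | inl m => (2 <= count id m)%N && psat w (pat m t)
  | inr (b, (i, j)) => (i < j)%N &&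
     (if b then (odd i == odd j) && (pt (odd i) (nth x0 t i) == pt (odd i) (nth x0 t j))
      else z (nth x0 t i) == z (nth x0 t j))
  end.
have Wp : 0 < cyc r by apply: lt_le_trans W1.
have eW : 0 <= eps * cyc r by rewrite mulr_ge0 // ltW.
have t00 (f : seq E -> R) : tot l (fun t => f t * false%:R) <= eps * cyc r.
  by rewrite (eq_tot (u := fun=> 0)) ?tot0 // => t _; rewrite mulr0.
have inP i j : (i, j) \in prs -> (j < l)%N.
  by case/allpairsP => -[i' j'] /= [_ + [_ ->]]; rewrite mem_iota.
have [|||t [st tp tev]] := @exists_avoid R E l I evs ev (cw false) (eps * cyc r).
- by move=> s _; apply: cw_ge0.
- move=> i; rewrite !mem_cat => /or3P[] /mapP[] => [m|[i1 j1]|[i1 j1]] hin -> /=.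
  + have sm : size m = l by apply/eqP; rewrite -mem_masks.
    by case: (leqP 2 (count id m)) => /= hm; [apply: bad_mask|apply: t00].
  + case: (ltnP i1 j1) => /= ij; last exact: t00.
    have [oij|/negPf oij] := eqVneq (odd i1) (odd j1); last exact: t00.
    by apply/epsW/rep_pair; rewrite ?ij ?(inP _ _ hin).
  + case: (ltnP i1 j1) => /= ij; last exact: t00.
    by apply: col_pair; rewrite ij (inP _ _ hin).
- have -> : size evs = (2 ^ l + 2 * (l * l))%N.
    by rewrite !size_cat !size_map size_masks size_allpairs !size_iota addnn mul2n.
  have lE : l = l.-1.+1 by rewrite prednK // double_gt0.
  rewrite [X in _ < tot X _]lE tot_cw trc_cyc // mulrA -[ltRHS]mul1r.
  by rewrite ltr_pM2r.
have memP i j : (i < j < l)%N -> (i, j) \in prs.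
  move=> /andP[ij jl]; apply/allpairsP; exists (i, j).
  by rewrite /= !mem_iota /= !add0n jl (ltn_trans ij jl).
exists t; split=> //.
- move=> m sm cm; have := tev (inl m); rewrite /ev cm /=; apply.
  by rewrite mem_cat map_f // mem_masks sm.
- move=> i j ij oij; have := tev (inr (true, (i, j))); rewrite /ev oij eqxx /=.
  have /andP[-> _] := ij; apply; rewrite !mem_cat; apply/or3P; apply: Or32.
  by apply: map_f; apply: memP.
- move=> i j ij; have := tev (inr (false, (i, j))); rewrite /ev /=.
  have /andP[-> _] := ij; apply; rewrite !mem_cat; apply/or3P; apply: Or33.
  by apply: map_f; apply: memP.
Qed.

End CoreExistence.

Lemma marg_delta_le (R : realFieldType) (F : finType) (p : seq (option F)) t :
  marg p (fun s => (s == t)%:R) <= 1 :> R.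
Proof.
elim: p t => [|[a|] p IH] t /=; first by rewrite lern1 leq_b1.
  case: t => [|c t]; first by rewrite marg_eq0.
  apply: le_trans (IH t); apply: ler_marg => s _.
  by rewrite eqseq_cons ler_nat; case: eqP.
case: t => [|c t]; first by rewrite big1 // => a _; rewrite marg_eq0.
rewrite (bigD1 c) //= big1 ?addr0 => [|a /negPf ac].
  apply: le_trans (IH t); apply: ler_marg => s _.
  by rewrite eqseq_cons eqxx.
by apply: marg_eq0 => s _; rewrite eqseq_cons ac.
Qed.

Lemma tot_delta (R : realFieldType) (F : finType) (t : seq F) :
  tot (size t) (fun s => (s == t)%:R) = 1 :> R.
Proof.
elim: t => [|c t IH] //; rewrite [size _]/= totS (bigD1 c) //= big1 ?addr0 => [|a /negPf ac].
  by rewrite -[RHS]IH; apply: eq_tot => s _; rewrite eqseq_cons eqxx.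
by rewrite -[RHS](tot0 R F (size t)); apply: eq_tot => s _; rewrite eqseq_cons ac.
Qed.

(** * Balanced measures on loose cycles *)

Section Greedy.
Variables (R : archiRealFieldType) (E : finType) (F : {set E}) (l : nat).
Variables (B tau : R) (good : seq E -> Prop).
Hypothesis B0 : 0 < B.
Hypothesis tau0 : 0 < tau.

Record balanced (w : seq E -> R) : Prop := Balanced {
  balanced_ge0 : forall s, size s = l -> 0 <= w s;
  balanced_in : forall s, size s = l -> ~~ all (mem F) s -> w s = 0;
  balanced_good : forall s, size s = l -> w s != 0 -> good s;
  balanced_marg : forall p, size p = l -> (0 < psize p)%N ->
    marg p w <= B * tau ^+ (psize p).-1
}.

(* Keep adding a small multiple of a tuple without saturated pattern. *)
Lemma greedy :
  (forall w, balanced w -> tot l w <= 1 ->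
     exists t, [/\ size t = l, all (mem F) t, good t &
       forall m, size m = l -> (0 < count id m)%N -> ~~ psat B tau w (pat m t)]) ->
  exists2 w, balanced w & tot l w = 1.
Proof.
move=> Hex.
(* The step 1/k is at most the room left by an unsaturated pattern of any size, so k additions reach
   total mass 1. *)
have [k [k0 hk]] : exists k : nat, (0 < k)%N /\
    forall j, (j <= l)%N -> (k%:R^-1 : R) <= B * tau ^+ j / 2.
  elim: (l) => [|L [k [k0 hk]]]; first exists (Num.bound (2 / (B * tau ^+ 0))).+1; last first.
    exists (maxn k (Num.bound (2 / (B * tau ^+ L.+1))).+1); split.
      by rewrite leq_max k0.
    move=> j; rewrite leq_eqVlt => /orP[/eqP ->|]; last first.
      rewrite ltnS => /hk; apply: le_trans.
      by rewrite lef_pV2 ?posrE ?ltr0n ?leq_max ?k0 // ler_nat leq_maxl.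
    have c0 : 0 < B * tau ^+ L.+1 by rewrite mulr_gt0 ?exprn_gt0.
    have h : 2 / (B * tau ^+ L.+1) <= (maxn k (Num.bound (2 / (B * tau ^+ L.+1))).+1)%:R.
      apply: ltW; apply: lt_le_trans (archi_boundP _) _; first by rewrite divr_ge0 ?ltW.
      by rewrite ler_nat leq_max leqnSn orbT.
    rewrite -[leRHS]invrK lef_pV2 ?posrE ?invr_gt0 ?divr_gt0 // ?ltr0n ?leq_max ?k0 //.
    by rewrite invfM invrK mulrC.
  split=> // j; rewrite leqn0 => /eqP ->.
  have c0 : 0 < B * tau ^+ 0 by rewrite mulr_gt0 ?exprn_gt0.
  rewrite -[leRHS]invrK lef_pV2 ?posrE ?invr_gt0 ?divr_gt0 // ?ltr0n //.
  rewrite invfM invrK mulrC; apply: ltW; apply: lt_le_trans (archi_boundP _) _.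
    by rewrite divr_ge0 ?ltW.
  by rewrite ler_nat.
have kp : 0 < k%:R :> R by rewrite ltr0n.
suff : forall i, (i <= k)%N -> exists2 w, balanced w & tot l w = i%:R / k%:R.
  by move/(_ k (leqnn k)); rewrite divff ?gt_eqF.
elim=> [|i IH] ik.
  exists (fun=> 0); last by rewrite tot0 mul0r.
  split=> // [s _ /eqP //|p _ _].
  by rewrite marg0 mulr_ge0 ?exprn_ge0 // ltW.
have [w bw tw] := IH (ltnW ik); have [w0 wF wg wm] := bw.
have [|t [st tF tg ts]] := Hex w bw.
  by rewrite tw ler_pdivrMr // mul1r ler_nat ltnW.
exists (fun s => w s + k%:R^-1 * (s == t)%:R); last first.
  have td : tot l (fun s => (s == t)%:R) = 1 :> R by rewrite -st tot_delta.
  by rewrite totD totZ tw td mulr1 mulrSr mulrDl mul1r.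
split.
- by move=> s hs; rewrite addr_ge0 ?w0 // mulr_ge0 ?invr_ge0.
- move=> s hs nF; rewrite wF // add0r; case: eqP => [e|_]; last by rewrite mulr0.
  by rewrite e tF in nF.
- move=> s hs; have [-> //|_] := eqVneq s t.
  by rewrite mulr0 addr0; apply: wg.
- move=> p sp pp; rewrite margD margZ.
  have [e|ne] := eqVneq (pat (map isSome p) t) p; last first.
    rewrite [X in _ * X]marg_eq0_match ?mulr0 ?addr0; first exact: wm.
    by move=> s hs hp; case: eqP => // e; move: ne; rewrite -e hp eqxx.
  have cp : count id (map isSome p) = psize p by rewrite count_map.
  have := ts (map isSome p); rewrite size_map cp e => /(_ sp pp).
  rewrite /psat -leNgt => h1.
  have pl : ((psize p).-1 <= l)%N.
    by rewrite -sp; apply: leq_trans (leq_pred _) (count_size _ _).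
  have h2 : k%:R^-1 * marg p (fun s => (s == t)%:R) <= B * tau ^+ (psize p).-1 / 2.
    apply: le_trans (hk _ pl); rewrite ler_piMr ?invr_ge0 ?ler0n //.
    exact: marg_delta_le.
  by have := lerD h1 h2; lra.
Qed.

End Greedy.

(** * Passing to a subset with large degrees and codegrees *)

Section Clean.
Variables (R : realFieldType) (E V : finType).
Implicit Types (F G : {set E}) (a b c : E -> V).

Definition fiber F a (u : V) := #|[set f in F | a f == u]|.

(** [G] maximises its cardinal minus a price for every vertex and every pair it uses. Deleting all
    edges at a vertex saves its price, so maximality makes each degree at least the price; likewise
    for pairs. The prices in [F1] add up to at most N/50 + N/50 + N/100 < N/12, so [G] is not
    empty. *)
Lemma clean F F1 a b n : F1 \subset F -> (0 < #|F|)%N -> (0 < n)%N ->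
  (#|F| <= 12 * #|F1|)%N ->
  (#|[set a e | e in F]| <= n)%N -> (#|[set b e | e in F]| <= n)%N ->
  exists G, [/\ G \subset F1, (0 < #|G|)%N,
    forall e, e \in G -> (vdeg F a e)%:R / 100 + #|F|%:R / (100 * n%:R) <= (vdeg G a e)%:R :> R,
    forall e, e \in G -> (vdeg F b e)%:R / 100 + #|F|%:R / (100 * n%:R) <= (vdeg G b e)%:R :> R &
    forall e, e \in G -> #|F|%:R / (100 * n%:R ^+ 2) <= (pdeg G a b e)%:R :> R].
Proof.
move=> F1F F0 n0 hF ha hb.
have Fp : 0 < #|F|%:R :> R by rewrite ltr0n.
have np : 0 < n%:R :> R by rewrite ltr0n.
set N : R := #|F|%:R in Fp *; set x : R := n%:R in np *.
pose pv d u : R := (fiber F d u)%:R / 100 + N / (100 * x).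
pose pc : R := N / (100 * x ^+ 2).
pose Phi G : R := #|G|%:R - \sum_(u in [set a e | e in G]) pv a u
   - \sum_(u in [set b e | e in G]) pv b u
   - \sum_(u in [set (a e, b e) | e in G]) pc.
have pv0 d u : 0 <= pv d u by rewrite addr_ge0 ?divr_ge0 ?mulr_ge0 ?ler0n ?ltW.
have pc0 : 0 <= pc by rewrite divr_ge0 ?mulr_ge0 ?exprn_ge0 ?ltW.
pose G := [arg max_(H > F1 | H \subset F1) Phi H]%O.
have [GF1 Gmax] : G \subset F1 /\ forall H : {set E}, H \subset F1 -> Phi H <= Phi G.
  by rewrite /G; case: arg_maxP => // H h1 h2; split.
have sub_le (T : finType) (A A' : {set T}) (f : T -> R) : (forall u, 0 <= f u) -> A \subset A' ->
    \sum_(u in A) f u <= \sum_(u in A') f u.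
  move=> f0 /setIidPr AA; rewrite [leRHS](big_setID A) /= AA lerDl.
  by apply: sumr_ge0.
have pvF d : (#|[set d e | e in F]| <= n)%N ->
    \sum_(u in [set d e | e in F1]) pv d u <= N / 50.
  move=> hd; apply: le_trans (sub_le _ _ _ _ (pv0 d) (imsetS d F1F)) _.
  rewrite big_split /= -mulr_suml sumr_const -natr_sum.
  have -> : (\sum_(u in [set d e | e in F]) fiber F d u)%N = #|F|.
    rewrite -[RHS]sum1_card (partition_big d (mem [set d e | e in F])) /=; last first.
      by move=> e eF; apply: imset_f.
    by apply: eq_bigr => u _; rewrite /fiber -sum1_card; apply: eq_bigl => f; rewrite !inE.
  rewrite -/N -[X in _ + X]mulr_natl.
  have : #|[set d e | e in F]|%:R * (N / (100 * x)) <= x * (N / (100 * x)).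
    by rewrite ler_wpM2r ?ler_nat // divr_ge0 ?mulr_ge0 // ltW.
  have -> : x * (N / (100 * x)) = N / 100 by field; rewrite gt_eqF.
  lra.
have pcF : \sum_(u in [set (a e, b e) | e in F1]) pc <= N / 100.
  rewrite sumr_const -[leLHS]mulr_natl.
  have h : (#|[set (a e, b e) | e in F1]| <= n * n)%N.
    apply: leq_trans (_ : #|setX [set a e | e in F] [set b e | e in F]| <= _)%N.
      apply/subset_leq_card/subsetP => _ /imsetP[e eF1 ->].
      by rewrite inE /= !imset_f ?(subsetP F1F).
    by rewrite cardsX leq_mul.
  apply: le_trans (_ : (n * n)%:R * pc <= _); first by rewrite ler_wpM2r ?ler_nat.
  rewrite natrM -/x le_eqVlt; apply/orP; left; apply/eqP; rewrite /pc.
  by field; rewrite gt_eqF.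
have PF1 : 0 < Phi F1.
  have h12 : N <= 12 * #|F1|%:R by rewrite /N -natrM ler_nat.
  by have := pvF _ ha; have := pvF _ hb; rewrite /Phi; lra.
have PG : 0 < Phi G by apply: lt_le_trans PF1 (Gmax _ _).
have img (T : finType) (d : E -> T) (f : T -> R) (D : {set E}) : (forall u, 0 <= f u) ->
    \sum_(u in [set d e | e in G :\: D]) f u <= \sum_(u in [set d e | e in G]) f u.
  by move=> f0; apply: sub_le => //; apply/imsetS/subsetDl.
have drop (T : finType) (d : E -> T) (f : T -> R) e : (forall u, 0 <= f u) -> e \in G ->
    \sum_(u in [set d e | e in G :\: [set g in G | d g == d e]]) f u + f (d e)
      <= \sum_(u in [set d e | e in G]) f u.
  move=> f0 eG; rewrite [leRHS](bigD1 (d e)) ?imset_f //= [leLHS]addrC lerD2l.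
  rewrite [leRHS](eq_bigl (mem ([set d e | e in G] :\ d e))); last first.
    by move=> u; rewrite !inE andbC.
  apply: sub_le => //; apply/subsetP => _ /imsetP[g + ->].
  rewrite !inE => /andP[gd gG]; rewrite imset_f // andbT.
  by move: gd; rewrite gG.
have cardD (D : {set E}) : D \subset G -> #|G :\: D|%:R = #|G|%:R - #|D|%:R :> R.
  by move=> /setIidPr h; rewrite -(cardsID D G) h natrD addrAC subrr add0r.
have maxD (D : {set E}) : D \subset G -> Phi (G :\: D) <= Phi G.
  by move=> _; apply: Gmax; apply: subset_trans (subsetDl _ _) GF1.
have sG (P : pred E) : [set f in G | P f] \subset G.
  by apply/subsetP => f; rewrite inE => /andP[].
have drop_a e : e \in G -> pv a (a e) <= (vdeg G a e)%:R.
  move=> eG; have h1 := drop _ a (pv a) e (pv0 a) eG.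
  set D := [set g in G | _] in h1; have h2 := maxD D (sG _).
  have h3 := img _ b (pv b) D (pv0 b).
  have h4 := img _ (fun e => (a e, b e)) (fun=> pc) D (fun=> pc0).
  by move: h2; rewrite /Phi cardD ?sG // -/(vdeg G a e); lra.
have drop_b e : e \in G -> pv b (b e) <= (vdeg G b e)%:R.
  move=> eG; have h1 := drop _ b (pv b) e (pv0 b) eG.
  set D := [set g in G | _] in h1; have h2 := maxD D (sG _).
  have h3 := img _ a (pv a) D (pv0 a).
  have h4 := img _ (fun e => (a e, b e)) (fun=> pc) D (fun=> pc0).
  by move: h2; rewrite /Phi cardD ?sG // -/(vdeg G b e); lra.
have drop_c e : e \in G -> pc <= (pdeg G a b e)%:R.
  move=> eG; have h1 := drop _ (fun e => (a e, b e)) (fun=> pc) e (fun=> pc0) eG.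
  set D := [set g in G | _] in h1; have h2 := maxD D (sG _).
  have h3 := img _ a (pv a) D (pv0 a).
  have h4 := img _ b (pv b) D (pv0 b).
  have <- : #|D| = pdeg G a b e by apply: eq_card => f; rewrite !inE.
  by move: h2; rewrite /Phi cardD ?sG //; lra.
exists G; split=> //.
- rewrite lt0n; apply/eqP => /cards0_eq G0; move: PG.
  by rewrite /Phi G0 !imset0 !big_set0 cards0 !subr0 ltxx.
Qed.

End Clean.

Lemma chain_gt0 (R : realFieldType) (E V : finType) (G : {set E}) (pt : bool -> E -> V)
    (x0 : E) b e s f : 0 < chain R G pt b e s f ->
  forall i, (i <= size s)%N ->
    0 < K R G pt (b (+) odd i) (nth x0 (e :: s) i) (nth x0 (rcons s f) i).
Proof.
elim: s b e => [|c s IH] b e /=; first by move=> h [|i] //; rewrite addbF.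
move=> h; have [h1 h2] : 0 < K R G pt b e c /\ 0 < chain R G pt (~~ b) c s f.
  have := K_ge0 R G pt b e c; rewrite le_eqVlt => /orP[/eqP h0|h0].
    by rewrite -h0 mul0r ltxx in h.
  by move: h; rewrite pmulr_rgt0.
move=> [|i] hi /=; first by rewrite addbF.
by have := IH _ _ h2 i hi; rewrite addNb -addbN.
Qed.

Section LooseTuple.
Variables (E V : finType).
Implicit Types (a b c : E -> V) (t : seq E).

(** [C] gives the shared vertices and [z] the private ones, indexed as in [loose_cycle_coords]. *)
Definition loose_tuple (es : E -> {set V}) (l : nat) t :=
  exists (x0 : E) (C z : nat -> V),
  [/\ forall i, (i < l)%N -> es (nth x0 t (i.+1 %% l)) = [set C i; C (i.+1 %% l)%N; z (i.+1 %% l)%N],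
      forall i j, (i < j < l)%N -> C i != C j,
      forall i j, (i < j < l)%N -> z i != z j &
      forall i j, (i < l)%N -> (j < l)%N -> C i != z j].

(** The step from edge i to edge i+1 keeps the vertex of kind [odd i], and these become the shared
    vertices. Different kinds are disjoint, so only repetitions within one kind have to be
    excluded. *)
Lemma walk_loose (R : realFieldType) (G : {set E}) a b c (es : E -> {set V}) r x0 t :
  (0 < r)%N ->
  let pt (s : bool) := if s then b else a in
  (forall e, es e = [set a e; b e; c e]) ->
  (forall e f, a e != b f) -> (forall e f, a e != c f) -> (forall e f, b e != c f) ->
  size t = r.*2 -> 0 < cw R G pt false t ->
  (forall i j, (i < j < r.*2)%N -> odd i = odd j ->
      pt (odd i) (nth x0 t i) != pt (odd i) (nth x0 t j)) ->
  (forall i j, (i < j < r.*2)%N -> c (nth x0 t i) != c (nth x0 t j)) ->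
  all (mem G) t /\ loose_tuple es r.*2 t.
Proof.
move=> r0 pt hes ab ac bc st tp hC hz.
have l0 : (0 < r.*2)%N by rewrite double_gt0.
have step i : (i < r.*2)%N -> 0 < K R G pt (odd i) (nth x0 t i) (nth x0 t (i.+1 %% r.*2)).
  case: t st tp {hC hz} => [|e s] /= st tp hi; first by rewrite -st in l0.
  rewrite -st in hi *; have := @chain_gt0 R E V G pt x0 false e s e tp i hi.
  rewrite addFb nth_rcons; move: hi; rewrite ltnS leq_eqVlt => /orP[/eqP ->|hi].
    by rewrite ltnn eqxx modnn.
  by rewrite hi modn_small.
have inG i : (i < r.*2)%N -> nth x0 t i \in G.
  by move=> /step; rewrite /K; case: ifP => [/andP[]//|]; rewrite ltxx.
split; first by apply/(all_nthP x0) => i; rewrite st; apply: inG.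
exists x0, (fun i => pt (odd i) (nth x0 t i)), (fun i => c (nth x0 t i)).
have ptC s s' e f : s != s' -> pt s e != pt s' f.
  by case: s; case: s' => // _; rewrite /pt // eq_sym.
split=> //.
- move=> i hi; have oi : odd (i.+1 %% r.*2) = ~~ odd i.
    by rewrite modn_def; case: edivnP => q m e _ /=;
      have := congr1 odd e; rewrite /= oddD oddM odd_double andbF /= => ->.
  have -> : pt (odd i) (nth x0 t i) = pt (odd i) (nth x0 t (i.+1 %% r.*2)).
    by have := step i hi; rewrite /K; case: ifP => [/and3P[_ _ /eqP]//|]; rewrite ltxx.
  rewrite oi hes; set f := nth _ _ _.
  by case: (odd i) => //=; rewrite [[set b f; a f]]setUC.
- move=> i j ij; have [oij|oij] := eqVneq (odd i) (odd j); last exact: ptC.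
  by rewrite -oij; apply: hC.
- by move=> i j _ _; rewrite /pt; case: (odd i).
Qed.

End LooseTuple.

(** * Choice of the parameters *)

Lemma sqr_le (R : realDomainType) (x y : R) : 0 <= y -> x ^+ 2 <= y ^+ 2 -> x <= y.
Proof.
move=> y0 h; have [x0|/ltW x0] := leP 0 x; last exact: le_trans y0.
by rewrite -(ler_pXn2r (n := 2)) ?nnegrE.
Qed.

Lemma edge_count_large (R : realFieldType) (x e N N0 : R) : 1 <= x -> 5 <= e ->
  1000 * 1000 * 1000 * e * x ^+ 2 <= N0 -> N0 / 2 <= N ->
  0 < N /\ 500 * 1000 * 1000 * (e * x ^+ 2) <= N.
Proof.
move=> x1 e5 hA hB.
have x2 : 1 <= x ^+ 2 by rewrite exprn_ege1.
have e0 : 0 <= e by lra.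
have e2 : 5 <= e * x ^+ 2 by apply: (le_trans e5); rewrite ler_peMr.
by split; lra.
Qed.

Lemma theta_small (R : realFieldType) (x e N N0 th : R) : 1 <= x -> 5 <= e ->
  1000 * 1000 * 1000 * e * x ^+ 2 <= N0 -> N0 / 2 <= N ->
  th ^+ 2 = 200 * 200 * x / N -> x * th ^+ 2 <= (100 * 100 * e)^-1.
Proof.
move=> x1 e5 hA hB ->; have [N0' hN] := edge_count_large x1 e5 hA hB; have ep : 0 < e by lra.
rewrite mulrA ler_pdivrMr // ler_pdivlMl ?mulr_gt0 //.
apply: le_trans hN.
have : 0 <= e * x ^+ 2 by rewrite mulr_ge0 ?sqr_ge0 // ltW.
by rewrite expr2; lra.
Qed.

(** The codegree X satisfies X^2 <= 4 dF <= 400 d, and d >= N / (100 x) turns 400 d into 400 * 100 x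
    d^2 / N; hence the constant 200^2 in the square of [th]. *)
Lemma codegree_budget (R : realFieldType) (x N th X d dF : R) : 0 < x -> 0 < N ->
  th ^+ 2 = 200 * 200 * x / N ->
  0 <= dF -> X ^+ 2 <= 4 * dF -> dF / 100 + N / (100 * x) <= d ->
  X ^+ 2 <= th ^+ 2 * d ^+ 2.
Proof.
move=> xp Np -> dF0 hX hd.
have Dx : 0 < N / (100 * x) by rewrite divr_gt0 // mulr_gt0.
have d0 : 0 <= d by lra.
apply: le_trans (_ : 400 * d <= _); first by lra.
have hN : N <= 100 * x * d by rewrite mulrC -ler_pdivrMr ?mulr_gt0 //; lra.
rewrite mulrAC ler_pdivlMr // expr2.
have := ler_wpM2l (mulr_ge0 (ler0n R 400) d0) hN; lra.
Qed.

Lemma multiplicity_budget (R : realFieldType) (x e N : R) : 0 < x -> 0 < e ->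
  500 * 1000 * 1000 * (e * x ^+ 2) <= N -> 1 <= e^-1 * (N / (100 * x ^+ 2)).
Proof.
move=> xp ep hNe; rewrite ler_pdivlMl // mulr1 ler_pdivlMr ?mulr_gt0 ?exprn_gt0 //.
apply: le_trans hNe; have : 0 <= e * x ^+ 2 by rewrite mulr_ge0 ?sqr_ge0 // ltW.
lra.
Qed.

(** Orders of magnitude, with x = n, y = k and e constant: D is N / n, tau D is k e, 2 / (B D) is at
    most n, and th at most n^(-1/2), up to constants. The tight condition is Gc th / D <= y^(r-1),
    where the left side is O(sqrt x). *)
Lemma cycle_parameters (R : realFieldType) (x e N N0 th l Gc : R) (k r : nat) :
  let y := k%:R in let tau := 400 * x * y * e / N0 in
  let B := 4 * l / N0 in let D := N / (100 * x) in
  1 <= x -> 1 <= y -> 5 <= e -> 4 <= l -> 0 < N -> N <= N0 -> N0 <= 2 * N ->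
  0 <= th -> x * th ^+ 2 <= (100 * 100 * e)^-1 -> (2 <= r)%N ->
  x = y ^+ r.-1 ^+ 2 -> 0 <= Gc -> Gc <= N ->
  [/\ 0 < B, 0 < tau, th <= 1, e^-1 <= 1 & Gc * (th / D) <= y ^+ r.-1] /\
  [/\ 2 * y <= e^-1 * (tau * D), 2 / (B * D) <= e^-1 * (tau * D) ^+ r.*2.-1,
      2 / (B * D) * th <= e^-1 * (tau * D) ^+ r.*2.-2,
      2 / (B * D) * th ^+ 2 <= e^-1 & Gc * th ^+ 2 / D <= e^-1].
Proof.
move=> y tau B D nR kR eR lR Np hC hB2 th0 thx r2 xE Gc0 NGN.
have N00 : 0 < N0 by apply: lt_le_trans Np hC.
have [xp yp ep lp] : [/\ 0 < x, 0 < y, 0 < e & 0 < l].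
  by split; [apply: lt_le_trans nR|apply: lt_le_trans kR|apply: lt_le_trans eR|apply: lt_le_trans lR].
have D0 : 0 < D by rewrite divr_gt0 // mulr_gt0.
have B0 : 0 < B by rewrite divr_gt0 // mulr_gt0.
have tau0 : 0 < tau by rewrite divr_gt0 // !mulr_gt0.
have tD : tau * D = 4 * y * e * (N / N0).
  rewrite /tau /D; field.
  by rewrite !gt_eqF.
have tD2 : 2 * y * e <= tau * D.
  rewrite tD; have : 2^-1 <= N / N0 by rewrite ler_pdivlMr // mulrC ler_pdivrMr // mulrC.
  have : 0 <= y * e by rewrite mulr_ge0 // ltW.
  move=> h1 h2; have := ler_wpM2l h1 h2; lra.
have ye : 1 <= y * e by apply: mulr_ege1 => //; lra.
have N1 : N / N0 <= 1 by rewrite ler_pdivrMr // mul1r.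
have n1 : 2 / (B * D) <= 100 * x.
  have -> : 2 / (B * D) = 50 * x / l * (N0 / N).
    rewrite /B /D; field.
    by rewrite !gt_eqF.
  have h2 : N0 / N <= 2 by rewrite ler_pdivrMr //; lra.
  have h1 : 50 * x / l <= 50 * x.
    rewrite ler_pdivrMr; last by lra.
    have := ler_wpM2l (ltW xp) lR; lra.
  have h0 : 0 <= 50 * x by lra.
  apply: le_trans (ler_wpM2l _ h2) _; last by lra.
  by rewrite divr_ge0 //; lra.
have hq2 : (100 * x * th) ^+ 2 <= x.
  have -> : (100 * x * th) ^+ 2 = 100 * 100 * x * (x * th ^+ 2) by ring.
  have h0 : 0 <= 100 * 100 * x by lra.
  have := ler_wpM2l h0 thx; move/le_trans; apply.
  rewrite ler_pdivrMr ?mulr_gt0 //; have := ler_wpM2l (ltW xp) eR; lra.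
have yr : 0 <= y ^+ r.-1 by rewrite exprn_ge0 // ltW.
have hq1 : 100 * x * th <= y ^+ r.-1 by apply: sqr_le => //; rewrite -xE.
have GD : Gc / D <= 100 * x.
  rewrite ler_pdivrMr // /D; apply: le_trans NGN _.
  by rewrite le_eqVlt; apply/orP; left; apply/eqP; field; rewrite gt_eqF.
have eV : 100 * x * th ^+ 2 <= e^-1.
  have := ler_wpM2l (ler0n R 100) thx; rewrite mulrA => /le_trans; apply.
  rewrite invfM mulrA ler_piMl ?invr_ge0 ?(ltW ep) //; lra.
have th1 : th <= 1.
  apply: sqr_le; rewrite // expr1n.
  have : 1 * th ^+ 2 <= x * th ^+ 2 by rewrite ler_wpM2r ?sqr_ge0.
  have : 100 * x * th ^+ 2 <= 1.
    by apply: le_trans eV _; rewrite invf_le1 //; lra.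
  lra.
have pow2 : 4 * e ^+ 2 * x <= (tau * D) ^+ (r.-1).*2.
  have h1 : 2 * e * y ^+ r.-1 <= (2 * y * e) ^+ r.-1.
    have -> : 2 * y * e = (2 * e) * y by ring.
    rewrite exprMn ler_wpM2r //.
    have -> : r.-1 = r.-2.+1 by case: (r) r2 => [|[|]].
    rewrite exprS ler_peMr ?exprn_ege1 //; lra.
  have h2 : (2 * y * e) ^+ r.-1 <= (tau * D) ^+ r.-1.
    by apply: lerXn2r => //; rewrite nnegrE; lra.
  rewrite -muln2 exprM xE.
  have -> : 4 * e ^+ 2 * (y ^+ r.-1) ^+ 2 = (2 * e * y ^+ r.-1) ^+ 2 by ring.
  by apply: lerXn2r; rewrite ?nnegrE ?(le_trans h1) // ?mulr_ge0 // ?exprn_ge0; lra.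
have eV0 : 0 < e^-1 by rewrite invr_gt0.
have eVe : e^-1 * e = 1 by rewrite mulVf ?gt_eqF.
have pow1 : 4 * e * x <= e^-1 * (tau * D) ^+ r.*2.-2.
  have -> : r.*2.-2 = (r.-1).*2 by case: (r) => [|?].
  have := ler_wpM2l (ltW eV0) pow2.
  have -> : e^-1 * (4 * e ^+ 2 * x) = e^-1 * e * (4 * e * x) by ring.
  by rewrite eVe mul1r.
have ex : 5 * x <= e * x by rewrite ler_wpM2r // ltW.
have powf : 100 * x <= e^-1 * (tau * D) ^+ r.*2.-1.
  have -> : r.*2.-1 = r.*2.-2.+1 by case: (r) r2 => [|[|]].
  rewrite exprSr (mulrA e^-1).
  have ye5 : 5 <= y * e by apply: (le_trans eR); rewrite ler_peMl // ltW.
  have tD5 : 10 <= tau * D by apply: le_trans tD2; move: ye5; lra.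
  apply: le_trans (_ : 4 * e * x * 10 <= _); first by lra.
  by apply: ler_pM => //; rewrite !mulr_ge0 // ltW.
have eps1 : e^-1 <= 1 by rewrite invf_le1 //; lra.
have hq' : Gc * (th / D) <= y ^+ r.-1.
  by apply: le_trans hq1; rewrite mulrCA mulrC ler_wpM2r // ltW.
have hM' : 2 * y <= e^-1 * (tau * D).
  have := ler_wpM2l (ltW eV0) tD2.
  have -> : e^-1 * (2 * y * e) = e^-1 * e * (2 * y) by ring.
  by rewrite eVe mul1r.
have hfull' : 2 / (B * D) <= e^-1 * (tau * D) ^+ r.*2.-1 by apply: le_trans powf.
have hone' : 2 / (B * D) * th <= e^-1 * (tau * D) ^+ r.*2.-2.
  apply: le_trans (_ : 100 * x * th <= _); first by rewrite ler_wpM2r // ltW.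
  apply: (le_trans hq1); apply: le_trans pow1.
  apply: le_trans (_ : x <= _); last by lra.
  by rewrite xE expr2 ler_peMr // exprn_ege1.
have htwo' : 2 / (B * D) * th ^+ 2 <= e^-1.
  by apply: le_trans eV; rewrite ler_wpM2r ?sqr_ge0.
have hrep' : Gc * th ^+ 2 / D <= e^-1.
  by apply: le_trans eV; rewrite mulrAC ler_wpM2r ?sqr_ge0.
by split; split.
Qed.

(** The number of events in [core_exists] plus 5: with eps = 1 / e their proportions add up to less
    than 1, and e >= 5 absorbs numerical constants. *)
Definition event_const l := (2 ^ l + 2 * (l * l) + 5)%N.

Section FindCycle.
Variables (R : rcfType) (E V : finType) (a b c : E -> V) (es : E -> {set V}).
Hypothesis hes : forall e, es e = [set a e; b e; c e].
Hypothesis hab : forall e f, a e != b f.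
Hypothesis hac : forall e f, a e != c f.
Hypothesis hbc : forall e f, b e != c f.
Hypothesis hinj : forall e f, a e = a f -> b e = b f -> c e = c f -> e = f.
Variables (r k : nat) (F : {set E}) (N0 : R).
Hypothesis r2 : (2 <= r)%N.
Hypothesis k0 : (0 < k)%N.
Notation l := r.*2.
Notation n := (k ^ (r.-1).*2)%N.
Notation ee := (event_const l).
Hypothesis ha : (#|[set a x | x in F]| <= n)%N.
Hypothesis hb : (#|[set b x | x in F]| <= n)%N.
Hypothesis hN0 : 1000 * 1000 * 1000 * ee%:R * n%:R ^+ 2 <= N0.
Hypothesis hN : N0 / 2 <= #|F|%:R.
Hypothesis hN' : #|F|%:R <= N0.
Hypothesis hl : (#|F| <= 12 * #|light F a b|)%N.

Let B := 4 * l%:R / N0.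
Let tau := 400 * n%:R * k%:R * ee%:R / N0.
Let D : R := #|F|%:R / (100 * n%:R).
Let th : R := Num.sqrt (200 * 200 * n%:R / #|F|%:R).

Lemma find_cycle w : sparse r B w ->
  exists t, [/\ size t = l, all (mem F) t, loose_tuple es l t &
    forall m, size m = l -> (2 <= count id m)%N -> ~~ psat B tau w (pat m t)].
Proof.
move=> sw.
have n0 : (0 < n)%N by rewrite expn_gt0 k0.
have nR : 1 <= n%:R :> R by rewrite ler1n.
have kR : 1 <= k%:R :> R by rewrite ler1n.
have eR : 5 <= ee%:R :> R by rewrite ler_nat /event_const; apply: leq_addl.
have n2 : 1 <= n%:R ^+ 2 :> R by rewrite exprn_ege1.
have lR : 4 <= l%:R :> R by rewrite ler_nat -[4%N]/(2.*2)%N leq_double.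
have hA := hN0; have hB := hN; have hC := hN'.
set x := n%:R in nR n2 hA *; set y := k%:R in kR *; set e := ee%:R in eR hA *.
set N := #|F|%:R in hB hC *.
have [Np hNe] := edge_count_large nR eR hA hB.
have N00 : 0 < N0 by apply: lt_le_trans Np hC.
have F0 : (0 < #|F|)%N by move: Np; rewrite /N ltr0n.
have [xp yp ep] : [/\ 0 < x, 0 < y & 0 < e] by split; [apply: lt_le_trans nR|apply: lt_le_trans kR|apply: lt_le_trans eR].
have LF : light F a b \subset F by apply/subsetP => f; rewrite inE => /andP[].
have [G [GF G0 dGa dGb dGc]] := @clean R E V F (light F a b) a b n LF F0 n0 hl ha hb.
rewrite -/N -/x in dGa dGb dGc.
have [D0 th2] : 0 < D /\ th ^+ 2 = 200 * 200 * x / N.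
  split; first by rewrite divr_gt0 // mulr_gt0.
  by rewrite sqr_sqrtr // divr_ge0 ?mulr_ge0 // ltW.
have th0 : 0 < th by rewrite sqrtr_gt0 divr_gt0 // !mulr_gt0.
have thx := theta_small nR eR hA hB th2.
have NGN : #|G|%:R <= N.
  by rewrite ler_nat; apply: subset_leq_card; apply: subset_trans GF LF.
pose pt (s : bool) := if s then b else a.
have dG s f : f \in G -> (vdeg F (pt s) f)%:R / 100 + N / (100 * x) <= (edeg G pt s f)%:R.
  by move=> fG; case: s; [apply: dGb|apply: dGa].
have hdeg s f : f \in G -> D <= (edeg G pt s f)%:R.
  by move=> fG; apply: le_trans (dG s f fG); rewrite lerDr divr_ge0.
(* An edge of this set is light in [F]; codegrees only decrease from [F] to [G], while by [clean]
   the degrees keep a hundredth of their size. *)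
have hcod s f g : f \in G -> g \in G ->
    #|[set h in G | (pt s h == pt s f) && (pt (~~ s) h == pt (~~ s) g)]|%:R
      <= th * (edeg G pt s f)%:R.
  move=> fG gG; set X := [set h in G | _].
  have [->|[h]] := set_0Vmem X; first by rewrite cards0 mulr_ge0 // ltW.
  rewrite inE => /and3P[hG /eqP hf /eqP hg].
  have hL : h \in light F a b by apply: subsetP GF _ hG.
  have XC : (#|X| <= pdeg F a b h)%N.
    apply/subset_leq_card/subsetP => h'; rewrite !inE -hf -hg => /and3P[h'G h1 h2].
    rewrite (subsetP (subset_trans GF LF)) //=.
    by move: h1 h2; case: (s) => /= -> ->.
  have dd : (#|X| ^ 2 <= 4 * vdeg F (pt s) h)%N.
    apply: leq_trans (_ : pdeg F a b h ^ 2 <= _)%N; first by rewrite leq_sqr.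
    by move: hL; rewrite inE => /and3P[_ h1 h2]; case: (s).
  have := dG s h hG.
  have -> : edeg G pt s h = edeg G pt s f by rewrite /edeg hf.
  set d := (edeg _ _ _ _)%:R; move=> hd.
  have ddR : #|X|%:R ^+ 2 <= 4 * (vdeg F (pt s) h)%:R :> R by rewrite -natrX -natrM ler_nat.
  apply: sqr_le; first by rewrite mulr_ge0 // ltW.
  by rewrite exprMn; apply: (codegree_budget xp Np th2 _ ddR hd).
have xE : x = y ^+ r.-1 ^+ 2 by rewrite /x natrX -muln2 exprM.
have a00 : 0 < N / (100 * x ^+ 2) by rewrite divr_gt0 // mulr_gt0 // exprn_gt0.
have hinjG f g : f \in G -> g \in G -> (forall s, pt s f = pt s g) -> c f = c g -> f = g.
  by move=> _ _ h hcc; apply: hinj => //; [apply: (h false)|apply: (h true)].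
have hzG f : f \in G -> N / (100 * x ^+ 2) <=
    #|[set g in G | (pt false g == pt false f) && (pt true g == pt true f)]|%:R.
  by move=> fG; apply: le_trans (dGc f fG) _; rewrite lexx.
have hB2 : N0 <= 2 * N by move: hB; rewrite ler_pdivrMr // mulrC.
have hcol' := multiplicity_budget xp ep hNe.
have := cycle_parameters (k := k) (r := r) nR kR eR lR Np hC hB2 (ltW th0) thx r2 xE (ler0n R _) NGN.
rewrite -/y -/tau -/B -/D => -[[B0 tau0 th1 eps1 hq'] [hM' hfull' hone' htwo' hrep']].
have eV0 : 0 < e^-1 by rewrite invr_gt0.
have hsum' : (2 ^ l + 2 * (l * l))%:R * e^-1 < 1 :> R.
  by rewrite ltr_pdivrMr // mul1r ltr_nat /event_const -[ltnLHS]addn0 ltn_add2l.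
have /card_gt0P[x0 _] := G0.
have [t [st tp tm tC tz]] := core_exists D0 th0 th1 hdeg hcod a00 hinjG hzG r2
  B0 tau0 kR eV0 eps1 hq' hM' hfull' hone' htwo' hrep' hcol' G0 x0 hsum' sw.
have [tG tL] := walk_loose (ltnW r2) hes hab hac hbc st tp tC tz.
exists t; split=> //.
apply: sub_all tG => f; apply: subsetP; exact: subset_trans GF LF.
Qed.

End FindCycle.

Lemma marg_single_sum (R : realFieldType) (E : finType) i j (w : seq E -> R) :
  \sum_e marg (nseq i None ++ Some e :: nseq j None) w = tot (i + j.+1) w.
Proof.
elim: i w => [|i IH] w; first by rewrite totS; apply: eq_bigr => e _; rewrite /= marg_nseq.
by rewrite addSn totS exchange_big; apply: eq_bigr => e _ /=; rewrite -IH.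
Qed.

Lemma pat_single (E : finType) (x0 : E) m t : size m = size t -> count id m = 1%N ->
  exists2 i, (i < size m)%N &
    pat m t = nseq i None ++ Some (nth x0 t i) :: nseq (size m - i.+1) None.
Proof.
elim: m t => [|[] m IH] [|e t] //= [st].
  move=> [/eqP cm]; exists 0%N => //; rewrite subn1 /=; congr cons.
  elim: m t st cm {IH} => [|[] m IH] [|e' t] //= [st] cm.
  by rewrite IH.
rewrite add0n => /(IH _ st)[i im ->]; exists i.+1 => //.
Qed.

Section CoverStep.
Variables (R : archiRcfType) (E V : finType) (v1 v2 v3 : E -> V) (es : E -> {set V}).
Hypothesis hes : forall e, es e = [set v1 e; v2 e; v3 e].
Hypothesis h12 : forall e f, v1 e != v2 f.
Hypothesis h13 : forall e f, v1 e != v3 f.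
Hypothesis h23 : forall e f, v2 e != v3 f.
Hypothesis hinj : forall e f, v1 e = v1 f -> v2 e = v2 f -> v3 e = v3 f -> e = f.
Variables (r k : nat).
Hypothesis r2 : (2 <= r)%N.
Notation l := r.*2.
Notation n := (k ^ (r.-1).*2)%N.
Notation ee := (event_const l).
Hypothesis i1 : (#|[set v1 x | x in [set: E]]| <= n)%N.
Hypothesis i2 : (#|[set v2 x | x in [set: E]]| <= n)%N.
Hypothesis i3 : (#|[set v3 x | x in [set: E]]| <= n)%N.
Hypothesis kbig : 1000 * 4 * l%:R * cconst R l.-1 <= k%:R.

(** By [light_sum] one of the three pairs of classes is light on a twelfth of [F]. The walk runs
    through these two classes, and the third supplies the private vertices. *)
Lemma find_cycle3 (F : {set E}) (N0 : R) w :
  (0 < k)%N -> 1000 * 1000 * 1000 * ee%:R * n%:R ^+ 2 <= N0 ->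
  N0 / 2 <= #|F|%:R -> #|F|%:R <= N0 -> sparse r (4 * l%:R / N0) w ->
  exists t, [/\ size t = l, all (mem F) t, loose_tuple es l t &
    forall m, size m = l -> (2 <= count id m)%N ->
      ~~ psat (4 * l%:R / N0) (400 * n%:R * k%:R * ee%:R / N0) w (pat m t)].
Proof.
move=> k0 hA hB hC sw.
have iF (v : E -> V) : (#|[set v x | x in [set: E]]| <= n)%N -> (#|[set v x | x in F]| <= n)%N.
  by apply: leq_trans; apply/subset_leq_card/imsetS/subsetT.
have := @light_sum E V F v1 v2 v3; move=> /(_ _) hl.
have {hl} : (#|F| <= 4 * (#|light F v1 v2| + #|light F v1 v3| + #|light F v2 v3|))%N.
  by apply: hl => e f _ _; apply: hinj.
have [h|h12'] := leqP #|F| (12 * #|light F v1 v2|).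
  by move=> _; apply: (@find_cycle R E V v1 v2 v3 es); rewrite ?iF.
have [h|h13'] := leqP #|F| (12 * #|light F v1 v3|).
  move=> _; apply: (@find_cycle R E V v1 v3 v2 es); rewrite ?iF //.
  - by move=> e; rewrite hes -setUA [X in _ :|: X]setUC setUA.
  - by move=> e f; rewrite eq_sym.
  - by move=> e f ? ? ?; apply: hinj.
move=> hs; apply: (@find_cycle R E V v2 v3 v1 es); rewrite ?iF //.
- by move=> e; rewrite hes -setUA setUC.
- by move=> e f; rewrite eq_sym.
- by move=> e f; rewrite eq_sym.
- by move=> e f ? ? ?; apply: hinj.
- by lia.
Qed.

(** A balanced measure of mass 1, built by [greedy], is fed to [container]. The number 400 n k e of
    selected elements is tau |F0|. *)
Lemma cover_step (F0 : {set E}) :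
  1000 * 1000 * 1000 * ee%:R * n%:R ^+ 2 <= #|F0|%:R :> R ->
  covered F0
    (fun I => forall t, size t = l -> all (mem I) t -> ~ loose_tuple es l t)
    ((#|F0|.+1 ^ (400 * n * k * ee)) ^ l.-1)
    (#|F0|%:R - #|F0|%:R / (4 * l%:R * cconst R l.-1)).
Proof.
move=> hA.
have c8 : 8 <= cconst R l.-1 := cconst_ge8 R l.-1.
have lE : l.-1.+1 = l by rewrite prednK // double_gt0 ltnW.
have l4 : (4 <= l)%N by rewrite -[4%N]/(2.*2)%N leq_double.
have lR : 4 <= l%:R :> R by rewrite ler_nat.
have k0 : (0 < k)%N.
  have : 0 < k%:R :> R.
    by apply: lt_le_trans kbig; rewrite !mulr_gt0 //; [apply: lt_le_trans lR|apply: lt_le_trans c8].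
  by rewrite ltr0n.
have n0 : (0 < n)%N by rewrite expn_gt0 k0.
have e0 : (0 < ee)%N by rewrite /event_const addn_gt0 orbT.
set c := cconst R l.-1 in c8 *; set N0 : R := #|F0|%:R in hA *.
have N00 : 0 < N0 by apply: lt_le_trans hA; rewrite !mulr_gt0 ?exprn_gt0 ?ltr0n.
pose B := 4 * l%:R / N0; pose tau := 400 * n%:R * k%:R * ee%:R / N0.
have lp : 0 < l%:R :> R by apply: lt_le_trans lR.
have B0 : 0 < B by rewrite divr_gt0 // mulr_gt0.
have tau0 : 0 < tau by rewrite divr_gt0 // !mulr_gt0 // ltr0n.
have [w bw tw] : exists2 w, balanced F0 l B tau (loose_tuple es l) w & tot l w = 1.
  apply: greedy => // w bw tw; have [w0 wF wg wm] := bw.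
  pose sg (i : nat) e := nseq i None ++ Some e :: nseq (l - i.+1) (None : option E).
  have psg i e : psize (sg i e) = 1%N.
    by rewrite /psize count_cat /= !count_nseq !mul0n.
  (* This settles the masks with one prescribed position. As B = 4 l / N0, at most 2 / B = N0 / (2
     l) edges are saturated at each position, so half of [F0] remains. *)
  pose F := [set e in F0 | [forall i : 'I_l, ~~ psat B tau w (sg i e)]].
  have FF0 : F \subset F0 by apply/subsetP => e; rewrite inE => /andP[].
  have bad (i : 'I_l) : #|[set e | psat B tau w (sg i e)]|%:R * (2 * l%:R) <= N0.
    have h : #|[set e | psat B tau w (sg i e)]|%:R * (B / 2) <= 1.
      apply: le_trans tw.
      have il : l = (i + (l - i.+1).+1)%N by rewrite subnSK // subnKC // ltnW.
      rewrite [X in _ <= tot X _]il -marg_single_sum mulr_natl -sumr_const big_mkcond; apply: ler_sum => e _.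
      rewrite inE; case: ifP => [|_].
        by rewrite /psat psg expr0 mulr1 => /ltW.
      apply: marg_ge0 => s; rewrite size_cat /= !size_nseq => hs; apply: w0.
      by rewrite hs subnSK // subnKC // ltnW.
    move: h; rewrite /B mulrA ler_pdivrMr // mul1r mulrA ler_pdivrMr // => h.
    by lra.
  have hB : N0 / 2 <= #|F|%:R.
    have h : (#|F0| <= #|F| + \sum_(i < l) #|[set e | psat B tau w (sg i e)]|)%N.
      rewrite -(cardsID F F0) (setIidPr FF0) leq_add2l.
      apply: leq_trans (_ : #|\bigcup_(i < l) [set e | psat B tau w (sg i e)]| <= _)%N.
        apply/subset_leq_card/subsetP => e; rewrite !inE => /andP[+ eF].
        rewrite eF /= => /forallPn[i]; rewrite negbK => hi.
        by apply/bigcupP; exists i => //; rewrite inE.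
      elim/big_ind2: _ => [|a A b' A' h1 h2|i _]; rewrite ?cards0 //.
      by apply: leq_trans (leq_card_setU _ _) (leq_add h1 h2).
    have hs : (\sum_(i < l) #|[set e | psat B tau w (sg i e)]|)%:R * (2 * l%:R) <= N0 * l%:R.
      rewrite natr_sum mulr_suml; apply: le_trans (_ : \sum_(i < l) N0 <= _).
        by apply: ler_sum => i _; apply: bad.
      by rewrite sumr_const card_ord mulr_natr.
    move: h; rewrite -(ler_nat R) natrD -/N0 => h.
    move: hs; rewrite mulrA ler_pM2r // => hs; lra.
  have sw : sparse r B w.
    split=> //.
    by move=> p sp pp; have := wm p sp; rewrite pp expr0 mulr1; apply.
  have hC : #|F|%:R <= N0 by rewrite ler_nat subset_leq_card.
  have [t [st tF tl ts]] := find_cycle3 k0 hA hB hC sw.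
  exists t; split=> //; first by apply: sub_all tF => e; apply: subsetP.
  move=> m sm; rewrite leq_eqVlt => /orP[/eqP cm|]; last exact: ts.
  case: t st tF tl ts => [|x0 t] st tF tl ts; first by rewrite -st in lp; rewrite ltxx in lp.
  have [i im ->] := @pat_single E x0 m (x0 :: t) (etrans sm (esym st)) (esym cm).
  rewrite sm in im; have : nth x0 (x0 :: t) i \in F.
    by apply: (allP tF); rewrite mem_nth // st.
  by rewrite inE => /andP[_ /forallP/(_ (Ordinal im))]; rewrite /sg sm.
have [w0 wF wg wm] := bw.
have tF : tau * #|F0|%:R <= (400 * n * k * ee)%:R.
  by rewrite /tau divfK ?gt_eqF // !natrM.
have sp : spread F0 tau l.-1.+1 w B 1 by rewrite lE; split=> //; rewrite tw.
have := container tau0 tF B0 ltr01 sp.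
have -> : 1 / (B * cconst R l.-1) = N0 / (4 * l%:R * c).
  by rewrite /B -/c; field; rewrite !gt_eqF //; apply: lt_le_trans c8.
move=> h; apply: covered_sub (leqnn _) (lexx _) (h _).
  move=> I hI s ss sI; apply/eqP/negPn/negP => ns; apply: (hI s) => //; first by rewrite ss lE.
  by apply: wg; rewrite // ss lE.
have -> : 2 * tau * #|F0|%:R * B * cconst R l.-1 =
    (n%:R * ee%:R * k%:R) * (800 * 4 * l%:R * c) / N0.
  by rewrite /tau /B -/N0 -/c; field; rewrite gt_eqF.
rewrite ler_pdivrMr // mul1r; apply: le_trans hA.
(* One factor k replaces the constants, by [kbig], and k^2 <= n, which holds since l >= 4, leaves
   n^2 e. *)
have nk : (k * k <= n)%N.
  by rewrite mulnn leq_pexp2l // -[2%N]/(1.*2)%N leq_double -ltnS prednK // ltnW.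
have hk : 800 * 4 * l%:R * c <= k%:R.
  apply: le_trans kbig; rewrite -/c -!mulrA ler_wpM2r //; last by rewrite ler_nat.
  by rewrite !mulr_ge0 ?ler0n //; lra.
apply: le_trans (_ : n%:R * ee%:R * (k%:R * k%:R) <= _).
  by rewrite [leRHS]mulrA ler_wpM2l // !mulr_ge0.
rewrite -(natrM _ k k); apply: le_trans (_ : n%:R * ee%:R * n%:R <= _).
  by rewrite ler_wpM2l ?ler_nat // mulr_ge0.
rewrite expr2 !mulrA ler_wpM2r // mulrC ler_wpM2r // ler_peMl //.
by rewrite !mulr_ege1 // ler1n.
Qed.

End CoverStep.

Fixpoint cnat n : nat := if n is n'.+1 then (2 ^ n'.+4 * cnat n')%N else 8.

Lemma cconstE (R : realFieldType) n : cconst R n = (cnat n)%:R.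
Proof. by elim: n => //= n ->; rewrite natrM natrX. Qed.

Lemma covered_flatten (R : realFieldType) (E : finType) (F : {set E})
    (P : {set E} -> Prop) (cs : seq {set E}) (k : nat) (b : R) :
  (forall C, C \in cs -> C \subset F) ->
  (forall C, C \in cs -> covered C P k b) ->
  exists ds : seq {set E},
    [/\ (size ds <= size cs * k)%N, forall D, D \in ds -> D \subset F /\ #|D|%:R <= b &
      forall (I : {set E}), P I -> (exists2 C, C \in cs & I \subset C) ->
        exists2 D, D \in ds & I \subset D].
Proof.
elim: cs => [|C cs IH] sF cv; first by exists [::]; split=> // I _ [].
have [|D hD|ds [s1 d1 c1]] := IH.
- by move=> D hD; apply: sF; rewrite inE hD orbT.
- by apply: cv; rewrite inE hD orbT.
have [ds' [s2 d2 c2]] := cv C (mem_head _ _).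
exists (ds' ++ ds); split.
- by rewrite size_cat mulSn leq_add.
- move=> D; rewrite mem_cat => /orP[/d2[DC Db]|/d1//]; split=> //.
  by apply: subset_trans DC (sF _ (mem_head _ _)).
- move=> I PI [D]; rewrite inE => /orP[/eqP->|Dc] ID.
    by have [D' hD' ID'] := c2 I ID PI; exists D' => //; rewrite mem_cat hD'.
  by have [|D' hD' ID'] := c1 I PI; [exists D|exists D' => //; rewrite mem_cat hD' orbT].
Qed.

(** * The upper bound *)

Section CoverIter.
Variables (R : archiRcfType) (E V : finType) (v1 v2 v3 : E -> V) (es : E -> {set V}).
Hypothesis hes : forall e, es e = [set v1 e; v2 e; v3 e].
Hypothesis h12 : forall e f, v1 e != v2 f.
Hypothesis h13 : forall e f, v1 e != v3 f.
Hypothesis h23 : forall e f, v2 e != v3 f.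
Hypothesis hinj : forall e f, v1 e = v1 f -> v2 e = v2 f -> v3 e = v3 f -> e = f.
Variables (r k : nat).
Hypothesis r2 : (2 <= r)%N.
Notation l := r.*2.
Notation n := (k ^ (r.-1).*2)%N.
Notation ee := (event_const l).
Hypothesis i1 : (#|[set v1 x | x in [set: E]]| <= n)%N.
Hypothesis i2 : (#|[set v2 x | x in [set: E]]| <= n)%N.
Hypothesis i3 : (#|[set v3 x | x in [set: E]]| <= n)%N.
Hypothesis kbig : (1000 * 4 * l * cnat l.-1 <= k)%N.

Definition loose_free (I : {set E}) :=
  forall t, size t = l -> all (mem I) t -> ~ loose_tuple es l t.

Let dn := (4 * l * cnat l.-1)%N.
Let S := ((#|E|.+1 ^ (400 * n * k * ee)) ^ l.-1)%N.

(** Each application of [cover_step] shrinks the containers by the factor 1 - 1/dn; those already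
    below its size threshold, and hence below [b], are kept. *)
Lemma cover_iter j (F0 : {set E}) (b : R) :
  1000 * 1000 * 1000 * ee%:R * n%:R ^+ 2 <= b ->
  (1 - dn%:R^-1) ^+ j * #|F0|%:R <= b ->
  covered F0 loose_free (S ^ j) b.
Proof.
move=> hb; elim: j F0 => [|j IH] F0 hj.
  apply: (covered_one (C := F0)) => //.
  by move: hj; rewrite expr0 mul1r.
have S0 : (0 < S)%N by rewrite !expn_gt0.
have [hF|hF] := leP (1000 * 1000 * 1000 * ee%:R * n%:R ^+ 2) (#|F0|%:R : R); last first.
  apply: (@covered_sub R E F0 loose_free _ 1 _ b) => //; first by rewrite expn_gt0 S0.
  by apply: (covered_one (C := F0)) => //; apply: ltW; apply: lt_le_trans hb.
have kb : 1000 * 4 * l%:R * cconst R l.-1 <= k%:R.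
  by rewrite cconstE -!natrM ler_nat.
have [cs [h1 h2 h3]] := cover_step hes h12 h13 h23 hinj r2 i1 i2 i3 kb hF.
have [||ds [g1 g2 g3]] := @covered_flatten R E F0 loose_free cs (S ^ j) b.
- by move=> C /h2[].
- move=> C /h2[CF hC]; apply: IH; apply: le_trans hj.
  rewrite exprSr -mulrA ler_wpM2l //.
    rewrite exprn_ge0 // subr_ge0 invf_le1 ?ler1n ?ltr0n;
      by rewrite /dn !muln_gt0 /= double_gt0 (ltnW r2) -(ltr0n R) -cconstE;
         apply: lt_le_trans (cconst_ge8 R _).
  apply: le_trans hC _; rewrite mulrBl mul1r lerD2l lerN2 mulrC.
  by rewrite /dn !natrM cconstE.
exists ds; split=> //.
  apply: leq_trans g1 _; rewrite expnS leq_mul2r; apply/orP; right.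
  by apply: leq_trans h1 _; do 2 apply: leq_expl; rewrite ltnS max_card.
by move=> I IF hI; apply: g3 => //; apply: h3.
Qed.

End CoverIter.

Local Open Scope nat_scope.

Lemma loose_tuple_copy (E V U : finType) (es : E -> {set V}) (G : {set {set V}})
    (C : {set {set U}}) l t :
  2 < l -> loose_cycle 3 l C -> loose_tuple es l t -> size t = l ->
  (forall f, f \in t -> es f \in G) -> contains_copy C G.
Proof.
move=> l2 /(loose_cycle_coords l2)[v [w [CE vinj winj vw cov]]].
move=> [x0 [c [z [tE cinj zinj cz]]]] st tG.
pose f := [ffun u => if [pick i | u == v i] is Some i then c (val i) else
   if [pick i | u == w i] is Some i then z (val i) else c 0].
have fv i : f (v i) = c i.
  rewrite ffunE; case: pickP => [j /eqP/vinj ->//|/(_ i)]; by rewrite eqxx.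
have fw i : f (w i) = z i.
  rewrite ffunE; case: pickP => [j /eqP h|_]; first by have := vw j i; rewrite -h eqxx.
  case: pickP => [j /eqP/winj ->//|/(_ i)]; by rewrite eqxx.
have inj2 (g : nat -> V) : (forall i j, i < j < l -> g i != g j) ->
    forall i j : 'I_l, g i = g j -> i = j.
  move=> gi i j gij; apply: val_inj => /=.
  case: (ltngtP i j) => // ij.
    by have := gi i j; rewrite ij ltn_ord gij eqxx => /(_ isT).
  by have := gi j i; rewrite ij ltn_ord gij eqxx => /(_ isT).
apply/existsP; exists f; apply/andP; split.
  apply/injectiveP => u u'.
  case: (cov u) => -[i ->]; case: (cov u') => -[j ->]; rewrite ?fv ?fw.
  - by move=> /(inj2 _ cinj) ->.
  - by move=> h; have := cz i j (ltn_ord i) (ltn_ord j); rewrite h eqxx.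
  - by move=> h; have := cz j i (ltn_ord j) (ltn_ord i); rewrite h eqxx.
  - by move=> /(inj2 _ zinj) ->.
apply/forall_inP => A; rewrite CE => /imsetP[i _ ->].
rewrite !imsetU !imset_set1 !fv fw /= -tE //; apply: tG.
by rewrite mem_nth // st ltn_mod (leq_ltn_trans _ (ltn_ord i)).
Qed.

Local Open Scope ring_scope.

(** Bernoulli gives (1 + 1/d)^d >= 2, and the product with (1 - 1/d)^d is at most 1. *)
Lemma halving (R : realFieldType) d : (0 < d)%N -> (1 - d%:R^-1 : R) ^+ d <= 2^-1.
Proof.
move=> d0; have d0' : (0 : R) < d%:R by rewrite ltr0n.
have d1 : (d%:R^-1 : R) <= 1 by rewrite invf_le1 // ler1n.
have i0 : (0 : R) < d%:R^-1 by rewrite invr_gt0.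
have h : 2 <= (1 + d%:R^-1 : R) ^+ d.
  have bern m : 1 + m%:R * d%:R^-1 <= (1 + d%:R^-1 : R) ^+ m.
    elim: m => [|m IH]; first by rewrite mul0r addr0 expr0.
    have p : 0 <= (m%:R * d%:R^-1 * d%:R^-1 : R) by rewrite !mulr_ge0 // ltW.
    rewrite exprS -natr1; apply: le_trans (_ : (1 + d%:R^-1) * (1 + m%:R * d%:R^-1) <= _); last first.
      by rewrite ler_wpM2l // addr_ge0 // ltW.
    nra.
  by have := bern d; rewrite divff ?gt_eqF.
have p : (1 - d%:R^-1 : R) ^+ d * (1 + d%:R^-1) ^+ d <= 1.
  rewrite -exprMn; apply: exprn_ile1; nra.
rewrite -[leRHS]mul1r ler_pdivlMr //; apply: le_trans p; apply: ler_wpM2l => //.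
by rewrite exprn_ge0 // subr_ge0.
Qed.

Lemma loose_free_copyless (E V U : finType) (es : E -> {set V}) (G : {set {set V}})
    (C : {set {set U}}) r (I : {set E}) :
  (2 <= r)%N -> loose_cycle 3 r.*2 C -> (forall e, e \in I -> es e \in G) ->
  ~~ contains_copy C G -> loose_free es r I.
Proof.
move=> r2 hC hI nc t st tI lt; case/negP: nc.
apply: loose_tuple_copy hC lt st _ => [|f ft]; first by rewrite -(ltn_double 1) in r2; lia.
by apply: hI; move/allP: tI => /(_ f ft).
Qed.

Local Open Scope nat_scope.

(** In base 2, N+1 <= n^4 contributes 4 L s to the exponent and the dn L s rounds contribute another
    factor L; this is the origin of L^2. *)
Lemma container_count N s n k L ee l1 dn m :
  n ^ 3 = N -> 1 < n -> n <= 2 ^ (L * s) ->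
  4 * s * (400 * ee) * l1 * dn * s * (n * k * L ^ 2) + 1 < m ->
  ((((N.+1 ^ (400 * n * k * ee)) ^ l1) ^ (dn * (L * s)))).*2 < 2 ^ m.
Proof.
move=> Nn n1 nL hm.
have h1 : N.+1 <= 2 ^ (4 * (L * s)).
  apply: (@leq_trans (n ^ 4)); last by rewrite mulnC expnM leq_expl.
  by rewrite -Nn [in X in _ <= X]expnS; have : 0 < n ^ 3; [rewrite expn_gt0 (ltnW n1)|nia].
rewrite -!expnM -mul2n; apply: leq_ltn_trans (_ : 2 * 2 ^ (4 * (L * s) * (400 * n * k * ee * (l1 * (dn * (L * s))))) < _).
  by rewrite leq_mul2l [X in _ <= X]expnM leq_expl.
rewrite -expnS ltn_exp2l //; apply: leq_ltn_trans hm.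
by rewrite addn1 ltnS; apply: eq_leq; ring.
Qed.

Lemma ltn_budget a b c : 0 < c -> b * c + 1 < (a + b + 2) * c.
Proof. nia. Qed.

Lemma slice_budget T n k q L : n = k * q -> 0 < L ->
  8 * (T * n ^ 2) <= 8 * T * (n * k * L ^ 2) * q.
Proof.
move=> nkq L0; have -> : 8 * T * (n * k * L ^ 2) * q = 8 * (T * n ^ 2) * L ^ 2.
  by rewrite [n ^ 2]expnS expn1 {3}nkq; ring.
by rewrite leq_pmulr // expn_gt0 L0.
Qed.

Section Upper.
Variables (R : archiRcfType) (r : nat).
Hypothesis r2 : 2 <= r.
Notation l := r.*2.
Notation s := (r.-1).*2.

Definition container_const : nat := 1000 * 1000 * 1000 * event_const l.
(** The first summand is 8 times the expected number of triples in a container, the second counts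
    the containers as in [container_count], and 2 is slack. *)
Definition host_const : nat := 8 * container_const + 4 * s * (400 * event_const l) * l.-1 * (4 * l * cnat l.-1) * s + 2.

Lemma sparse_host k L : 1000 * 4 * l * cnat l.-1 <= k -> 1 < k -> 0 < L -> k <= 2 ^ L ->
  exists (V : finType) (H : {set {set V}}),
    [/\ uniform 3 H, #|H| = k ^ s * k ^ l.-1, max_degree H <= 8 * k ^ l.-1 &
      forall (U : finType) (C : {set {set U}}), loose_cycle 3 l C ->
        ex_in H C <= host_const * k ^ l.-1 * L ^ 2].
Proof.
move=> kbig k1 L0 kL.
set q := k ^ s.-1; set n := k ^ s.
have k0 : 0 < k by apply: ltnW.
have s0 : 0 < s by rewrite double_gt0 -ltnS prednK // (ltnW r2).
have nkq : n = k * q by rewrite /n /q -expnS prednK.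
have nk : n * k = k ^ l.-1.
  by rewrite /n -expnSr; congr (_ ^ _); case: (r) r2 => [|r'].
have n1 : 1 < n by rewrite /n -{1}(exp1n s) ltn_exp2r.
have nL : n <= 2 ^ (L * s) by rewrite /n expnM leq_expl.
pose E := ('I_n * 'I_n * ('I_k * 'I_q))%type.
have cE : #|{: E}| = n ^ 3 by rewrite !card_prod !card_ord -nkq !expnS expn0 muln1 mulnA.
pose dn := 4 * l * cnat l.-1.
have dn0 : 0 < dn.
  rewrite /dn !muln_gt0 /= double_gt0 (ltnW r2) /=; rewrite -(ltr0n R) -cconstE.
  by apply: lt_le_trans (cconst_ge8 R _).
have := @cover_iter R E _ (@vx n k q) (@vy n k q) (@vz n k q) (@tri n k q).
move=> /(_ (fun=> erefl)).
have h12 (e f : E) : vx e != vy f by [].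
have h13 (e f : E) : vx e != vz f by [].
have h23 (e f : E) : vy e != vz f by [].
have hinj (e f : E) : vx e = vx f -> vy e = vy f -> vz e = vz f -> e = f.
  by move: e f => [[a b] c] [[a' b'] c'] [->] [->] [->].
move=> /(_ h12 h13 h23 hinj r k r2).
have i1 : #|[set vx x | x in [set: E]]| <= n.
  rewrite -[X in _ <= X]card_ord -cardsT -(card_imset [set: 'I_n] (_ : injective (fun a => inl (inl a) : 'I_n + 'I_n + ('I_k * 'I_q)))).
    by apply/subset_leq_card/subsetP => _ /imsetP[x _ ->]; apply/imsetP; exists x.1.1; rewrite ?inE.
  by move=> a b [].
have i2 : #|[set vy x | x in [set: E]]| <= n.
  rewrite -[X in _ <= X]card_ord -cardsT -(card_imset [set: 'I_n] (_ : injective (fun a => inl (inr a) : 'I_n + 'I_n + ('I_k * 'I_q)))).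
    by apply/subset_leq_card/subsetP => _ /imsetP[x _ ->]; apply/imsetP; exists x.1.2; rewrite ?inE.
  by move=> a b [].
have i3 : #|[set vz x | x in [set: E]]| <= n.
  have nE : #|[set: 'I_k * 'I_q]| = n by rewrite cardsT card_prod !card_ord.
  rewrite -[X in _ <= X]nE -(card_imset [set: 'I_k * 'I_q] (_ : injective (fun a => inr a : 'I_n + 'I_n + ('I_k * 'I_q)))).
    by apply/subset_leq_card/subsetP => _ /imsetP[x _ ->]; apply/imsetP; exists x.2; rewrite ?inE.
  by move=> a b [].
(* By [halving], [L * s] rounds of [dn] steps shrink n^3 by the factor 2^(L s) >= n. *)
move=> /(_ i1 i2 i3 kbig (dn * (L * s)) [set: E] (container_const * n ^ 2)%:R).
case.
- by rewrite /container_const !natrM natrX.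
- rewrite cardsT cE exprM; apply: (@le_trans _ _ ((2^-1 : R) ^+ (L * s) * (n ^ 3)%:R)%R).
    rewrite ler_wpM2r //; apply: lerXn2r; rewrite ?nnegrE ?invr_ge0 ?ler0n ?halving //.
    by rewrite exprn_ge0 // subr_ge0 invf_le1 ?ler1n ?ltr0n.
  rewrite exprVn mulrC ler_pdivrMr ?exprn_gt0 // -natrX -natrM ler_nat [n ^ 3]expnS mulnC.
  by apply: leq_mul nL; rewrite leq_pmull // /container_const !muln_gt0 /= /event_const addn_gt0 orbT.
move=> cs [cs1 cs2 cs3].
pose m := host_const * (n * k) * L ^ 2.
have nkL : 0 < n * k * L ^ 2 by rewrite !muln_gt0 k0 (ltnW n1) ?L0.
have thr0 : 0 < container_const by rewrite /container_const !muln_gt0 /= /event_const addn_gt0 orbT.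
have mE : m = (8 * container_const + 4 * s * (400 * event_const l) * l.-1 * dn * s + 2) * (n * k * L ^ 2).
  by rewrite /m /host_const -mulnA.
have [|||h [hcs hst]] := @random_graph n k q cs m nkq (ltnW n1).
- rewrite mE; have L2 : 0 < L ^ 2 by rewrite expn_gt0 L0.
  apply: (@leq_trans (8 * container_const * (n * k * L ^ 2))); last by rewrite leq_mul2r -addnA leq_addr orbT.
  by rewrite -mulnA -mulnA leq_mul2l /=; apply: leq_trans (leq_pmull _ thr0); rewrite leq_pmulr.
- apply: leq_ltn_trans (@container_count _ s n k L (event_const l) l.-1 dn m (esym cE) n1 nL _).
    by rewrite leq_double.
  by rewrite mE; apply: ltn_budget.
- move=> D /cs2 [_]; rewrite ler_nat => hD.
  apply: (@leq_trans (8 * container_const * (n * k * L ^ 2) * q)); last first.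
    by rewrite mE leq_mul2r leq_mul2r -addnA leq_addr !orbT.
  by apply: leq_trans (slice_budget container_const nkq L0); rewrite leq_mul2l hD orbT.
exists _, [set tri e | e in graph h]; split.
- exact: tri_uniform.
- by rewrite card_imset ?card_graph -?nk ?mulnA //; exact: tri_inj.
- rewrite -nk mulnA; apply: max_degree_graph => [|z]; first by rewrite -mulnA leq_pmull.
  exact: ltnW (hst z).
move=> U C hC; apply/bigmax_leqP => G /andP[GH nc].
pose I := [set e in graph h | tri e \in G].
have GI : G = [set tri e | e in I].
  apply/setP => A; apply/idP/imsetP => [AG|[e]]; last by rewrite inE => /andP[_ eG] ->.
  by have /imsetP[e eh AE] := subsetP GH A AG; exists e; rewrite // inE eh -AE.
have [|D Dc ID] := cs3 I (subsetT _).
- by apply: (loose_free_copyless r2 hC _ nc) => e; rewrite inE => /andP[].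
rewrite GI card_imset; last exact: tri_inj.
rewrite -nk; apply: leq_trans (ltnW (hcs D Dc)).
apply/subset_leq_card; rewrite subsetI ID andbT.
by apply/subsetP => e; rewrite inE => /andP[].
Qed.

End Upper.

From mathcomp Require Import all_classical all_reals all_analysis.
Import Order.TTheory GRing.Theory Num.Theory.
Local Open Scope ring_scope.

(** * Real exponents *)

Section RealExponents.
Variable R : realType.
Implicit Types (eps d x : R).

Lemma powR_large eps c : 0 < eps -> exists D0 : nat, forall D : nat, (D0 <= D)%N ->
  (0 < D)%N /\ c <= (D%:R : R) `^ eps.
Proof.
move=> e0; pose c1 : R := Num.max c 1.
have c11 : 1 <= c1 by rewrite le_max lexx orbT.
exists (Num.trunc (c1 `^ eps^-1)).+1 => D hD; split; first exact: leq_trans hD.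
apply: le_trans (_ : c1 <= _); first by rewrite le_max lexx.
have h : c1 `^ eps^-1 <= D%:R.
  by apply/ltW; apply: lt_le_trans (truncnS_gt _) _; rewrite ler_nat.
have -> : c1 = (c1 `^ eps^-1) `^ eps.
  by rewrite -powRrM mulVf ?gt_eqF // powRr1 // (le_trans ler01).
by apply: ge0_ler_powR; rewrite ?nnegrE ?powR_ge0 //; apply: ltW.
Qed.

Lemma root_ceil (l D : nat) : (0 < l)%N -> (0 < D)%N -> exists s : nat,
  [/\ (0 < s)%N, (D <= s ^ l)%N & (s%:R : R) <= 2 * D%:R `^ l%:R^-1].
Proof.
move=> l0 D0.
have ex : exists s, (D <= s ^ l)%N.
  by exists D; case: l l0 => // l _; rewrite expnS leq_pmulr ?expn_gt0 ?D0.
case: (ex_minnP ex) => -[|t] hs smin; first by rewrite exp0n // leqNgt D0 in hs.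
exists t.+1; split=> //.
have d1 : (1 : R) <= D%:R `^ l%:R^-1 by rewrite -[leLHS](powRr0 (D%:R : R)) ler_powR ?ler1n ?invr_ge0.
suff : t%:R <= (D%:R : R) `^ l%:R^-1 by rewrite -natr1; lra.
have tD : (t ^ l <= D)%N.
  by rewrite leqNgt; apply/negP => h; have := smin t (ltnW h); rewrite ltnn.
have -> : (t%:R : R) = (t ^ l)%:R `^ l%:R^-1.
  rewrite natrX -powR_mulrn // -powRrM mulfV ?powRr1 //.
  by rewrite pnatr_eq0 -lt0n.
by apply: ge0_ler_powR; rewrite ?nnegrE ?invr_ge0 ?ler_nat.
Qed.

(** s^(l-1) is at most 2^(l-1) D^(1-1/l), and D^eps absorbs the constants. *)
Lemma lower_exponent (l D s : nat) eps : (0 < l)%N -> (0 < D)%N ->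
  (s%:R : R) <= 2 * D%:R `^ l%:R^-1 -> 96 * 2 ^+ l.-1 <= (D%:R : R) `^ eps ->
  D%:R `^ (- 1 + 1 / l%:R - eps) * (96 * s ^ l.-1)%:R <= (1 : R).
Proof.
move=> l0 D0 hs hD.
have d0 : (0 : R) < D%:R by rewrite ltr0n.
have lR : (l%:R : R) != 0 by rewrite pnatr_eq0 -lt0n.
have h : (s ^ l.-1)%:R <= 2 ^+ l.-1 * (D%:R : R) `^ (1 - 1 / l%:R).
  rewrite natrX; apply: le_trans (_ : (2 * (D%:R : R) `^ l%:R^-1) ^+ l.-1 <= _).
    by apply: lerXn2r; rewrite ?nnegrE ?mulr_ge0 ?powR_ge0.
  rewrite exprMn -(powR_mulrn (a := D%:R `^ l%:R^-1)) ?powR_ge0 // -powRrM.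
  have -> : l%:R^-1 * l.-1%:R = 1 - 1 / l%:R :> R.
    by rewrite -subn1 natrB // mulrBr mulVf // mul1r mulr1.
  by [].
apply: le_trans (_ : D%:R `^ (- 1 + 1 / l%:R - eps) * (96 * (2 ^+ l.-1 * (D%:R : R) `^ (1 - 1 / l%:R))) <= _).
  by rewrite ler_wpM2l ?powR_ge0 // natrM ler_wpM2l.
have -> : D%:R `^ (- 1 + 1 / l%:R - eps) * (96 * (2 ^+ l.-1 * (D%:R : R) `^ (1 - 1 / l%:R))) =
    96 * 2 ^+ l.-1 * (D%:R `^ (- 1 + 1 / l%:R - eps) * (D%:R : R) `^ (1 - 1 / l%:R)) by ring.
rewrite -powRD; last by rewrite (gt_eqF d0) implybT.
have -> : - 1 + 1 / l%:R - eps + (1 - 1 / l%:R) = - eps by ring.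
by rewrite powRN ler_pdivrMr ?powR_gt0 // mul1r.
Qed.

(** L is one more than the integer part n of the binary logarithm. With p > 4 / eps and j the
    integer part of n / p, L <= p (j+1), so u L^2 <= u p^2 (j+1)^2 <= 4^j 4^j = 2^(4j) <= 2^(p j
    eps) <= k^eps; large k is needed for u p^2 <= j. *)
Lemma log_sq_bound eps (u : nat) : 0 < eps -> exists k0 : nat, forall k : nat, (k0 <= k)%N ->
  exists L : nat, [/\ (0 < L)%N, (k <= 2 ^ L)%N & (u * L ^ 2)%:R <= (k%:R : R) `^ eps].
Proof.
move=> e0; pose p := (Num.trunc (4 / eps)).+1.
have pe : 4 <= p%:R * eps by rewrite -ler_pdivrMr //; apply/ltW; apply: truncnS_gt.
pose J := (u * p ^ 2)%N.
exists (2 ^ (p * J))%N => k hk.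
have k0 : (0 < k)%N by apply: leq_trans hk; rewrite expn_gt0.
pose n := trunc_log 2 k.
have n1 : (2 ^ n <= k)%N by apply: trunc_logP.
have n2 : (k < 2 ^ n.+1)%N by apply: trunc_log_ltn.
exists n.+1; split=> //; first exact: ltnW.
pose j := (n %/ p)%N.
have nj : (n.+1 <= p * j.+1)%N by rewrite mulnC -ltn_divLR.
have jJ : (J <= j)%N.
  rewrite leq_divRL // -ltnS mulnC; rewrite -(ltn_exp2l _ _ (isT : 1 < 2)%N).
  exact: leq_ltn_trans hk n2.
have h1 : (u * n.+1 ^ 2 <= 16 ^ j)%N.
  have a1 : (J <= 4 ^ j)%N by apply: leq_trans jJ _; apply: ltnW; apply: ltn_expl.
  have a2 : (j.+1 ^ 2 <= 4 ^ j)%N.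
    by rewrite (_ : 4 = 2 ^ 2)%N // expnAC leq_exp2r // ltn_expl.
  rewrite (_ : 16 = 4 * 4)%N // expnMn; apply: leq_trans (leq_mul a1 a2).
  by rewrite /J -mulnA -expnMn leq_mul2l leq_exp2r ?nj ?orbT.
apply: le_trans (_ : (16 ^ j)%:R <= _); first by rewrite ler_nat.
apply: le_trans (_ : ((2 ^ (p * j))%:R : R) `^ eps <= _); last first.
  apply: ge0_ler_powR; rewrite ?nnegrE //; first exact: ltW.
  rewrite ler_nat.
  by apply: leq_trans n1; rewrite leq_exp2l // mulnC leq_trunc_div.
have -> : ((2 ^ (p * j))%:R : R) = 2 `^ (p * j)%:R by rewrite natrX powR_mulrn.
have -> : ((16 ^ j)%:R : R) = 2 `^ (4 * j)%:R by rewrite powR_mulrn // -natrX expnM.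
rewrite -powRrM.
apply: ler_powR; first by rewrite ler1n.
by rewrite !natrM mulrAC ler_wpM2r.
Qed.

(** [D] has the order of k^(l-1), so D^(1-1/(l-1)) is at most a constant times k^(l-2), and D^eps
    exceeds k^eps. *)
Lemma upper_exponent (l D k : nat) eps : (1 < l)%N -> (0 < k)%N -> 0 < eps ->
  (k ^ l.-1 <= D)%N -> (D <= 8 * (2 * k) ^ l.-1)%N ->
  (k%:R : R) `^ eps <= D%:R `^ (- 1 + 1 / (l%:R - 1) + eps) * (8 * 2 ^ l.-1 * k ^ l.-2)%:R.
Proof.
move=> l1 k0 e0 h1 h2.
have kR : (0 : R) < k%:R by rewrite ltr0n.
have kR1 : (1 : R) <= k%:R by rewrite ler1n.
have D0 : (0 < D)%N by apply: leq_trans h1; rewrite expn_gt0 k0.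
have dR : (0 : R) < D%:R by rewrite ltr0n.
have lR : l%:R - 1 = l.-1%:R :> R by rewrite -subn1 natrB // ltnW.
have l0 : (0 < l.-1)%N by rewrite -ltnS prednK // ltnW.
have lR0 : (l.-1%:R : R) != 0 by rewrite pnatr_eq0 -lt0n.
pose a : R := 1 - 1 / l.-1%:R.
have a0 : 0 <= a by rewrite subr_ge0 mul1r invf_le1 ?ler1n ?ltr0n.
have a1 : a <= 1 by rewrite gerBl mul1r invr_ge0.
have hk : (k%:R : R) `^ eps <= D%:R `^ eps.
  apply: ge0_ler_powR; rewrite ?nnegrE //; first exact: ltW.
  rewrite ler_nat; apply: leq_trans h1.
  by rewrite -{1}(expn1 k) leq_pexp2l.
have hD : (D%:R : R) `^ a <= (8 * 2 ^ l.-1 * k ^ l.-2)%:R.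
  apply: le_trans (_ : ((8 * (2 * k) ^ l.-1)%:R : R) `^ a <= _).
    by apply: ge0_ler_powR; rewrite ?nnegrE ?ler_nat.
  rewrite expnMn mulnA !(natrM _ _ (k ^ _)) powRM //.
  apply: ler_pM; rewrite ?powR_ge0 //.
    have K1 : (1 : R) <= (8 * 2 ^ l.-1)%:R by rewrite ler1n muln_gt0 expn_gt0.
    by rewrite -[leRHS]powRr1 ?(le_trans ler01) // ler_powR.
  rewrite !natrX -powR_mulrn // -powRrM.
  have -> : l.-1%:R * a = l.-2%:R.
    by rewrite mulrBr mulr1 mul1r mulfV // -[l.-2]subn1 natrB.
  by rewrite powR_mulrn.
rewrite lR; have -> : - 1 + 1 / l.-1%:R + eps = eps + - a by rewrite /a; ring.
rewrite powRD; last by rewrite (gt_eqF dR) implybT.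
rewrite powRN -mulrA; apply: le_trans hk _; rewrite ler_peMr ?powR_ge0 //.
by rewrite mulrC ler_pdivlMr ?powR_gt0 // mul1r.
Qed.

End RealExponents.

(** For the largest admissible k the upper bound holds because 2k is no longer admissible. *)
Lemma largest_host (l k0 D : nat) : (0 < l)%N -> (0 < k0)%N -> (8 * k0 ^ l <= D)%N ->
  exists k, [/\ (k0 <= k)%N, (8 * k ^ l <= D)%N & (D <= 8 * (2 * k) ^ l)%N].
Proof.
move=> l0 k00 hD.
have bd k : (8 * k ^ l <= D)%N -> (k <= D)%N.
  move=> h; apply: leq_trans h; apply: leq_trans (leq_pmull _ _) => //.
  by case: (k) => // k'; rewrite -{1}(expn1 k'.+1) leq_pexp2l.
case: (ex_maxnP (ex_intro _ k0 hD) bd) => k hk kmax; exists k; split=> //; first exact: kmax.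
have k1 : (0 < k)%N by apply: leq_trans k00 (kmax _ hD).
rewrite leqNgt; apply/negP => h.
have := kmax (2 * k)%N (ltnW h); rewrite leqNgt ltn_Pmull //.
Qed.

Theorem theorem1p3 (R : realType) (l : nat) (hl : (3 <= l)%N)
    (U : finType) (C : {set {set U}}) (hC : loose_cycle 3 l C) :
  (forall eps : R, 0 < eps ->
     exists D0 : nat, forall D : nat, (D0 <= D)%N ->
       forall (V : finType) (H : {set {set V}}),
         uniform 3 H -> (max_degree H <= D)%N ->
         (ex_in H C)%:R >=
           (D%:R : R) `^ (- 1 + 1 / l%:R - eps) * #|H|%:R)
  /\
  (~~ odd l ->
   forall eps : R, 0 < eps ->
     exists D0 : nat, forall D : nat, (D0 <= D)%N ->
       exists (V : finType) (H : {set {set V}}),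
         [/\ uniform 3 H, (0 < #|H|)%N, (max_degree H <= D)%N &
           (ex_in H C)%:R <=
             (D%:R : R) `^ (- 1 + 1 / (l%:R - 1) + eps) * #|H|%:R]).
Proof.
split=> [eps e0|].
  have [D0 hD0] := powR_large (96 * 2 ^+ l.-1) e0.
  exists D0 => D /hD0[Dpos hD] V H unif maxD.
  have [s [s0 Ds sD]] := root_ceil R (ltnW (ltnW hl)) Dpos.
  have hH : (#|H| <= 96 * s ^ l.-1 * ex_in H C)%N.
    case: l hl hC Ds {D0 hD0 hD sD} => [|[|m]] // m0 hC' Ds.
    exact: (ex_in_lower m0 hC' unif maxD s0 Ds).
  apply: le_trans (_ : D%:R `^ (- 1 + 1 / l%:R - eps) * (96 * s ^ l.-1 * ex_in H C)%:R <= _).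
    by rewrite ler_wpM2l ?powR_ge0 // ler_nat.
  rewrite natrM mulrA -[leRHS]mul1r ler_wpM2r //.
  exact: (lower_exponent (ltnW (ltnW hl)) Dpos sD hD).
move=> ol eps e0.
have lr : l = l./2.*2 by rewrite -[LHS]odd_double_half (negPf ol).
have l2 : (1 < l)%N by apply: ltnW.
move: hl hC; rewrite {1 2}lr; set r := l./2 => hl hC'.
have r2 : (2 <= r)%N by lia.
(* Collects every constant in front of the logarithmic factor, so that k^eps can absorb all of them
   at once. *)
pose u := (host_const r * (8 * 2 ^ l.-1))%N.
have [k1 hk1] := log_sq_bound u e0.
pose k0 := maxn k1 (maxn 2 (1000 * 4 * r.*2 * cnat r.*2.-1)).
have l1 : (0 < l.-1)%N by rewrite lr -/r; lia.
exists (8 * k0 ^ l.-1)%N => D hD.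
have k00 : (0 < k0)%N by rewrite !leq_max orbT.
have [k [kk0 kD Dk]] := largest_host l1 k00 hD.
have kk1 : (k1 <= k)%N by apply: leq_trans kk0; rewrite leq_max leqnn.
have k2 : (1 < k)%N by apply: leq_trans kk0; rewrite !leq_max leqnn orbT.
have kbig : (1000 * 4 * r.*2 * cnat r.*2.-1 <= k)%N by apply: leq_trans kk0; rewrite !leq_max leqnn !orbT.
have [L [L0 kL hL]] := hk1 k kk1.
have [V [H [unif cH maxH exH]]] := sparse_host R r2 kbig k2 L0 kL.
rewrite -lr in cH maxH exH.
exists V, H; split=> //.
- by rewrite cH muln_gt0 !expn_gt0 ltnW.
- exact: leq_trans maxH kD.
have rs : (r.-1).*2 = l.-2 by rewrite lr -/r; lia.
have K0 : (0 : R) < (8 * 2 ^ l.-1)%:R by rewrite ltr0n muln_gt0 expn_gt0.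
rewrite -(ler_pM2r K0).
have exC : (ex_in H C * (8 * 2 ^ l.-1) <= u * L ^ 2 * k ^ l.-1)%N.
  apply: leq_trans (_ : host_const r * k ^ l.-1 * L ^ 2 * (8 * 2 ^ l.-1) <= _)%N.
    by rewrite leq_mul2r exH ?orbT // lr.
  by apply: eq_leq; rewrite /u; ring.
rewrite -natrM; apply: le_trans (_ : (u * L ^ 2 * k ^ l.-1)%:R <= _); first by rewrite ler_nat.
have hX : (k ^ l.-1 <= D)%N by apply: leq_trans kD; rewrite leq_pmull.
have := upper_exponent l2 (ltnW k2) e0 hX Dk.
move=> hE; rewrite natrM; apply: le_trans (_ : (k%:R `^ eps) * (k ^ l.-1)%:R <= _).
  by rewrite ler_wpM2r.
apply: le_trans (ler_wpM2r (ler0n R (k ^ l.-1)) hE) _.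
rewrite cH rs natrM [(k ^ l.-2 * _)%:R]natrM.
by rewrite le_eqVlt; apply/orP; left; apply/eqP; ring.
Qed.
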